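(* Let $a,d$ be integers with $a^2=4d$ and $d\ne\pm1$, and let $n\ge 3$, $m\ge 2$ be integers. Let $\ell$ be a prime divisor of $d$ with $\ell\nmid n$, and put $\rho=\operatorname{rad}(\gcd(d,n))$ and $\kappa=\operatorname{rad}(m\ell)$. Assume that $\gcd(\kappa,\rho)=1$. Let $\delta,\Lambda_n,\lambda_G$ be the constants defined in the context. Let $B,C>0$ be integers. If the abc-conjecture is true, then there are at least $$\Lambda_n\lambda_G\,\frac{\varphi(\kappa)}{\delta\,\ell\,\kappa^2\,\zeta(2)\,\rho^2}\,BC+o(BC)\qquad (B,C\to\infty)$$ pairs $(b,c)$ of integers with $1\le b\le B$ and $1\le c\le C$ such that both $$f(x)=x^n+ax^{n-1}+dx^{n-2}+b$$ and $$F(x)=(x^m+c)^n+a(x^m+c)^{n-1}+d(x^m+c)^{n-2}+b$$ are irreducible over $\mathbb{Q}$ and monogenic.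
   Context: A monic irreducible polynomial $h(x)\in\mathbb{Z}[x]$ with root $\theta$ is called monogenic if $\mathcal{O}_{\mathbb{Q}(\theta)}=\mathbb{Z}[\theta]$, where $\mathcal{O}_{\mathbb{Q}(\theta)}$ is the ring of algebraic integers of $\mathbb{Q}(\theta)$. $\operatorname{rad}(k)$ is the product of the distinct primes dividing $k$; $\varphi$ is Euler's function; $\zeta$ is the Riemann zeta function; $\nu_p$ is the $p$-adic valuation. The constant $\delta$ is $1$ if $2\mid dm$, and $4$ if $2\nmid dm$. Let $G(y)=(-n)^ny+4(n-2)^{n-2}\left(\frac a2\right)^n$ and $D_G=\gcd\{G(t):t\in\mathbb{Z}\}$. Let $D_G'$ be the smallest divisor of $D_G$ such that $D_G/D_G'$ is square-free. For each prime $p$ write $q_p=\nu_p(D_G')$, and let $\omega_G(p)$ be the number of integers $\alpha$ with $1\le\alpha\le p^{2+q_p}$ such that $G(\alpha)\equiv 0\pmod{p^2}$. Define $$\Lambda_n=\prod_{p\le\sqrt n}\frac1{p^2}\prod_{p>\sqrt n}\left(1-\frac n{p^2}\right),\qquad \lambda_G=\prod_{p\ \mathrm{prime}}\left(1-\frac{\omega_G(p)}{p^{2+q_p}}\right),$$ where the products run over primes $p$. The abc-conjecture: for every $\varepsilon>0$ there is a constant $K_\varepsilon$ such that for all coprime positive integers $u,v,w$ with $u+v=w$ one has $w\le K_\varepsilon\operatorname{rad}(uvw)^{1+\varepsilon}$. *)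

(* Defs.v *)
From HB Require Import structures.
From mathcomp Require Import all_boot all_order all_algebra all_field.
From mathcomp Require Import all_classical all_reals all_analysis.

Set Implicit Arguments.
Unset Strict Implicit.
Unset Printing Implicit Defensive.

Import Order.TTheory GRing.Theory Num.Theory.
Import numFieldNormedType.Exports.

Local Open Scope classical_set_scope.
Local Open Scope ring_scope.

(* rad(k) for k > 0; as [primes 0] is empty, [radn 0 = 1]. *)
Definition radn (k : nat) : nat := (\prod_(p <- primes k) p)%N.

Definition square_free (k : nat) : bool :=
  (0 < k)%N && all (fun p => ~~ (p ^ 2 %| k)%N) (primes k).

Definition abc_conjecture (R : realType) : Prop :=
  forall eps : R, 0 < eps ->
  exists K : R, forall u v w : nat,
    (0 < u)%N -> (0 < v)%N -> (0 < w)%N ->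
    gcdn (gcdn u v) w = 1%N ->
    (u + v = w)%N ->
    w%:R <= K * (radn (u * v * w))%:R `^ (1 + eps).

Definition irreducible_over_Q (h : {poly int}) : Prop :=
  irreducible_poly (map_poly (intr : int -> rat) h).

Definition Q_adjoin (theta : algC) : set algC :=
  [set x | exists p q : {poly rat},
     (map_poly ratr q).[theta] != 0 /\
     x = (map_poly ratr p).[theta] / (map_poly ratr q).[theta]].

Definition Z_adjoin (theta : algC) : set algC :=
  [set x | exists p : {poly int}, x = (map_poly intr p).[theta]].

Definition ring_of_integers (theta : algC) : set algC :=
  Q_adjoin theta `&` [set x | x \in Aint].

(* The condition is independent of the root; quantifying over all the roots in
   [algC] is not vacuous, because [h] is not constant. *)
Definition monogenic (h : {poly int}) : Prop :=
  [/\ h \is monic, irreducible_over_Q h &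
      forall theta : algC, root (map_poly intr h) theta ->
        ring_of_integers theta = Z_adjoin theta].

Definition f_poly (n : nat) (a d : int) (b : nat) : {poly int} :=
  'X^n + a%:P * 'X^(n - 1) + d%:P * 'X^(n - 2) + (b%:Z)%:P.

Definition F_poly (n m : nat) (a d : int) (b c : nat) : {poly int} :=
  ('X^m + (c%:Z)%:P) ^+ n + a%:P * ('X^m + (c%:Z)%:P) ^+ (n - 1)
  + d%:P * ('X^m + (c%:Z)%:P) ^+ (n - 2) + (b%:Z)%:P.

Definition count_pairs (n m : nat) (a d : int) (B C : nat) : nat :=
  (\sum_(1 <= b < B.+1) \sum_(1 <= c < C.+1)
    `[< [/\ irreducible_over_Q (f_poly n a d b),
            monogenic (f_poly n a d b),
            irreducible_over_Q (F_poly n m a d b c) &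
            monogenic (F_poly n m a d b c)] >])%N.

(* [a] is even whenever a ^ 2 = 4 d, so the integer quotient is a / 2. *)
Definition G (n : nat) (a : int) (y : int) : int :=
  (- n%:Z) ^+ n * y
  + 4 * (n%:Z - 2) ^+ (n - 2) * (a %/ 2)%Z ^+ n.

Definition is_gcd_of_values (g : int -> int) (D : nat) : Prop :=
  (forall t : int, (D%:Z %| g t)%Z) /\
  (forall e : nat, (forall t : int, (e%:Z %| g t)%Z) -> (e %| D)%N).

Definition gcd_of_values (g : int -> int) : nat :=
  xget 0%N [set D | is_gcd_of_values g D].

Lemma gcd_of_valuesP (g : int -> int) : is_gcd_of_values g (gcd_of_values g).
Proof.
suff ex : exists D, is_gcd_of_values g D by exact: (xgetPex 0%N).
have [g0|/existsNP[t0 gt0]] := pselect (forall t, g t = 0).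
  by exists 0%N; split=> [t|e _]; rewrite ?g0 ?dvdz0 ?dvdn0.
exists (\big[lcmn/1%N]_(e < `|g t0|.+1 |
          `[< forall t : int, (e%:Z %| g t)%Z >]) e)%N; split=> [t|e eP].
  by apply/dvdn_biglcmP => e /asboolP /(_ t).
have lee : (e < `|g t0|.+1)%N.
  by rewrite ltnS dvdn_leq ?absz_gt0; [|exact/eqP|exact: eP t0].
apply: (@biglcmn_sup _ (Ordinal lee)) => //.
exact/asboolP.
Qed.

Definition D_G (n : nat) (a : int) : nat := gcd_of_values (G n a).

(* [D] is itself among the candidates when D > 0, so the initial value of the
   minimum is harmless. *)
Definition sqfree_codivisor (D : nat) : nat :=
  \big[minn/D]_(e <- divisors D | square_free (D %/ e)%N) e.

Definition q_G (n : nat) (a : int) (p : nat) : nat :=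
  logn p (sqfree_codivisor (D_G n a)).

Definition omega_G (n : nat) (a : int) (p : nat) : nat :=
  (\sum_(1 <= t < (p ^ (2 + q_G n a p)).+1)
     ((p ^ 2)%N%:Z %| G n a t%:Z)%Z)%N.

(* Infinite products over primes are limits of the products over p < N. *)
Definition prime_prod (R : realType) (P : pred nat) (u : nat -> R) : R :=
  limn (fun N => \prod_(0 <= p < N | prime p && P p) u p).

(* p <= sqrt n is expressed as p ^ 2 <= n. *)
Definition Lambda (R : realType) (n : nat) : R :=
  (\prod_(0 <= p < n.+1 | prime p && (p ^ 2 <= n)%N) (p%:R ^+ 2)^-1)
  * prime_prod (fun p => (n < p ^ 2)%N) (fun p => 1 - n%:R / p%:R ^+ 2).

Definition lambda_G (R : realType) (n : nat) (a : int) : R :=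
  prime_prod predT
    (fun p => 1 - (omega_G n a p)%:R / (p ^ (2 + q_G n a p))%N%:R).

(* The Dirichlet series of the Riemann zeta function, for s > 1. *)
Definition zeta (R : realType) (s : R) : R :=
  limn (series (fun k : nat => (k.+1%:R `^ s)^-1)).

Definition delta (m : nat) (d : int) : nat :=
  if (2 %| d * m%:Z)%Z then 1 else 4.

(* Main.v *)
Require Import Defs.
From mathcomp Require Import all_boot all_order all_algebra all_field.
From mathcomp Require Import all_classical all_reals all_analysis.
From mathcomp Require Import ring lra zify.
Set Implicit Arguments.
Unset Strict Implicit.
Unset Printing Implicit Defensive.
Import Order.TTheory GRing.Theory Num.Theory.
Import numFieldNormedType.Exports.
Local Open Scope classical_set_scope.
Local Open Scope ring_scope.

(* Write a = 2s and d = s^2, so that f = x^(n-2) (x + s)^2 + b.  By Dedekind's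
   criterion, f(x^m + c) is monogenic as soon as, for every prime p and every
   irreducible pi modulo p, it avoids the ideal (p, pi)^2.  At a prime p not
   dividing m this only fails if p^2 divides b, f(c) or G(b); at the primes
   dividing m or gcd(d, n) it is enough to take b exactly divisible by p, and at
   the prime l one takes in addition c divisible by l, which gives
   irreducibility by Eisenstein.  Since lambda_G <= 1, zeta(2) >= 1 and
   delta >= 1, the announced constant is at most the product over p of the
   densities of these local conditions; the only delicate case is n = 3, p | m,
   p not dividing s, where a second class of b modulo p, the root of G, is needed.

   The conditions at small p are counted with the Chinese remainder theorem and
   those at large p are negligible.  This is elementary for b and G(b), which
   are linear in b, and for the primes p = O(max(B, C)) dividing f(c) twice.
   For the larger p one applies abc to consecutive integers M, ..., M + j+1 with
   M = f(c) - b + O(B): the j-th multiplicative difference of M / (M+1) writes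
   1 + O(M^-(j+1)) as a quotient of two products of the M + i, so that abc makes
   the radical of the product of the M + i at least M^(j+1-eps).  Hence a
   bounded number of them have a square factor exceeding M^(2/n), uniformly in
   B and C. *)

(** * Dedekind's criterion *)

(** B and C tend to infinity independently, so f(c) is not bounded by a power of B and no single
    count reaches all primes. For fixed c the values f(c) are consecutive integers as b varies,
    which settles p up to a small multiple of B. For fixed b the roots of f modulo p settle p up to
    a small multiple of C; primes dividing b G(b) are treated apart, because there a root need not
    lift uniquely. Beyond both ranges p exceeds a constant times the n-th root of f(c), and abc
    leaves at most 2n bad b in each block of j + 2 consecutive ones; j is free, and taking it of
    order n/e makes these a proportion e. Regularity at p depends only on (b, c) modulo p^2, so each
    local density is a count among p^4 pairs, done mostly in b for fixed c. For p dividing neither m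
    nor l, generically at most three classes of b are lost, and 1 - 3/p^2 is at least the factor of
    Lambda_n since n >= 3. The constant is only ever bounded from above, so the monotonicity of
    partial products suffices for the infinite products. *)

Notation redp p := (map_poly (intr : int -> 'F_p)).
Notation polyZC := (map_poly (intr : int -> algC)).

Definition lift_poly (p : nat) (u : {poly 'F_p}) : {poly int} :=
  map_poly (fun x : 'F_p => (x : nat)%:Z) u.

Lemma lift_polyK (p : nat) (u : {poly 'F_p}) : redp p (lift_poly u) = u.
Proof.
apply/polyP => i; rewrite coef_map /lift_poly coef_map_id0 //=.
by rewrite -pmulrn natr_Zp.
Qed.

Lemma intrFp_eq0 (p : nat) (x : int) :
  prime p -> ((x%:~R : 'F_p) == 0) = (p%:Z %| x)%Z.
Proof. by move=> pp; rewrite (dvdz_pcharf (pchar_Fp pp)). Qed.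

Lemma redp_eq0P (p : nat) (h : {poly int}) : prime p ->
  redp p h = 0 -> exists k, h = (p%:Z)%:P * k.
Proof.
move=> pp h0; exists (map_poly (fun x => (x %/ p%:Z)%Z) h).
apply/polyP => i; rewrite coefCM coef_map_id0 ?div0z //.
have : (redp p h)`_i = 0 by rewrite h0 coef0.
rewrite coef_map => /eqP; rewrite intrFp_eq0 // => /divzK.
by rewrite mulrC => ->.
Qed.

Lemma redp_prime0 (p : nat) : prime p -> (redp p (p%:Z)%:P) = 0.
Proof.
by move=> pp; rewrite map_polyC /=; apply/eqP; rewrite polyC_eq0 intrFp_eq0.
Qed.

Lemma redp_eqP (p : nat) (g h : {poly int}) : prime p ->
  redp p g = redp p h -> exists k, g = h + (p%:Z)%:P * k.
Proof.
move=> pp e; have [|k hk] := @redp_eq0P p (g - h) pp.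
  by rewrite rmorphB /= e subrr.
by exists k; rewrite -hk addrC subrK.
Qed.

Definition in_J (p : nat) (pi : {poly 'F_p}) (h : {poly int}) : bool :=
  pi %| redp p h.

(* The square of the ideal generated by [p] and a lift of [pi]. *)
Definition in_J2 (p : nat) (pi : {poly 'F_p}) (h : {poly int}) : Prop :=
  exists S V X : {poly int},
    h = lift_poly pi ^+ 2 * S + (p%:Z)%:P * lift_poly pi * V
        + (p%:Z)%:P ^+ 2 * X.

(** Regularity of the ring Z[x]/(h) at its maximal ideals above [p]. An irreducible [pi] that does
    not divide h modulo [p] imposes nothing, as the square of an ideal lies in the ideal. *)
Definition regular_at (p : nat) (h : {poly int}) : Prop :=
  forall pi : {poly 'F_p}, irreducible_poly pi -> ~ in_J2 pi h.

(** The remainder of E by h vanishes at [th] and has smaller degree; were it nonzero, its Bezout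
    relation with the irreducible h over Q would read 0 = 1 at [th]. Monicity keeps the quotient in
    Z[x]. *)
Lemma monic_min_dvd (h E : {poly int}) (th : algC) :
  h \is monic -> irreducible_poly (map_poly (intr : int -> rat) h) ->
  root (polyZC h) th -> root (polyZC E) th -> exists S, E = h * S.
Proof.
move=> hm hi hr Er.
have := Pdiv.RingMonic.rdivp_eq hm E.
set q := Pdiv.Ring.rdivp _ _; set r := Pdiv.Ring.rmodp _ _ => Eqr.
have rs : (size r < size h)%N.
  by apply: Pdiv.Ring.ltn_rmodpN0; rewrite monic_neq0.
suff r0 : r = 0 by exists q; rewrite Eqr r0 addr0 mulrC.
apply/eqP; apply: contraT => rn0.
have zr : (polyZC r).[th] = 0.
  have /rootP := Er; rewrite Eqr rmorphD rmorphM /= hornerD hornerM.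
  by move/rootP: hr => ->; rewrite mulr0 add0r.
have injZQ : injective (intr : int -> rat) by exact: intr_inj.
have sz g : size (map_poly (intr : int -> rat) g) = size g.
  by apply: size_map_inj_poly.
have cop : coprimep (map_poly (intr : int -> rat) h) (map_poly (intr : int -> rat) r).
  rewrite irreducible_poly_coprime //; apply/negP => /dvdp_leq.
  rewrite -size_poly_eq0 !sz size_poly_eq0 => /(_ rn0).
  by rewrite leqNgt rs.
have [[u v] /= uv] := Bezout_eq1_coprimepP _ _ cop.
have toC g : map_poly (ratr : rat -> algC) (map_poly (intr : int -> rat) g) = polyZC g.
  by rewrite -map_poly_comp; apply: eq_map_poly => x /=; rewrite ratr_int.
have := congr1 (fun g => (map_poly (ratr : rat -> algC) g).[th]) uv.
rewrite rmorphD !rmorphM /= !toC rmorph1 hornerD !hornerM hornerC zr.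
move/rootP: hr => ->; rewrite !mulr0 addr0 => /eqP.
by rewrite eq_sym oner_eq0.
Qed.

Lemma AintP (x : algC) :
  reflect (exists2 P : {poly int}, P \is monic & root (polyZC P) x) (x \in Aint).
Proof.
apply: (iffP idP) => [|[P Pm Pr]].
  rewrite unfold_in => /floorpP[P hP].
  exists P; last by rewrite -hP root_minCpoly.
  have := minCpoly_monic x; rewrite hP !monicE lead_coef_map_inj //=.
    by rewrite -[1]/(1%:~R) eqr_int.
  exact: intr_inj.
apply: root_monic_Aint Pr _ _.
  by rewrite monicE lead_coef_map_inj ?(monicP Pm) //=; exact: intr_inj.
by apply/polyOverP => i; rewrite coef_map /= intr_int.
Qed.

(** Multiplying the monic equation of [al], of degree r, by the r-th power of B(th) turns it into a
    polynomial identity in A(th) and B(th); the corresponding polynomial vanishes at [th], hence is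
    a multiple of h. *)
Lemma integral_relation (h A B : {poly int}) (th al : algC) :
  h \is monic -> irreducible_poly (map_poly (intr : int -> rat) h) ->
  root (polyZC h) th -> al \in Aint ->
  (polyZC A).[th] = al * (polyZC B).[th] ->
  exists r S T, A ^+ r = h * S + B * T.
Proof.
move=> hm hi hr /AintP[P Pm /rootP Pr] AB.
set r := (size P).-1.
pose T := \sum_(i < r) (P`_i)%:P * A ^+ i * B ^+ (r.-1 - i).
have szP : size P = r.+1 by rewrite /r prednK // size_poly_gt0 monic_neq0.
have [|S eS] := @monic_min_dvd h (A ^+ r + B * T) th hm hi hr.
  apply/rootP; rewrite rmorphD rmorphM rmorphXn /= rmorph_sum /=.
  rewrite hornerD hornerM horner_exp horner_sum AB.
  rewrite horner_coef size_map_inj_poly // in Pr; last exact: intr_inj.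
  rewrite szP big_ord_recr /= coef_map /= -/r -lead_coefE (monicP Pm) mul1r in Pr.
  set b := (polyZC B).[th] in AB *.
  transitivity (b ^+ r * (\sum_(i < r) (polyZC P)`_i * al ^+ i + al ^+ r)); last first.
    by rewrite Pr mulr0.
  rewrite mulrDr addrC exprMn [b ^+ r * al ^+ r]mulrC; congr (_ + _).
  rewrite !mulr_sumr; apply: eq_bigr => i _.
  rewrite coef_map /= !rmorphM /= !hornerM !rmorphXn /= !horner_exp map_polyC hornerC.
  rewrite AB -/b exprMn.
  have -> : b ^+ r = b * b ^+ i * b ^+ (r.-1 - i).
    rewrite -mulrA -exprD -exprS; congr (_ ^+ _); have := ltn_ord i; lia.
  by rewrite /=; ring.
by exists r, S, (- T); rewrite -eS; ring.
Qed.

Lemma irreducible_dvd_exp (F : fieldType) (pi u : {poly F}) (r : nat) :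
  irreducible_poly pi -> pi %| u ^+ r -> pi %| u.
Proof.
move=> hpi; apply: contraLR => hu.
by rewrite -irreducible_poly_coprime // coprimep_expr // irreducible_poly_coprime.
Qed.

Lemma irreducible_dvdM (F : fieldType) (pi u v : {poly F}) :
  irreducible_poly pi -> (pi %| u * v) = (pi %| u) || (pi %| v).
Proof.
move=> hpi; apply/idP/orP => [|[h|h]]; last 2 first.
- exact: dvdp_mulr.
- exact: dvdp_mull.
case: (boolP (pi %| u)) => [|hu]; first by left.
by rewrite Gauss_dvdpr ?irreducible_poly_coprime //; right.
Qed.

Lemma irreducible_factor (F : fieldType) (v : {poly F}) :
  (1 < size v)%N -> exists2 pi, irreducible_poly pi & pi %| v.
Proof.
have [k] := ubnP (size v); elim: k v => // k IH v.
rewrite ltnS => szk sv.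
have [hirr|nirr] := pselect (irreducible_poly v); first by exists v.
have v0 : v != 0 by rewrite -size_poly_gt0 ltnW.
have [q [q1 qv nqv]] : exists q : {poly F}, [/\ size q != 1, q %| v & ~~ (q %= v)].
  apply: contrapT => nq; apply: nirr; split=> // q q1 qv.
  by apply: contraT => nqv; case: nq; exists q.
have qs : (size q < size v)%N.
  by rewrite ltn_neqAle dvdp_size_eqp // nqv dvdp_leq.
have [|pi pirr piq] := IH q (leq_trans qs szk).
  rewrite ltn_neqAle eq_sym q1 size_poly_gt0.
  by apply: contraNneq v0 => q0; rewrite q0 dvd0p in qv.
by exists pi => //; apply: dvdp_trans qv.
Qed.

(* The residues modulo p of the P with P(th)/p integral form an ideal containing
   h.  If it is larger than (h), it contains Q = h / pi for some pi; writing
   h = Pi Q + p T, the integral equation of Q(th)/p gives pi | Q and pi | T. *)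
Lemma dedekind_step (p : nat) (h R : {poly int}) (th : algC) :
  prime p -> h \is monic -> irreducible_poly (map_poly (intr : int -> rat) h) ->
  root (polyZC h) th -> regular_at p h ->
  (polyZC R).[th] / p%:R \in Aint ->
  exists P, (polyZC R).[th] = p%:R * (polyZC P).[th].
Proof.
move=> pp hm hi hr reg RA.
have p0 : (p%:R : algC) != 0 by rewrite pnatr_eq0 -lt0n prime_gt0.
have hth0 : (polyZC h).[th] = 0 by apply/rootP.
have evp g : (polyZC ((p%:Z)%:P * g)).[th] = p%:R * (polyZC g).[th].
  by rewrite rmorphM /= hornerM map_polyC hornerC.
pose hb := redp p h.
have thA : th \in Aint by apply/AintP; exists h.
have evA g : (polyZC g).[th] \in Aint.
  rewrite horner_coef; apply: rpred_sum => i _; apply: rpredM; last exact: rpredX.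
  by rewrite coef_map /= Aint_int.
have congA g g' : redp p g = redp p g' ->
    (polyZC g).[th] / p%:R \in Aint -> (polyZC g').[th] / p%:R \in Aint.
  move=> /esym/(redp_eqP pp)[k ->] gA.
  by rewrite rmorphD hornerD evp mulrDl rpredD // mulrC mulrA mulVf // mul1r.
have ghA g k : (polyZC g).[th] / p%:R \in Aint -> (polyZC (g * k)).[th] / p%:R \in Aint.
  by move=> gA; rewrite rmorphM /= hornerM mulrAC rpredM.
have [hR|nhR] := boolP (hb %| redp p R).
  have hbm : hb \is monic by rewrite /hb monic_map.
  have : redp p R = redp p (h * lift_poly (redp p R %/ hb)).
    by rewrite rmorphM /= lift_polyK mulrC divpK.
  case/(redp_eqP pp) => k ->; exists k.
  by rewrite rmorphD hornerD evp rmorphM hornerM hth0 mul0r add0r.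
exfalso.
have hb0 : hb != 0 by apply: monic_neq0; rewrite monic_map.
(* [u] is a proper divisor of h modulo p. Taking [pi] in the cofactor [v] makes [u] divide h / pi,
   so that Q = h / pi falls in the ideal of numerators. *)
pose u := gcdp (redp p R) hb.
have [[x y] /= xy] := Bezoutp (redp p R) hb.
have udv : u %| hb by apply: dvdp_gcdr.
pose v := hb %/ u.
have uv : hb = v * u by rewrite divpK.
have v0 : v != 0 by apply: contraNneq hb0 => v0; rewrite uv v0 mul0r.
have sv : (1 < size v)%N.
  rewrite ltn_neqAle eq_sym size_poly_gt0 v0 andbT.
  apply: contra nhR => /size_poly1P[c c0 vc].
  have : u %| redp p R by exact: dvdp_gcdl.
  by apply: dvdp_trans; rewrite [hb]uv vc mul_polyC dvdpZl.
have [pi pirr piv] := irreducible_factor sv.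
pose Qb := hb %/ pi.
have pih : pi %| hb by rewrite uv dvdp_mulr.
have uQ : u %| Qb.
  rewrite /Qb uv -mulrC -divp_mulA //; exact: dvdp_mulr.
pose Q := lift_poly Qb; pose Pi := lift_poly pi.
have QA : (polyZC Q).[th] / p%:R \in Aint.
  have uA : (polyZC (R * lift_poly x)).[th] / p%:R \in Aint by exact: ghA.
  pose w := R * lift_poly x + h * lift_poly y.
  have wA : (polyZC w).[th] / p%:R \in Aint.
    by rewrite rmorphD hornerD [_ (h * _)]rmorphM hornerM hth0 mul0r addr0.
  have [z hz] : exists z, Qb = redp p w * z.
    have /dvdpP[z hz] : redp p w %| Qb.
      apply: dvdp_trans uQ; rewrite /w rmorphD !rmorphM /= !lift_polyK.
      by rewrite mulrC [redp p h * _]mulrC (eqp_dvdl _ xy).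
    by exists z; rewrite mulrC.
  apply: (congA (w * lift_poly z)); last exact: ghA.
  by rewrite rmorphM /= !lift_polyK hz.
have [T hT] : exists T, h = Pi * Q + (p%:Z)%:P * T.
  apply: redp_eqP pp _; rewrite rmorphM /= !lift_polyK mulrC divpK //.
have eQ : (polyZC Q).[th] = (polyZC Q).[th] / p%:R * (polyZC (p%:Z)%:P).[th].
  by rewrite map_polyC hornerC /= divfK.
have eT : (polyZC (- T)).[th] = (polyZC Q).[th] / p%:R * (polyZC Pi).[th].
  apply: (mulfI p0); rewrite rmorphN hornerN mulrA [p%:R * (_ / _)]mulrC divfK //.
  apply/eqP; rewrite mulrN eq_sym -addr_eq0 -evp -hornerM -rmorphM -hornerD -rmorphD.
  by rewrite [Q * Pi]mulrC -hT hth0.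
(* Two relations for the same algebraic integer al = Q(th)/p: al p = Q(th), and al Pi(th) = -T(th)
   because h(th) = 0. *)
have [r1 [S1 [T1 e1]]] := integral_relation hm hi hr QA eQ.
have [r2 [S2 [T2 e2]]] := integral_relation hm hi hr QA eT.
have piQ : pi %| redp p Q.
  apply: (@irreducible_dvd_exp _ _ _ r1) => //; rewrite -rmorphXn e1 rmorphD !rmorphM /=.
  by rewrite redp_prime0 // mul0r addr0 dvdp_mulr.
have piT : pi %| redp p T.
  rewrite -dvdpNr -rmorphN; apply: (@irreducible_dvd_exp _ _ _ r2) => //.
  rewrite -rmorphXn e2 rmorphD !rmorphM /= lift_polyK.
  by rewrite dvdp_add // dvdp_mulr.
have lft g : pi %| redp p g -> exists a b, g = Pi * a + (p%:Z)%:P * b.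
  move=> /dvdpP[z hz]; exists (lift_poly z); apply: redp_eqP pp _.
  by rewrite rmorphM /= !lift_polyK hz mulrC.
have [S [V hQ]] := lft _ piQ; have [W [X hT']] := lft _ piT.
apply: (reg _ pirr); exists S, (V + W), X.
by rewrite hT hT' hQ -/Pi; ring.
Qed.

(** The denominator is stripped one prime p of N at a time: R(th)/p is N/p times R(th)/N, hence
    integral, and [dedekind_step] divides R(th) by p. *)
Lemma dedekind_descent (h : {poly int}) (th : algC) :
  h \is monic -> irreducible_poly (map_poly (intr : int -> rat) h) ->
  root (polyZC h) th ->
  (forall p, prime p -> regular_at p h) ->
  forall (N : nat) (R : {poly int}), (0 < N)%N ->
  (polyZC R).[th] / N%:R \in Aint ->
  exists P, (polyZC R).[th] = N%:R * (polyZC P).[th].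
Proof.
move=> hm hi hr reg; elim/ltn_ind => N IH R N0 RA.
have [N1|N1] := leqP N 1.
  by exists R; rewrite (_ : N = 1%N) ?mul1r //; lia.
have pp := pdiv_prime N1; set p := pdiv N in pp.
have /dvdnP[N' eN] : (p %| N)%N by apply: pdiv_dvd.
have p0 := prime_gt0 pp; have p1 := prime_gt1 pp.
have N'0 : (0 < N')%N by move: N0; rewrite eN muln_gt0 => /andP[].
have N'n0 : (N'%:R : algC) != 0 by rewrite pnatr_eq0 -lt0n.
have pn0 : (p%:R : algC) != 0 by rewrite pnatr_eq0 -lt0n.
have [|P hP] := @dedekind_step p h R th pp hm hi hr (reg p pp).
  have -> : (polyZC R).[th] / p%:R = (polyZC R).[th] / N%:R * N'%:R.
    by rewrite eN natrM; field; rewrite N'n0 pn0.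
  by rewrite rpredM // -[N'%:R]/((N'%:Z)%:~R) Aint_int.
have [| |P' hP'] := IH N' _ P N'0.
- by rewrite eN -[X in (X < _)%N]muln1 ltn_pmul2l.
- have -> : (polyZC P).[th] / N'%:R = (polyZC R).[th] / N%:R => //.
  by rewrite hP eN natrM; field; rewrite N'n0 pn0.
by exists P'; rewrite hP hP' eN natrM mulrA [_%:R * _%:R]mulrC.
Qed.

(** Bezout modulo h inverts the denominator Q(th), so every element of Q(th) is a polynomial in [th]
    with rational coefficients, that is some R(th)/N, to which the descent applies. *)
Theorem dedekind_monogenic (h : {poly int}) :
  h \is monic -> irreducible_over_Q h ->
  (forall p, prime p -> regular_at p h) -> monogenic h.
Proof.
move=> hm hi reg; split=> // th hr.
have thA : th \in Aint by apply/AintP; exists h.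
pose toC := map_poly (ratr : rat -> algC).
have toCz g : toC (map_poly (intr : int -> rat) g) = polyZC g.
  by rewrite /toC -map_poly_comp; apply: eq_map_poly => x /=; rewrite ratr_int.
have evA g : (polyZC g).[th] \in Aint.
  rewrite horner_coef; apply: rpred_sum => i _; apply: rpredM; last exact: rpredX.
  by rewrite coef_map /= Aint_int.
rewrite /ring_of_integers /Z_adjoin; apply/seteqP; split=> x /=; last first.
  move=> [P ->]; split; last exact: evA.
  exists (map_poly intr P), 1; rewrite rmorph1 hornerC oner_neq0 divr1.
  by split=> //; rewrite -(toCz P).
move=> [[P [Q [Q0 ->]]] xA].
have cop : coprimep (map_poly (intr : int -> rat) h) Q.
  rewrite irreducible_poly_coprime //; apply: contraNN Q0 => /dvdpP[k ->].
  by rewrite rmorphM /= hornerM [map_poly _ (map_poly _ h)]toCz; move/rootP: hr => ->; rewrite mulr0.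
have [[u v] /= uv] := Bezout_eq1_coprimepP _ _ cop.
have vQ : (toC v).[th] * (toC Q).[th] = 1.
  have := congr1 (fun g => (toC g).[th]) uv; rewrite /toC.
  rewrite rmorphD !rmorphM /= [map_poly _ (map_poly _ h)]toCz rmorph1.
  rewrite hornerD !hornerM hornerC.
  by move/rootP: hr => ->; rewrite mulr0 add0r.
have [R [N [N0 eR]]] : exists R N, (0 < N)%N /\
    (toC (P * v)).[th] = (polyZC R).[th] / N%:R.
  have [R [a a0 ->]] := rat_poly_scale (P * v).
  (* The sign of the common denominator [a] goes to the numerator, since N must be a positive
     natural number. *)
  exists ((Num.sg a)%:P * R), `|a|%N; rewrite absz_gt0; split=> //.
  rewrite /toC map_polyZ hornerZ [map_poly _ (map_poly _ R)]toCz /=.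
  rewrite fmorphV /= ratr_int.
  rewrite rmorphM /= hornerM map_polyC hornerC /=.
  have aC : (a%:~R : algC) != 0 by rewrite intr_eq0.
  have sC : ((Num.sg a)%:~R : algC) != 0 by rewrite intr_eq0 sgr_eq0.
  have -> : (`|a|%:R : algC) = (Num.sg a)%:~R * a%:~R.
    by rewrite -intrM -normrEsg -abszE.
  by field; rewrite aC sC.
have xe : (map_poly ratr P).[th] / (map_poly ratr Q).[th] = (polyZC R).[th] / N%:R.
  rewrite -eR /toC rmorphM /= hornerM; congr (_ * _).
  by apply: (mulIf Q0); rewrite mulVf.
rewrite xe in xA *.
have [P' hP'] := dedekind_descent hm hi hr reg N0 xA.
by exists P'; rewrite hP' mulrC mulKf // pnatr_eq0 -lt0n.
Qed.

(** * The square of a maximal ideal of Z[x] *)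

(** Used both in Z[x] and in Z, hence the general ring. All that matters about the remainder is that
    it is a multiple of the square of Z. *)
Lemma exprB_taylor (R : comNzRingType) (Z e : R) (j : nat) : exists A,
  (Z - e) ^+ j.+1 = (- e) ^+ j.+1 + (j.+1)%:R * (- e) ^+ j * Z + Z ^+ 2 * A.
Proof.
elim: j => [|j [A hA]]; first by exists 0; rewrite expr1 expr0; ring.
exists ((Z - e) * A + (j.+1)%:R * (- e) ^+ j).
by rewrite exprS hA [(- e) ^+ j.+2]exprS [(- e) ^+ j.+1]exprS -[in RHS]natr1; ring.
Qed.

(** Here n is [k.+3], which avoids truncated subtraction in exponents. Leaving Y free lets one
    computation serve f, with Y = x, and F, with Y = x^m + c. *)
Definition f_at (k : nat) (s b : int) (Y : {poly int}) : {poly int} :=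
  Y ^+ k.+1 * (Y + s%:P) ^+ 2 + b%:P.

(** This is G(b); it equals (-n)^n times the value of f at its critical point -(n-2)s/n. *)
Definition G_at (k : nat) (s b : int) : int :=
  (- (k.+3)%:Z) ^+ k.+3 * b + 4 * (k.+1)%:Z ^+ k.+1 * s ^+ k.+3.

Section LocalIdeals.
Variables (p : nat) (pi : {poly 'F_p}).
Hypotheses (pp : prime p) (pirr : irreducible_poly pi).
Implicit Types (g h u v : {poly int}) (c e : int).

Local Notation J := (in_J pi).
Local Notation J2 := (in_J2 pi).

Lemma in_JP h :
  reflect (exists a b, h = lift_poly pi * a + (p%:Z)%:P * b) (J h).
Proof.
apply: (iffP idP) => [/dvdpP[z hz]|[a [b ->]]].
  exists (lift_poly z); apply: redp_eqP pp _.
  by rewrite rmorphM /= !lift_polyK hz mulrC.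
apply/dvdpP; exists (redp p a); rewrite rmorphD !rmorphM /= redp_prime0 // lift_polyK.
by rewrite mul0r addr0 mulrC.
Qed.

Lemma in_JD g h : J g -> J h -> J (g + h).
Proof. by rewrite /in_J rmorphD /=; exact: dvdp_add. Qed.

Lemma in_JMl g h : J h -> J (g * h).
Proof. by rewrite /in_J rmorphM /=; exact: dvdp_mull. Qed.

Lemma in_JN h : J (- h) = J h.
Proof. by rewrite /in_J rmorphN dvdpNr. Qed.

Lemma in_JB g h : J g -> J h -> J (g - h).
Proof. by move=> Jg Jh; apply: in_JD; rewrite ?in_JN. Qed.

Lemma in_J_prime g h : J (g * h) = J g || J h.
Proof. by rewrite /in_J rmorphM /= irreducible_dvdM. Qed.

Lemma in_JX h r : J (h ^+ r) -> J h.
Proof. by rewrite /in_J rmorphXn /=; apply: irreducible_dvd_exp. Qed.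

Lemma in_JC c : J c%:P = (p%:Z %| c)%Z.
Proof.
rewrite /in_J map_polyC /= -(intrFp_eq0 _ pp); apply/idP/eqP => [|->]; last exact: dvdp0.
have [//|/eqP c0] := eqVneq (c%:~R : 'F_p) 0.
move=> /dvdp_leq; rewrite polyC_eq0 => /(_ (introN eqP c0)).
by rewrite size_polyC (introN eqP c0) leqNgt pirr.
Qed.

Lemma in_JMC c h : ~~ (p%:Z %| c)%Z -> J (c%:P * h) -> J h.
Proof. by move=> /negPf pc; rewrite in_J_prime in_JC pc. Qed.

Lemma in_J2_J h : J2 h -> J h.
Proof.
move=> [S [V [X ->]]]; apply/in_JP.
by exists (lift_poly pi * S + (p%:Z)%:P * V), ((p%:Z)%:P * X); ring.
Qed.

Lemma in_J2D g h : J2 g -> J2 h -> J2 (g + h).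
Proof.
move=> [S [V [X ->]]] [S' [V' [X' ->]]].
by exists (S + S'), (V + V'), (X + X'); ring.
Qed.

Lemma in_J2Ml g h : J2 h -> J2 (g * h).
Proof. by move=> [S [V [X ->]]]; exists (g * S), (g * V), (g * X); ring. Qed.

Lemma in_J2N h : J2 h -> J2 (- h).
Proof. by move=> Jh; rewrite -mulN1r; apply: in_J2Ml. Qed.

Lemma in_J2B g h : J2 g -> J2 h -> J2 (g - h).
Proof. by move=> Jg /in_J2N; apply: in_J2D. Qed.

Lemma in_J2M g h : J g -> J h -> J2 (g * h).
Proof.
move=> /in_JP[a [b ->]] /in_JP[a' [b' ->]].
by exists (a * a'), (a * b' + a' * b), (b * b'); ring.
Qed.

(** A derivation sends the square of an ideal into the ideal. This is what reduces membership in
    [J2] to a study of the critical points of f. *)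
Lemma in_J2_deriv h : J2 h -> J h^`().
Proof.
move=> [S [V [X ->]]]; apply/in_JP; set Pi := lift_poly pi.
rewrite !poly.derivE /= expr2.
exists (Pi^`() * S *+ 2 + Pi * S^`() + (p%:Z)%:P * V^`()),
       (Pi^`() * V + (p%:Z)%:P * X^`()).
by ring.
Qed.

(** Modulo p the relation for e leaves pi^2 S = 0, so p divides S; dividing by p shows that e/p is a
    constant lying in [J], hence a multiple of p. *)
Lemma in_J2C e : J2 e%:P -> ((p ^ 2)%N%:Z %| e)%Z.
Proof.
move=> Je; have := in_J2_J Je; rewrite in_JC => /dvdzP[e' ee].
move: Je => [S [V [X eq]]]; set Pi := lift_poly pi in eq.
have p0 : (p%:Z)%:P != 0 :> {poly int} by rewrite polyC_eq0; case: p pp.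
have S0 : redp p S = 0.
  have := congr1 (map_poly (intr : int -> 'F_p)) eq.
  have -> : redp p e%:P = 0 by rewrite ee polyCM rmorphM /= redp_prime0 // mulr0.
  rewrite !expr2 !rmorphD !rmorphM /= !redp_prime0 // !lift_polyK.
  rewrite !(mul0r, mulr0, addr0) => /esym/eqP.
  by rewrite !mulf_eq0 (negPf (irredp_neq0 pirr)) => /eqP.
have [S' eS] := redp_eq0P pp S0.
have eq' : e'%:P = Pi ^+ 2 * S' + Pi * V + (p%:Z)%:P * X.
  by apply: (mulfI p0); rewrite -polyCM mulrC -ee eq eS; ring.
have : J e'%:P.
  by apply/in_JP; exists (Pi * S' + V), X; rewrite eq' -/Pi; ring.
rewrite in_JC => /dvdzP[e2 ee2]; apply/dvdzP; exists e2.
by rewrite ee ee2; lia.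
Qed.

Lemma in_J2_dvdC e : ((p ^ 2)%N%:Z %| e)%Z -> J2 e%:P.
Proof.
move=> /dvdzP[k ->]; exists 0, 0, k%:P.
rewrite mulr0 mulr0 !add0r mulrC polyCM; congr (_ * _).
  by rewrite expr2 -polyCM; congr (_%:P); lia.
Qed.

Variables (k : nat) (s b : int) (Y : {poly int}).

Lemma f_at_J2_Ys : J2 (f_at k s b Y) -> J (Y + s%:P) -> ((p ^ 2)%N%:Z %| b)%Z.
Proof.
move=> JF JY; apply: in_J2C.
have -> : b%:P = f_at k s b Y - Y ^+ k.+1 * ((Y + s%:P) * (Y + s%:P)).
  by rewrite /f_at; ring.
by apply: in_J2B JF _; apply: in_J2Ml; apply: in_J2M.
Qed.

(** The factor Y^(n-2) is in [J2] only if n - 2 is at least 2. For n = 3 the root 0 is simple, which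
    is the source of all the cubic lemmas below. *)
Lemma f_at_J2_Y : (0 < k)%N ->
  J2 (f_at k s b Y) -> J Y -> ((p ^ 2)%N%:Z %| b)%Z.
Proof.
case: k => // k' _ JF JY; apply: in_J2C.
have -> : b%:P = f_at k'.+1 s b Y - (Y ^+ k' * (Y + s%:P) ^+ 2) * (Y * Y).
  by rewrite /f_at !exprS; ring.
by apply: in_J2B JF _; apply: in_J2Ml; apply: in_J2M.
Qed.

Lemma f_at_J_root : J2 (f_at k s b Y) -> (p%:Z %| b)%Z -> J Y || J (Y + s%:P).
Proof.
move=> /in_J2_J JF pb.
have : J (Y ^+ k.+1 * (Y + s%:P) ^+ 2).
  have -> : Y ^+ k.+1 * (Y + s%:P) ^+ 2 = f_at k s b Y - b%:P by rewrite /f_at addrK.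
  by apply: in_JB JF _; rewrite in_JC.
by rewrite in_J_prime // => /orP[/in_JX->|/in_JX->]; rewrite ?orbT.
Qed.

(** If p divides s, the roots 0 and -s coincide modulo p, so even in the cubic case the argument at
    the double root applies. *)
Lemma f_at_prime_dvd_const : (0 < k)%N \/ (p%:Z %| s)%Z -> (p%:Z %| b)%Z ->
  J2 (f_at k s b Y) -> ((p ^ 2)%N%:Z %| b)%Z.
Proof.
move=> hk pb JF; case/orP: (f_at_J_root JF pb); last exact: f_at_J2_Ys.
case: hk => [k0|ps] JY; first exact: f_at_J2_Y.
by apply: f_at_J2_Ys JF _; apply: in_JD => //; rewrite in_JC.
Qed.

(* With [Z = nY + (n-2)s], [n^n f(Y)] has no linear term in [Z]. *)
Lemma f_at_taylor : exists A,
  ((k.+3)%:Z%:P) ^+ k.+3 * f_at k s b Y * (-1) ^+ k.+3 =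
  ((k.+3)%:Z%:P * Y + ((k.+1)%:Z * s)%:P) ^+ 2 * A + (G_at k s b)%:P.
Proof.
set N := (k.+3)%:Z%:P; set t := s%:P; set K : {poly int} := (k.+1)%:R.
have -> : ((k.+1)%:Z * s)%:P = K * t by rewrite polyCM /K -natz polyC_natr.
set Z := N * Y + K * t.
have [A hA] := exprB_taylor Z (K * t) k; rewrite -/K in hA.
have hY : N * Y = Z - K * t by rewrite /Z addrK.
have hN : N = K + 2 by rewrite /N /K -natz polyC_natr -natrD addn2.
have hYs : N * (Y + t) = Z + 2 * t by rewrite mulrDr hY hN; ring.
have -> : N ^+ k.+3 * f_at k s b Y =
    (N * Y) ^+ k.+1 * (N * (Y + t)) ^+ 2 + N ^+ k.+3 * b%:P.
  by rewrite /f_at -/t !exprMn mulrDr -[k.+3]addn2 exprD; ring.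
have -> : (G_at k s b)%:P = (- N) ^+ k.+3 * b%:P + 4 * K ^+ k.+1 * t ^+ k.+3.
  rewrite /G_at polyCD (polyCM _ b) (polyCM _ (s ^+ _)) (polyCM 4) !polyC_exp polyCN.
  by rewrite (polyC_natr _ 4) /K -(polyC_natr _ k.+1) natz.
rewrite hY hYs hA.
(* The terms linear in Z cancel: the first power contributes K (-K t)^k 4 t^2 and the square
   contributes (-K t)^(k+1) 4 t. The witness collects what is left beyond the constant term. *)
exists ((-1) ^+ k.+3 * (A * (Z + 2 * t) ^+ 2 + (- (K * t)) ^+ k.+1
          + K * (- (K * t)) ^+ k * (Z + 4 * t))).
have sg : (-1) ^+ k * (-1) ^+ k = 1 :> {poly int} by rewrite -expr2 sqrr_sign.
rewrite (exprNn N) (exprNn (K * t) k.+1) (exprNn (K * t) k) (exprMn k.+1 K) (exprMn k K).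
rewrite [(-1) ^+ k.+3]exprS [(-1) ^+ k.+2]exprS [(-1) ^+ k.+1]exprS.
rewrite [t ^+ k.+3]exprS [t ^+ k.+2]exprS [t ^+ k.+1]exprS [K ^+ k.+1]exprS.
move: ((-1) ^+ k) (t ^+ k) (K ^+ k) (N ^+ k.+3) sg => e x y w sg.
by ring: sg.
Qed.

Lemma f_at_deriv : (f_at k s b Y)^`() = Y^`() *
  (Y ^+ k * (Y + s%:P) * ((k.+3)%:Z%:P * Y + ((k.+1)%:Z * s)%:P)).
Proof.
rewrite /f_at derivD derivC addr0 derivM !deriv_exp !derivD derivC addr0 /= (exprS Y k) expr1.
rewrite polyCM -!natz !polyC_natr -[X in X%:R * Y]addn2 natrD -mulr_natl.
by ring.
Qed.

(** Modulo [J], Y is one of the critical points 0, -s, -(n-2)s/n; at the first two the [J2]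
    condition reads off b, at the third it reads off G(b) through [f_at_taylor]. If p divides n, the
    third forces p | (n-2)s, whence p | 2s. *)
Lemma f_at_critical : J2 (f_at k s b Y) ->
  J (Y ^+ k * (Y + s%:P) * ((k.+3)%:Z%:P * Y + ((k.+1)%:Z * s)%:P)) ->
  ((p ^ 2)%N%:Z %| b)%Z \/
  ((p ^ 2)%N%:Z %| G_at k s b)%Z /\ ((p %| k.+3)%N -> (p%:Z %| 2 * s)%Z).
Proof.
move=> JF; rewrite !in_J_prime -orbA => /or3P[JY|JY|JZ].
- left; have [k0|k0] := posnP k; last by apply: f_at_J2_Y JF (in_JX JY).
  by move: JY; rewrite k0 expr0 in_JC /= dvdz1 => /eqP p1; move: pp; rewrite -[p]/`|p%:Z|%N p1.
- by left; apply: f_at_J2_Ys.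
right; split.
  apply: in_J2C; have [A hA] := f_at_taylor.
  rewrite (_ : (G_at _ _ _)%:P = ((k.+3)%:Z%:P) ^+ k.+3 * f_at k s b Y * (-1) ^+ k.+3
    - A * (((k.+3)%:Z%:P * Y + ((k.+1)%:Z * s)%:P) * ((k.+3)%:Z%:P * Y + ((k.+1)%:Z * s)%:P))).
    by apply: in_J2B; [rewrite mulrAC|]; apply: in_J2Ml => //; apply: in_J2M.
  by rewrite hA expr2; ring.
move=> pn.
have : J ((k.+1)%:Z * s)%:P.
  rewrite -[X in J X](addKr ((k.+3)%:Z%:P * Y)) addrC; apply: in_JB JZ _.
  by rewrite mulrC; apply: in_JMl; rewrite in_JC.
rewrite in_JC => pk.
have -> : 2 * s = (k.+3)%:Z * s - (k.+1)%:Z * s by lia.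
by apply: rpredB => //; apply: dvdz_mulr.
Qed.

(** By Frobenius W is the p-th power of Z = j w + c modulo p, so W in [J] gives Z in [J]. Since p Z
    and Z^2 are in [J2], expanding (Z - c)^p makes j^(p-1) W congruent to a constant modulo [J2]; as
    W^2 is in [J2] too, the cubic reduces to t^2 W + e, a constant after scaling by j^(p-1). *)
Lemma cubic_critical (W w : {poly int}) (t e j c : int) :
  W = j%:P * w ^+ p + c%:P ->
  J2 (W * (W + t%:P) ^+ 2 + e%:P) -> (p%:Z %| e)%Z ->
  ((p ^ 2)%N%:Z %| e)%Z \/
  ((p ^ 2)%N%:Z %| j ^+ p.-1 * e + t ^+ 2 * ((- c) ^+ p + j ^+ p.-1 * c))%Z.
Proof.
move=> hW JF pe.
have : J (W * (W + t%:P) ^+ 2).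
  by rewrite -[X in J X](addrK e%:P); apply: in_JB (in_J2_J JF) _; rewrite in_JC.
have [JWt _|nJWt] := boolP (J (W + t%:P)).
  left; apply: in_J2C; rewrite -[e%:P](addKr (W * (W + t%:P) ^+ 2)) addrC.
  by apply: in_J2B JF _; rewrite expr2; apply: in_J2Ml; apply: in_J2M.
rewrite in_J_prime => /orP[JW|/in_JX]; last by rewrite (negPf nJWt).
right; apply: in_J2C.
have chp : p \in [char {poly 'F_p}] by rewrite pchar_poly pchar_Fp.
have frob x : redp p (x%:P) ^+ p = redp p x%:P.
  by rewrite map_polyC /= -polyC_exp -[X in _ ^+ X](card_Fp pp) expf_card.
have JZ : J (j%:P * w + c%:P).
  apply: (@in_JX _ p); move: JW; rewrite hW /in_J rmorphD rmorphM /= rmorphXn /=.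
  rewrite -{1}frob -[redp p c%:P]frob -exprMn -exprDn_pchar; last by rewrite pnatE.
  by rewrite -rmorphM -rmorphD -rmorphXn.
have p0 := prime_gt0 pp.
have [A hA] := exprB_taylor (j%:P * w + c%:P) c%:P p.-1.
rewrite addrK prednK // exprMn in hA.
pose Z := j%:P * w + c%:P; rewrite -/Z in JZ hA.
have ej : j%:P ^+ p = j%:P * j%:P ^+ p.-1 by rewrite -exprS prednK.
rewrite ej in hA.
have -> : (j ^+ p.-1 * e + t ^+ 2 * ((- c) ^+ p + j ^+ p.-1 * c))%:P =
   j%:P ^+ p.-1 * (W * (W + t%:P) ^+ 2 + e%:P)
   - j%:P ^+ p.-1 * (W + 2 * t%:P) * (W * W)
   - t%:P ^+ 2 * (- c%:P) ^+ p.-1 * (p%:R * Z) - t%:P ^+ 2 * A * (Z * Z).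
  rewrite polyCD (polyCM (j ^+ _) e) (polyCM (t ^+ 2)) polyCD (polyCM _ c) !polyC_exp polyCN.
  move: hA; rewrite hW.
  set x := (- c%:P) ^+ p; set y := (- c%:P) ^+ p.-1; set q := j%:P ^+ p.-1; set v := w ^+ p.
  move=> hA.
  have -> : x = q * (j%:P * v) - p%:R * y * Z - Z ^+ 2 * A.
    by rewrite mulrA [q * _]mulrC hA; ring.
  by ring.
apply: in_J2B; last by apply: in_J2Ml; apply: in_J2M.
apply: in_J2B; last first.
  apply: in_J2Ml; apply: in_J2M => //.
  by rewrite -polyC_natr in_JC natz dvdzz.
by apply: in_J2B; apply: in_J2Ml => //; apply: in_J2M.
Qed.

End LocalIdeals.

(** * Irreducibility and regularity of the two polynomials *)

Lemma regular_at_congr (p : nat) (g h e : {poly int}) : prime p ->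
  g - h = ((p ^ 2)%N%:Z)%:P * e -> regular_at p g -> regular_at p h.
Proof.
move=> pp gh rg pi pirr Jh; apply: (rg pi pirr).
have -> : g = h + e * ((p ^ 2)%N%:Z)%:P by rewrite -[g](subrK h) gh; ring.
by apply: in_J2D Jh _; apply: in_J2Ml; apply: in_J2_dvdC.
Qed.

Lemma f_at_monic (k : nat) (s b : int) (Y : {poly int}) :
  Y \is monic -> (1 < size Y)%N ->
  f_at k s b Y \is monic /\ size (f_at k s b Y) = ((size Y).-1 * k.+3).+1%N.
Proof.
move=> Ym sY.
have Y0 := monic_neq0 Ym.
have [Ysm Yss] : Y + s%:P \is monic /\ size (Y + s%:P) = size Y.
  have ss : (size s%:P < size Y)%N by apply: leq_ltn_trans (size_polyC_leq1 _) sY.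
  by rewrite monicE lead_coefDl // size_polyDl // (monicP Ym).
have hm : Y ^+ k.+1 * (Y + s%:P) ^+ 2 \is monic.
  by rewrite monicMr monic_exp.
have hs : size (Y ^+ k.+1 * (Y + s%:P) ^+ 2) = ((size Y).-1 * k.+3).+1%N.
  rewrite size_monicM ?monic_exp ?monic_neq0 ?monic_exp //.
  have se (g : {poly int}) j : g \is monic -> size (g ^+ j) = ((size g).-1 * j).+1%N.
    by move=> gm; rewrite -size_exp prednK // size_poly_gt0 monic_neq0 ?monic_exp.
  by rewrite !se // Yss addSn addnS -mulnDr addn2.
have ss : (size b%:P < size (Y ^+ k.+1 * (Y + s%:P) ^+ 2)%R)%N.
  apply: leq_ltn_trans (size_polyC_leq1 _) _; rewrite hs.
  by rewrite ltnS muln_gt0 andbT; lia.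
by rewrite /f_at monicE lead_coefDl // size_polyDl // (monicP hm).
Qed.

Lemma f_at_irreducible (p k m : nat) (s b : int) (Y : {poly int}) :
  prime p -> Y \is monic -> (0 < m)%N -> redp p Y = 'X^m ->
  (p%:Z %| s)%Z -> (p%:Z %| b)%Z -> ~~ ((p ^ 2)%N%:Z %| b)%Z ->
  irreducible_over_Q (f_at k s b Y).
Proof.
move=> pp Ym m0 hY ps pb p2b; apply/irreducible_rat_int.
have sY : size Y = m.+1.
  rewrite -(size_polyXn 'F_p m) -hY size_map_poly_id0 //=.
  by rewrite (monicP Ym) oner_neq0.
have sY1 : (1 < size Y)%N by rewrite sY.
have [fm fs] := f_at_monic k s b Ym sY1.
have rz x : (p%:Z %| x)%Z -> redp p x%:P = 0.
  by move=> px; apply/eqP; rewrite map_polyC /= polyC_eq0 intrFp_eq0.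
have rf : redp p (f_at k s b Y) = 'X^(m * k.+3).
  rewrite /f_at !rmorphD rmorphM !rmorphXn /= !rmorphD /= !rz // !addr0 hY.
  by rewrite -exprD exprM addn2.
have Y0 : (p%:Z %| Y`_0)%Z.
  by rewrite -intrFp_eq0 // -coef_map hY coefXn; case: m m0 {hY rf sY}.
apply: (@eisenstein_crit p) => //.
- by rewrite fs sY eqSS -lt0n muln_gt0 m0.
- rewrite (monicP fm) -[1 \in _]/((p%:Z %| 1)%Z) dvdz1 /=.
  by have := prime_gt1 pp; case: (p) => [|[]].
(* The constant coefficient is b modulo p^2, because p divides both the constant coefficient of Y
   and s. *)
- rewrite -horner_coef0 /f_at !(hornerD, hornerM, horner_exp, hornerC) horner_coef0.
  apply: contra p2b => h; rewrite -[b](addKr (Y`_0 ^+ k.+1 * (Y`_0 + s) ^+ 2)) addrC.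
  have e2 : (p ^ 2)%N%:Z = p%:Z ^+ 2 by rewrite expr2; lia.
  rewrite e2; apply: rpredB => //; apply: dvdz_mull.
  rewrite expr2 expr2; apply: dvdz_mul; exact: rpredD.
move=> i; rewrite fs /= sY /= => hi; rewrite -intrFp_eq0 // -coef_map rf coefXn.
by rewrite ltn_eqF.
Qed.

Lemma dvdz_sq (p : nat) (x : int) : ((p ^ 2)%N%:Z %| x)%Z -> (p%:Z %| x)%Z.
Proof. by apply: dvdz_trans; apply: (@dvdn_exp 2 p p). Qed.

Section LocalConditions.
Variable p : nat.
Hypothesis pp : prime p.
Variables (k : nat) (s b : int).

Local Notation "p2%| x" := ((p ^ 2)%N%:Z %| x)%Z (at level 70).

Lemma regular_prime_dvd_const Y : (0 < k)%N \/ (p%:Z %| s)%Z ->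
  (p%:Z %| b)%Z -> ~~ (p2%| b) -> regular_at p (f_at k s b Y).
Proof.
move=> hk pb p2b pi pirr JF; case/negP: p2b.
exact: (f_at_prime_dvd_const pp pirr hk pb JF).
Qed.

Lemma regular_f : ~~ (p2%| b) ->
  ~~ (p2%| G_at k s b) \/ (p %| k.+3)%N /\ ~~ (p%:Z %| 2 * s)%Z ->
  regular_at p (f_at k s b 'X).
Proof.
move=> p2b hG pi pirr JF.
have Jd := in_J2_deriv pp JF; rewrite f_at_deriv derivX mul1r in Jd.
case: (f_at_critical pp pirr JF Jd) => [h|[h1 h2]]; first by rewrite h in p2b.
by case: hG => [|[/h2->]] //; rewrite h1.
Qed.

(** The derivative of F is m x^(m-1) f'(x^m + c). Either x is in [J], and then x^m is in [J2] since
    m >= 2, leaving the constant f(c); or f' vanishes at Y = x^m + c and [f_at_critical] applies. *)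
Lemma regular_F (m : nat) (c : int) : (1 < m)%N -> ~~ (p %| m)%N -> ~~ (p2%| b) ->
  ~~ (p2%| c ^+ k.+1 * (c + s) ^+ 2 + b) ->
  ~~ (p2%| G_at k s b) \/ (p %| k.+3)%N /\ ~~ (p%:Z %| 2 * s)%Z ->
  regular_at p (f_at k s b ('X^m + c%:P)).
Proof.
move=> m1 pm p2b p2f hG pi pirr JF.
have Jd := in_J2_deriv pp JF.
rewrite f_at_deriv derivD derivC addr0 derivXn -mulr_natl -mulrA in Jd.
have {}Jd : in_J pi ('X^(m.-1) * (('X^m + c%:P) ^+ k * ('X^m + c%:P + s%:P)
    * ((k.+3)%:Z%:P * ('X^m + c%:P) + ((k.+1)%:Z * s)%:P))).
  move: Jd; rewrite -polyC_natr natz; apply: in_JMC => //.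
move: Jd; rewrite in_J_prime // => /orP[/(in_JX pirr) JX|Jd].
  case/negP: p2f; apply: (in_J2C pp pirr).
  have [B hB] : exists B, ('X^m + c%:P) ^+ k.+1 * ('X^m + c%:P + s%:P) ^+ 2 =
      (c ^+ k.+1 * (c + s) ^+ 2)%:P + 'X^m * B :> {poly int}.
    have [A hA] : exists A, ('X^m + c%:P) ^+ k.+1 = (c ^+ k.+1)%:P + 'X^m * A :> {poly int}.
      elim: k.+1 => [|j [A hA]]; first by exists 0; rewrite !expr0 mulr0 addr0.
      exists (A * ('X^m + c%:P) + (c ^+ j)%:P).
      by rewrite exprS hA exprS polyCM; ring.
    rewrite hA polyCM [(_ ^+ 2)%:P]polyC_exp polyCD.
    exists (A * ('X^m + c%:P + s%:P) ^+ 2 + (c ^+ k.+1)%:P * ('X^m + 2 * (c%:P + s%:P))).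
    by ring.
  have -> : (c ^+ k.+1 * (c + s) ^+ 2 + b)%:P =
     f_at k s b ('X^m + c%:P) - (B * 'X^(m - 2)) * ('X * 'X).
    rewrite /f_at hB polyCD -{1}(subnK m1) exprD expr2; ring.
  by apply: in_J2B JF _; apply: in_J2Ml; apply: in_J2M.
case: (f_at_critical pp pirr JF Jd) => [h|[h1 h2]]; first by rewrite h in p2b.
by case: hG => [|[/h2->]] //; rewrite h1.
Qed.
End LocalConditions.

Section LocalCubic.
Variable p : nat.
Hypothesis pp : prime p.
Variables (m : nat) (s b c : int).

Local Notation "p2%| x" := ((p ^ 2)%N%:Z %| x)%Z (at level 70).

(** The simple root Y = 0: since p divides m, Y = x^m + c has the form required of W in
    [cubic_critical], with j = 1. *)
Lemma regular_F_cubic_const : (p %| m)%N -> (p%:Z %| b)%Z -> ~~ (p2%| b) ->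
  ~~ (p2%| b + s ^+ 2 * ((- c) ^+ p + c)) ->
  regular_at p (f_at 0 s b ('X^m + c%:P)).
Proof.
move=> pm pb p2b hc pi pirr JF.
have [] := @cubic_critical p pi pp pirr ('X^m + c%:P) 'X^(m %/ p) s b 1 c.
- by rewrite polyC1 mul1r -exprM divnK.
- by move: JF; rewrite /f_at expr1.
- by [].
- by rewrite (negPf p2b).
- by rewrite expr1n !mul1r (negPf hc).
Qed.

(** With W = 3Y + 4s one has 27 f(Y) = W (W - 3s)^2 - G(b): the same shape as f, with -G(b) in the
    role of b and -3s in the role of s. Hence j = 3 in [cubic_critical]. *)
Lemma regular_F_cubic_G : (p %| m)%N ->
  (p%:Z %| G_at 0 s b)%Z -> ~~ (p2%| G_at 0 s b) ->
  ~~ (p2%| 3 ^+ p.-1 * - G_at 0 s b +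
        (- (3 * s)) ^+ 2 * ((- (3 * c + 4 * s)) ^+ p + 3 ^+ p.-1 * (3 * c + 4 * s))) ->
  regular_at p (f_at 0 s b ('X^m + c%:P)).
Proof.
move=> pm pG p2G hc pi pirr JF.
have [] := @cubic_critical p pi pp pirr (3%:P * ('X^m + c%:P) + (4 * s)%:P) 'X^(m %/ p)
   (- (3 * s)) (- G_at 0 s b) 3 (3 * c + 4 * s).
- by rewrite -exprM divnK // mulrDr -addrA -polyCM -polyCD.
- have -> : (3%:P * ('X^m + c%:P) + (4 * s)%:P) *
     (3%:P * ('X^m + c%:P) + (4 * s)%:P + (- (3 * s))%:P) ^+ 2 + (- G_at 0 s b)%:P
     = 27 * f_at 0 s b ('X^m + c%:P).
    rewrite /f_at expr1.
    have -> : (- G_at 0 s b)%:P = 27 * b%:P - 4 * s%:P ^+ 3.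
      rewrite -[4 in RHS](polyC_natr _ 4) -[27 in RHS](polyC_natr _ 27).
      rewrite -polyC_exp -!polyCM -polyCB; congr (_%:P).
      by rewrite /G_at; ring.
    rewrite (polyCM 4) polyCN (polyCM 3).
    by rewrite !(polyC_natr _ 3) (polyC_natr _ 4); ring.
  exact: in_J2Ml.
- by rewrite rpredN.
- by rewrite rpredN (negPf p2G).
- by rewrite (negPf hc).
Qed.

(** Here G(b) = 4 s^3 - 27 b. For odd p already p does not divide it; for p = 2 it is congruent to b
    modulo 4. *)
Lemma G_at0_not_dvd : ~~ (p%:Z %| s)%Z -> (p%:Z %| b)%Z -> ~~ (p2%| b) ->
  ~~ (p2%| G_at 0 s b).
Proof.
move=> ps pb p2b; apply/negP => p2G.
have eG : G_at 0 s b = 4 * s ^+ 3 - 27 * b by rewrite /G_at; ring.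
have [p2|p2] := eqVneq p 2%N.
  move: p2G p2b; rewrite eG p2 => h /negP[].
  have -> : b = 4 * (7 * b - s ^+ 3) + (4 * s ^+ 3 - 27 * b) by ring.
  apply: rpredD => //; exact: dvdz_mulr.
have : (p%:Z %| 4 * s ^+ 3)%Z.
  rewrite -[4 * _](subrK (27 * b)) -eG rpredD //; last exact: dvdz_mull.
  exact: dvdz_sq.
move: ps; rewrite !dvdzE abszM abszX Euclid_dvdM // Euclid_dvdX // => /negPf->.
rewrite orbF => p4; have : (p %| 2 ^ 2)%N by [].
by rewrite Euclid_dvdX // dvdn_prime2 // (negPf p2).
Qed.
End LocalCubic.

(** * Local conditions and their densities *)

(* At [l] the condition is not just regularity: it makes both polynomials
   Eisenstein. *)
Definition good (k m : nat) (s : int) (l p b c : nat) : bool :=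
  if p == l then [&& p %| b, ~~ (p ^ 2 %| b) & p %| c]%N
  else `[< regular_at p (f_at k s b%:Z 'X) /\
           regular_at p (f_at k s b%:Z ('X^m + (c%:Z)%:P)) >].

Lemma f_polyE (k b : nat) (s : int) :
  f_poly k.+3 (2 * s) (s ^+ 2) b = f_at k s b%:Z 'X.
Proof.
rewrite /f_poly /f_at subn1 subn2 /= polyCM polyC_exp (polyC_natr _ 2).
by rewrite exprS ['X^(k.+2)]exprS; ring.
Qed.

Lemma F_polyE (k m b c : nat) (s : int) :
  F_poly k.+3 m (2 * s) (s ^+ 2) b c = f_at k s b%:Z ('X^m + (c%:Z)%:P).
Proof.
rewrite /F_poly /f_at subn1 subn2 /= polyCM polyC_exp (polyC_natr _ 2).
move: ('X^m + _) => Y; rewrite exprS [Y ^+ k.+2]exprS; ring.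
Qed.

Lemma good_monogenic (k m l b c : nat) (s : int) :
  (0 < m)%N -> prime l -> (l%:Z %| s)%Z ->
  (forall p, prime p -> good k m s l p b c) ->
  [/\ irreducible_over_Q (f_poly k.+3 (2 * s) (s ^+ 2) b),
      monogenic (f_poly k.+3 (2 * s) (s ^+ 2) b),
      irreducible_over_Q (F_poly k.+3 m (2 * s) (s ^+ 2) b c) &
      monogenic (F_poly k.+3 m (2 * s) (s ^+ 2) b c)].
Proof.
move=> m0 pl ls hg; rewrite f_polyE F_polyE.
have := hg l pl; rewrite /good eqxx => /and3P[lb l2b lc].
have Xm := monicXnaddC (c%:Z) m0.
have irf : irreducible_over_Q (f_at k s b%:Z 'X).
  apply: (f_at_irreducible k (m := 1) pl (monicX _)) => //.
  by rewrite map_polyX expr1.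
have irF : irreducible_over_Q (f_at k s b%:Z ('X^m + (c%:Z)%:P)).
  apply: (f_at_irreducible k pl Xm m0) => //.
  rewrite rmorphD /= map_polyXn map_polyC /= -[RHS]addr0; congr (_ + _).
  by apply/eqP; rewrite polyC_eq0 intrFp_eq0.
have regl Y : regular_at l (f_at k s b%:Z Y).
  by apply: regular_prime_dvd_const => //; right.
have reg p : prime p -> regular_at p (f_at k s b%:Z 'X) /\
   regular_at p (f_at k s b%:Z ('X^m + (c%:Z)%:P)).
  move=> pp; have [->|pl'] := eqVneq p l; first by split; apply: regl.
  by have := hg p pp; rewrite /good (negPf pl') => /asboolP.
split=> //; apply: dedekind_monogenic => //.
- by have [] := @f_at_monic k s b%:Z 'X (monicX _); rewrite ?size_polyX.
- by move=> p /reg[].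
- by have [] := @f_at_monic k s b%:Z _ Xm; rewrite ?size_XnaddC.
- by move=> p /reg[].
Qed.

(** Changing b or c by a multiple of p^2 changes both polynomials by a multiple of p^2, which lies
    in the square of every ideal (p, pi). This periodicity feeds the Chinese remainder theorem. *)
Lemma good_modn (k m l p b c : nat) (s : int) : prime p ->
  good k m s l p (b %% p ^ 2) (c %% p ^ 2) = good k m s l p b c.
Proof.
move=> pp; rewrite /good; case: eqP => [_|_].
  have pd x : (p %| x %% p ^ 2)%N = (p %| x)%N.
    by rewrite {2}(divn_eq x (p ^ 2)) dvdn_addr // dvdn_mull // dvdn_exp.
  by rewrite !pd [X in ~~ X]/dvdn modn_mod.
have hf (x y : nat) Y : exists e,
   f_at k s x%:Z Y - f_at k s (x %% p ^ 2)%N%:Z Y = ((p ^ 2)%N%:Z)%:P * e.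
  exists ((x %/ p ^ 2)%N%:Z)%:P; rewrite /f_at opprD addrACA subrr add0r -polyCB -polyCM.
  by congr (_%:P); rewrite {1}(divn_eq x (p ^ 2)) PoszD PoszM; ring.
have hc (x : int) : exists e,
   f_at k s x ('X^m + (c%:Z)%:P) - f_at k s x ('X^m + ((c %% p ^ 2)%N%:Z)%:P)
     = ((p ^ 2)%N%:Z)%:P * e.
  have cE : (c%:Z)%:P = ((c %% p ^ 2)%N%:Z)%:P + ((p ^ 2)%N%:Z)%:P * ((c %/ p ^ 2)%N%:Z)%:P
     :> {poly int}.
    by rewrite -polyCM -polyCD {1}(divn_eq c (p ^ 2)) PoszD PoszM; congr (_%:P); ring.
  rewrite cE addrA; move: ('X^m + _) (((p ^ 2)%N%:Z)%:P) ((c %/ p ^ 2)%N%:Z%:P) => Y P2 q.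
  have [A hA] := exprB_taylor (P2 * q) (- Y) k; rewrite opprK in hA.
  rewrite addrC in hA; rewrite /f_at hA.
  exists (q * ((k.+1)%:R * Y ^+ k + P2 * q * A) * (Y + P2 * q + s%:P) ^+ 2
     + Y ^+ k.+1 * q * (2 * (Y + s%:P) + P2 * q)).
  by ring.
apply/asboolP/asboolP=> -[h1 h2]; split.
- have [e he] := hf b 0%N 'X; apply: (regular_at_congr (e := - e) pp _ h1).
  by rewrite mulrN -he opprB.
- have [e he] := hf b 0%N ('X^m + ((c %% p ^ 2)%N%:Z)%:P); have [e' he'] := hc b%:Z.
  apply: (regular_at_congr (e := - e - e') pp _ h2).
  by rewrite mulrBr mulrN -he -he'; ring.
- have [e he] := hf b 0%N 'X; exact: (regular_at_congr pp he h1).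
- have [e he] := hf b 0%N ('X^m + ((c %% p ^ 2)%N%:Z)%:P); have [e' he'] := hc b%:Z.
  apply: (regular_at_congr (e := e + e') pp _ h2).
  by rewrite mulrDr -he -he'; ring.
Qed.

(** * Counting residue classes modulo p^2 *)

Lemma sum_bool_le1 (P : pred nat) (s t : nat) :
  {in [pred x | s <= x < t]%N &, forall x y, P x -> P y -> x = y} ->
  (\sum_(s <= x < t) P x <= 1)%N.
Proof.
move=> inj; rewrite -big_mkcond /= sum1_count -size_filter.
have : uniq [seq x <- index_iota s t | P x] by rewrite filter_uniq // iota_uniq.
have : forall x, x \in [seq x <- index_iota s t | P x] -> P x /\ (s <= x < t)%N.
  by move=> x; rewrite mem_filter mem_index_iota => /andP[].
case: [seq _ <- _ | _] => [|x [|y r]] //= h /and3P[]; rewrite inE negb_or => /andP[/eqP xy].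
case: xy; have [Px hx] := h x (mem_head _ _).
have [|Py hy] := h y; first by rewrite !inE eqxx orbT.
exact: inj.
Qed.

Lemma linear_congruence_le1 (N : nat) (u v : int) (t : nat) :
  coprimez u N%:Z ->
  (\sum_(t <= x < t + N) (N%:Z %| (u * x%:Z + v)%R)%Z <= 1)%N.
Proof.
move=> cop; apply: sum_bool_le1 => x y; rewrite !inE => hx hy Nx Ny.
have : (N%:Z %| u * (x%:Z - y%:Z))%Z.
  have -> : u * (x%:Z - y%:Z) = (u * x%:Z + v) - (u * y%:Z + v) by ring.
  exact: rpredB.
rewrite Gauss_dvdzr 1?coprimez_sym // => /dvdzP[q hq].
have [q0|q0] := eqVneq q 0; first by move: hq; rewrite q0 mul0r; lia.
exfalso; have : (`|x%:Z - y%:Z| >= N%:Z).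
  rewrite hq normrM ler_peMl //; lia.
lia.
Qed.

Lemma linear_congruence_ge (N r : nat) (u v : int) : (0 < N)%N ->
  coprimez u N%:Z ->
  (r <= \sum_(0 <= x < r * N) (N%:Z %| (u * x%:Z + v)%R)%Z)%N.
Proof.
move=> N0 /coprimezP[[x y] /= xy].
elim: r => [//|r IH]; rewrite mulSn addnC (big_cat_nat (n := (r * N)%N)) //=; last exact: leq_addr.
rewrite -addn1 leq_add //.
(* The Bezout coefficient [x] inverts u modulo N, so [z] is the solution -v/u reduced to the
   window. *)
set z := absz (modz (- v * x) N%:Z).
have hz : (z%:Z = ((- v * x) %% N%:Z)%Z).
  by rewrite /z gez0_abs // modz_ge0 //; lia.
have zN : (z < N)%N by rewrite -ltz_nat hz ltz_pmod //; lia.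
have zin : (r * N + z)%N \in index_iota (r * N) (r * N + N).
  by rewrite mem_index_iota leq_addr ltn_add2l.
rewrite (big_rem _ zin) /= (_ : (_ %| _)%Z) // PoszD PoszM hz.
have := divz_eq (- v * x) N%:Z; set q := (_ %/ _)%Z; set w := (_ %% _)%Z => e.
apply/dvdzP; exists (u * r%:Z - u * q + v * y).
have -> : w = - v * x - q * N by rewrite e; ring.
apply/eqP; rewrite -subr_eq0.
rewrite [X in X == 0](_ : _ = v * (1 - (x * u + y * N%:Z))); last by ring.
by rewrite xy subrr mulr0.
Qed.

Definition local_count (k m : nat) (s : int) (l p : nat) : nat :=
  (\sum_(0 <= c < p ^ 2) \sum_(0 <= b < p ^ 2) good k m s l p b c)%N.

Lemma coprimez_prime (p j : nat) (u : int) : prime p -> ~~ (p%:Z %| u)%Z ->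
  coprimez u (p ^ j)%N%:Z.
Proof.
move=> pp pu; rewrite coprimezE /= coprime_sym.
by case: j => [|j]; rewrite ?coprime1n // coprime_pexpl // prime_coprime.
Qed.

Lemma leq_sum_range (a n : nat) (E F : nat -> nat) :
  (forall i, i < n -> E i <= F i)%N ->
  (\sum_(a <= i < n) E i <= \sum_(a <= i < n) F i)%N.
Proof.
move=> h; rewrite big_nat_cond [leqRHS]big_nat_cond.
by apply: leq_sum => i /andP[/andP[_ /h]].
Qed.

Lemma sum_ge_term (n i : nat) (F : nat -> nat) :
  (i < n)%N -> (F i <= \sum_(0 <= j < n) F j)%N.
Proof.
by move=> hi; rewrite (big_rem i) ?mem_index_iota //= leq_addr.
Qed.

Section LocalCount.
Variables (k m : nat) (s : int) (l p : nat).
Hypothesis pp : prime p.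

Let p0 := prime_gt0 pp.
Let p1 := prime_gt1 pp.

Lemma count_sq_le1 (u v : int) : ~~ (p%:Z %| u)%Z ->
  (\sum_(0 <= b < p ^ 2) ((p ^ 2)%N%:Z %| (u * b%:Z + v)%R)%Z <= 1)%N.
Proof.
by move=> pu; apply: (@linear_congruence_le1 (p ^ 2) u v 0); apply: coprimez_prime.
Qed.

Lemma count_prime_ge (u v : int) : ~~ (p%:Z %| u)%Z ->
  (p <= \sum_(0 <= b < p ^ 2) (p%:Z %| (u * b%:Z + v)%R)%Z)%N.
Proof.
move=> pu; apply: (@linear_congruence_ge p p u v p0).
by rewrite -[p in X in coprimez _ X]expn1; apply: coprimez_prime.
Qed.

Lemma pn1 : ~~ (p%:Z %| 1)%Z.
Proof. by rewrite dvdzE /= dvdn1 neq_ltn p1 orbT. Qed.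

Lemma count_b_sq_le1 (v : int) :
  (\sum_(0 <= b < p ^ 2) ((p ^ 2)%N%:Z %| (b%:Z + v)%R)%Z <= 1)%N.
Proof.
have := @count_sq_le1 1 v pn1.
by under eq_bigr do rewrite mul1r.
Qed.

Lemma count_b_sq0_le1 : (\sum_(0 <= b < p ^ 2) (p ^ 2 %| b) <= 1)%N.
Proof.
by have := count_b_sq_le1 0; under eq_bigr do rewrite addr0.
Qed.

Lemma count_b_ge : (p <= \sum_(0 <= b < p ^ 2) (p %| b))%N.
Proof.
by have := @count_prime_ge 1 0 pn1; under eq_bigr do rewrite mul1r addr0.
Qed.

Lemma local_count_ge (r : nat) :
  (forall c, c < p ^ 2 -> r <= \sum_(0 <= b < p ^ 2) good k m s l p b c)%N ->
  (p ^ 2 * r <= local_count k m s l p)%N.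
Proof.
move=> h; rewrite -[X in (X * _)%N]subn0 -sum_nat_const_nat.
by apply: leq_sum_range.
Qed.

Lemma local_count_eisenstein : p = l -> (p * p.-1 <= local_count k m s l p)%N.
Proof.
move=> pl; rewrite /local_count /good pl eqxx -pl.
have e : (\sum_(0 <= c < p ^ 2) (p %| c) * p.-1 <=
   \sum_(0 <= c < p ^ 2) \sum_(0 <= b < p ^ 2) [&& p %| b, ~~ (p ^ 2 %| b) & p %| c])%N.
  apply: leq_sum_range => c _.
  case: (p %| c)%N; last by rewrite mul0n.
  rewrite mul1n -(leq_add2r 1) addn1 prednK //.
  apply: leq_trans count_b_ge _; apply: leq_trans (leq_add (leqnn _) count_b_sq0_le1).
  rewrite -big_split /=; apply: leq_sum_range => b _.
  by case: (p %| b)%N => //=; case: (p ^ 2 %| b)%N.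
apply: leq_trans e; rewrite -big_distrl /= leq_mul2r count_b_ge orbT //.
Qed.

Hypothesis pl : p != l.

Lemma goodE b c : good k m s l p b c =
  `[< regular_at p (f_at k s b%:Z 'X) /\
           regular_at p (f_at k s b%:Z ('X^m + (c%:Z)%:P)) >].
Proof. by rewrite /good (negPf pl). Qed.

(** Whatever c is, p - 1 classes of b modulo p^2 are divisible by p exactly once. *)
Lemma local_count_prime_dvd_const : (0 < k)%N \/ (p%:Z %| s)%Z ->
  (p ^ 2 * p.-1 <= local_count k m s l p)%N.
Proof.
move=> hk; apply: local_count_ge => c _.
rewrite -(leq_add2r 1) addn1 prednK //.
apply: leq_trans count_b_ge _; apply: leq_trans (leq_add (leqnn _) count_b_sq0_le1).
rewrite -big_split /=; apply: leq_sum_range => b _.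
have [pb|] := boolP (p %| b)%N => //; have [p2b|p2b] := boolP (p ^ 2 %| b)%N.
  by rewrite addn1.
rewrite addn0 goodE; case: asboolP => // -[].
by split; apply: regular_prime_dvd_const.
Qed.

(** For each c at most three classes of b are lost, those where p^2 divides b, f(c) or G(b). If p
    divides n, G is not injective modulo p^2, but then the third critical point is absent modulo p;
    hence the guard in [badG]. *)
Lemma local_count_generic : (1 < m)%N -> ~~ (p %| m)%N ->
  ~~ (p %| k.+3)%N \/ ~~ (p%:Z %| 2 * s)%Z ->
  (p ^ 2 * (p ^ 2 - 3) <= local_count k m s l p)%N.
Proof.
move=> m1 pm hn; apply: local_count_ge => c _; rewrite leq_subLR.
pose badG b := ~~ (p %| k.+3)%N && ((p ^ 2)%N%:Z %| G_at k s b%:Z)%Z.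
have badG1 : (\sum_(0 <= b < p ^ 2) badG b <= 1)%N.
  rewrite /badG; have [pn|pn] := boolP (p %| k.+3)%N; first by rewrite big1.
  apply: count_sq_le1; rewrite dvdzE abszX abszN Euclid_dvdX // andbT //.
have badf1 := count_b_sq_le1 (c%:Z ^+ k.+1 * (c%:Z + s) ^+ 2).
have badb1 := count_b_sq0_le1.
have : (\sum_(0 <= b < p ^ 2) 1 <= \sum_(0 <= b < p ^ 2) (good k m s l p b c +
   ((p ^ 2 %| b) + (((p ^ 2)%N%:Z %| (b%:Z + c%:Z ^+ k.+1 * (c%:Z + s) ^+ 2)%R)%Z + badG b))))%N.
  apply: leq_sum_range => b _.
  have [p2b|p2b] := boolP (p ^ 2 %| b)%N; first by rewrite /= ?(add1n, addn1, addnS, addSn).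
  case: (boolP (_ %| _)%Z) => [|p2f]; first by rewrite /= ?(add1n, addn1, addnS, addSn).
  have [bG|nG] := boolP (badG b); first by rewrite /= ?(add1n, addn1, addnS, addSn).
  rewrite goodE; case: asboolP => // -[].
  have hG : ~~ ((p ^ 2)%N%:Z %| G_at k s b%:Z)%Z \/ (p %| k.+3)%N /\ ~~ (p%:Z %| 2 * s)%Z.
    move: nG; rewrite /badG; case: (boolP (p %| k.+3)%N) => pn /=; last by left.
    by right; split=> //; case: hn; rewrite ?pn.
  split; first exact: regular_f.
  by apply: regular_F => //; rewrite addrC.
rewrite sum_nat_const_nat subn0 muln1 !big_split /= => /leq_trans -> //.
by rewrite addnC leq_add2r -[3%N]/(1 + (1 + 1))%N !leq_add.
Qed.

(** The density wanted is 1/4, from Lambda_n, times 1/4, from (p-1)/p^2. Among 16 pairs this asks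
    for one, and b = 2, c = 0 works. *)
Lemma local_count_cubic2 : k = 0%N -> (2 %| m)%N -> ~~ (2%:Z %| s)%Z -> p = 2%N ->
  (1 <= local_count k m s l p)%N.
Proof.
move=> k0 pm ps p2; rewrite /local_count.
apply: leq_trans (sum_ge_term (i := 0) _ _); last by rewrite p2.
apply: leq_trans (sum_ge_term (i := 2) _ _); last by rewrite p2.
rewrite lt0b.
have nb : ~~ ((p ^ 2)%N%:Z %| 2%:Z)%Z by rewrite p2.
have db : (p%:Z %| 2%:Z)%Z by rewrite p2.
rewrite goodE k0; apply/asboolP; split.
  apply: regular_f => //; left; apply: G_at0_not_dvd => //; rewrite p2 //.
apply: regular_F_cubic_const => //; first by rewrite p2.
by rewrite oppr0 expr0n p2 /= addr0 mulr0 addr0.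
Qed.

(** The density wanted is (1 - 3/9)(2/9), that is 12 pairs out of 81. For each c the candidates are
    b = 3, 6 modulo 9, of which [regular_F_cubic_const] loses at most one, and none if 9 divides c -
    c^3, for then its condition only says that 9 does not divide b. *)
Lemma local_count_cubic3 : k = 0%N -> (3 %| m)%N -> ~~ (3%:Z %| s)%Z -> p = 3%N ->
  (12 <= local_count k m s l p)%N.
Proof.
move=> k0 pm ps p3; rewrite /local_count.
pose e c := ((p ^ 2)%N%:Z %| (- c%:Z) ^+ p + c%:Z)%Z.
have h c : (1 + e c <= \sum_(0 <= b < p ^ 2) good k m s l p b c)%N.
  have hc := count_b_sq_le1 (s ^+ 2 * ((- c%:Z) ^+ p + c%:Z)).
  have badb1 := count_b_sq0_le1.
  have : (\sum_(0 <= b < p ^ 2) (p %| b) <= \sum_(0 <= b < p ^ 2) (good k m s l p b c +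
   ((p ^ 2 %| b) + (~~ e c && ((p ^ 2)%N%:Z %| (b%:Z + s ^+ 2 * ((- c%:Z) ^+ p + c%:Z))%R)%Z))))%N.
    apply: leq_sum_range => b _.
    have [pb|] := boolP (p %| b)%N => //.
    have [p2b|p2b] := boolP (p ^ 2 %| b)%N; first by rewrite /= ?(add1n, addn1, addnS, addSn).
    case: (boolP (~~ e c && _)) => [|p2f]; first by rewrite /= ?(add1n, addn1, addnS, addSn).
    rewrite goodE k0; case: asboolP => // -[].
    split; first by apply: regular_f => //; left; apply: G_at0_not_dvd => //; rewrite p3.
    apply: regular_F_cubic_const; rewrite // ?p3 //.
    rewrite -p3; move: p2f; rewrite negb_and negbK => /orP[ec|//].
    by rewrite rpredDr //; apply: dvdz_mull.
  rewrite !big_split /= => H; have := leq_trans count_b_ge H.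
  have : (\sum_(0 <= b < p ^ 2) (~~ e c && ((p ^ 2)%N%:Z %|
     (b%:Z + s ^+ 2 * ((- c%:Z) ^+ p + c%:Z))%R)%Z) <= ~~ e c)%N.
    by case: (e c) => /=; first by rewrite big1.
  move: hc badb1 H.
  do 4 move: (\sum_(0 <= i < _) _)%N => ?.
  by case: (e c) => /=; lia.
have : (\sum_(0 <= c < p ^ 2) (1 + e c) <=
   \sum_(0 <= c < p ^ 2) \sum_(0 <= b < p ^ 2) good k m s l p b c)%N.
  by apply: leq_sum_range.
(* Direct evaluation: [e] holds at c = 0, 1, 8 among the nine residues, which gives 9 + 3 = 12. *)
apply: leq_trans; rewrite {1}p3 /e p3.
by rewrite unlock.
Qed.

(** The classes with p exactly dividing b, less one, leave p - 2, short of the required (p - 1)(1 -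
    3/p^2). The classes with p exactly dividing G(b), less one, are disjoint from these since p does
    not divide 4 s^3, and contribute p - 2 more. *)
Lemma local_count_cubic : k = 0%N -> (p %| m)%N -> ~~ (p%:Z %| s)%Z -> (5 <= p)%N ->
  (p ^ 2 * (2 * (p - 2)) <= local_count k m s l p)%N.
Proof.
move=> k0 pm ps p5; apply: local_count_ge => c _.
have p3 : ~~ (p%:Z %| 3)%Z by rewrite dvdzE /=; apply/negP => /dvdn_leq; lia.
have p4s : ~~ (p%:Z %| 4 * s ^+ 3)%Z.
  rewrite dvdzE abszM Euclid_dvdM // abszX Euclid_dvdX // negb_or andbT.
  by rewrite -dvdzE ps andbT /=; apply/negP => /dvdn_leq; lia.
have eG (b : nat) : G_at 0 s b%:Z = - 27 * b%:Z + 4 * s ^+ 3 by rewrite /G_at; ring.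
have p27 : ~~ (p%:Z %| - 27)%Z.
  by rewrite dvdzE -[X in (_ %| X)%N]/(3 ^ 3)%N Euclid_dvdX // andbT.
pose v1 := s ^+ 2 * ((- c%:Z) ^+ p + c%:Z).
pose v2 := (- (3 * s)) ^+ 2 * ((- (3 * c%:Z + 4 * s)) ^+ p
              + 3 ^+ p.-1 * (3 * c%:Z + 4 * s)).
have e2 (b : nat) : 3 ^+ p.-1 * - G_at 0 s b%:Z + v2 =
    (3 ^+ p.-1 * 27) * b%:Z + (v2 - 3 ^+ p.-1 * (4 * s ^+ 3)) by rewrite eG; ring.
have h1 := count_b_sq0_le1.
have h2 := count_b_sq_le1 v1.
have h3 := count_sq_le1 (4 * s ^+ 3) p27.
have h4 : (\sum_(0 <= b < p ^ 2) ((p ^ 2)%N%:Z %| (3 ^+ p.-1 * 27 * b%:Z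
    + (v2 - 3 ^+ p.-1 * (4 * s ^+ 3)))%R)%Z <= 1)%N.
  apply: count_sq_le1; rewrite dvdzE abszM Euclid_dvdM // abszX.
  rewrite Euclid_dvdX // negb_or -!dvdzE (negPf p3) /=.
  by rewrite -rpredN.
have g1 := count_b_ge.
have g2 := count_prime_ge (4 * s ^+ 3) p27.
have : (\sum_(0 <= b < p ^ 2) ((p %| b) + (p%:Z %| (- 27 * b%:Z + 4 * s ^+ 3)%R)%Z) <=
  \sum_(0 <= b < p ^ 2) (good k m s l p b c + ((p ^ 2 %| b) +
   (((p ^ 2)%N%:Z %| (b%:Z + v1)%R)%Z + (((p ^ 2)%N%:Z %| (- 27 * b%:Z + 4 * s ^+ 3)%R)%Z
   + ((p ^ 2)%N%:Z %| (3 ^+ p.-1 * 27 * b%:Z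
    + (v2 - 3 ^+ p.-1 * (4 * s ^+ 3)))%R)%Z)))))%N.
  apply: leq_sum_range => b _.
  have [pb|pb] := boolP (p %| b)%N.
    have -> : (p%:Z %| (- 27 * b%:Z + 4 * s ^+ 3)%R)%Z = false.
      by apply/negP; rewrite rpredDl ?(negPf p4s) // dvdz_mull.
    have [p2b|p2b] := boolP (p ^ 2 %| b)%N; first by rewrite /= ?(add1n, addn1, addnS, addSn).
    case: (boolP (_ %| (b%:Z + v1)%R)%Z) => [|p2f]; first by rewrite /= ?(add1n, addn1, addnS, addSn).
    rewrite goodE k0; case: asboolP => [|[]]; first by rewrite /= ?(add1n, addn1, addnS, addSn).
    split; first by apply: regular_f => //; left; apply: G_at0_not_dvd.
    exact: regular_F_cubic_const.
  case: (boolP (p%:Z %| _)%Z) => // pG.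
  case: (boolP ((p ^ 2)%N%:Z %| (- 27 * _ + _)%R)%Z) => [|p2G]; first by rewrite /= ?(add1n, addn1, addnS, addSn).
  rewrite -e2 -eG in pG p2G *.
  case: (boolP (_ %| (3 ^+ p.-1 * - _ + _)%R)%Z) => [|p2f]; first by rewrite /= ?(add1n, addn1, addnS, addSn).
  rewrite goodE k0; case: asboolP => [|[]]; first by rewrite /= ?(add1n, addn1, addnS, addSn).
  split; first by apply: regular_f => //; [apply: contra pb => /dvdz_sq|left].
  exact: regular_F_cubic_G.
rewrite !big_split /=; move: h1 h2 h3 h4 g1 g2.
clear; do 7 move: (\sum_(0 <= i < _) _)%N => ?.
by lia.
Qed.
End LocalCount.

(** * Square factors of consecutive integers under abc *)

Lemma prod_primes_dvd (m : nat) (s : seq nat) : uniq s ->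
  all (fun p => prime p && (p %| m)%N) s -> (\prod_(p <- s) p %| m)%N.
Proof.
elim: s => [|p s IH] /=; first by rewrite big_nil dvd1n.
move=> /andP[ps us] /andP[/andP[pp pm] al]; rewrite big_cons Gauss_dvd ?pm ?IH //.
rewrite big_seq; apply: (big_ind (coprime p)); first exact: coprimen1.
  by move=> x y px py; rewrite coprimeMr px.
move=> q qs; have /allP/(_ q qs)/andP[pq _] := al.
by rewrite prime_coprime // dvdn_prime2 //; apply: contraNneq ps => ->.
Qed.

Lemma radn_dvd (n m : nat) :
  (forall p, prime p -> p %| n -> p %| m)%N -> (0 < n)%N -> (radn n %| m)%N.
Proof.
move=> h n0; apply: prod_primes_dvd; first exact: primes_uniq.
by apply/allP => p; rewrite mem_primes => /and3P[pp _ pn]; rewrite pp h.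
Qed.

Lemma radn_gt0 (n : nat) : (0 < radn n)%N.
Proof.
rewrite /radn big_seq_cond prodn_cond_gt0 // => p.
by rewrite andbT mem_primes => /and3P[/prime_gt0].
Qed.

Lemma dvdn_radn (p n : nat) : prime p -> (0 < n)%N -> (p %| n)%N -> (p %| radn n)%N.
Proof.
move=> pp n0 pn; have pin : p \in primes n by rewrite mem_primes pp n0.
by rewrite /radn (big_rem _ pin) /= dvdn_mulr.
Qed.

Lemma radnM_dvd (a b : nat) : (0 < a)%N -> (0 < b)%N ->
  (radn (a * b) %| radn a * radn b)%N.
Proof.
move=> a0 b0; apply: radn_dvd; last by rewrite muln_gt0 a0.
move=> p pp; rewrite Euclid_dvdM // => /orP[h|h].
  by apply: dvdn_mulr; apply: dvdn_radn.
by apply: dvdn_mull; apply: dvdn_radn.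
Qed.

Lemma radnM_le (a b : nat) : (0 < a)%N -> (0 < b)%N ->
  (radn (a * b) <= radn a * radn b)%N.
Proof.
by move=> a0 b0; rewrite dvdn_leq ?radnM_dvd // muln_gt0 !radn_gt0.
Qed.

Lemma radn_le (a : nat) : (0 < a)%N -> (radn a <= a)%N.
Proof. by move=> a0; rewrite dvdn_leq // radn_dvd. Qed.

Lemma radn_sq_le (a q : nat) : (0 < a)%N -> prime q -> (q ^ 2 %| a)%N ->
  (radn a * q <= a)%N.
Proof.
move=> a0 pq /dvdnP[x ax]; have q0 := prime_gt0 pq.
have x0 : (0 < x)%N by move: a0; rewrite ax muln_gt0 => /andP[].
rewrite {2}ax expnS expn1 mulnA leq_mul2r; apply/orP; right.
rewrite dvdn_leq ?muln_gt0 ?x0 //; apply: radn_dvd => // p pp.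
by rewrite ax expnS expn1 mulnA Euclid_dvdM // => /orP[//|h]; apply: dvdn_mull.
Qed.

Lemma radn_prod_le (k : nat) (F : nat -> nat) : (forall i, 0 < F i)%N ->
  (radn (\prod_(0 <= i < k) F i) <= \prod_(0 <= i < k) radn (F i))%N.
Proof.
move=> F0; elim: k => [|k IH]; first by rewrite !big_nil /radn big_nil.
rewrite !big_nat_recr //=; apply: leq_trans (radnM_le _ _) _ => //.
  exact: prodn_gt0.
by rewrite leq_mul2r IH orbT.
Qed.

Lemma gcdnM_le (a b c : nat) : (0 < c)%N ->
  (gcdn (a * b) c <= gcdn a c * gcdn b c)%N.
Proof.
move=> c0; apply: dvdn_leq; first by rewrite muln_gt0 !gcdn_gt0 c0 !orbT.
rewrite muln_gcdr dvdn_gcd !muln_gcdl !dvdn_gcd dvdn_gcdl /=.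
have gc : (gcdn (a * b) c %| c)%N by apply: dvdn_gcdr.
by rewrite (dvdn_mulr b gc) !(dvdn_mull _ gc).
Qed.

Lemma gcdn_prod_le (s t : seq nat) (f : nat -> nat) (B : nat) : (0 < B)%N ->
  (forall i, 0 < f i)%N ->
  {in s & t, forall i j, gcdn (f i) (f j) <= B}%N ->
  (gcdn (\prod_(i <- s) f i) (\prod_(j <- t) f j) <= B ^ (size s * size t))%N.
Proof.
move=> B0 f0; elim: s => [|i s IH] h; first by rewrite big_nil gcd1n.
have pt0 (r : seq nat) : (0 < \prod_(j <- r) f j)%N by apply: prodn_gt0.
rewrite big_cons; apply: leq_trans (gcdnM_le _ _ (pt0 t)) _.
rewrite /= mulSn expnD leq_mul //; last first.
  by apply: IH => x y xs; apply: h; rewrite inE xs orbT.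
have {}h : {in t, forall j, gcdn (f i) (f j) <= B}%N.
  by move=> j; apply: h; rewrite mem_head.
elim: t {IH} h => [|j t IHt] h; first by rewrite big_nil gcdn1.
rewrite big_cons gcdnC; apply: leq_trans (gcdnM_le _ _ (f0 i)) _.
rewrite /= expnS leq_mul //; first by rewrite gcdnC h ?mem_head.
by rewrite gcdnC IHt // => x xt; rewrite h // inE xt orbT.
Qed.

(* Multisets of even and odd shifts: the quotient of the products of the
   [X + i] is the [j]-th multiplicative finite difference of [X / (X + 1)],
   hence it is 1 + O(X^-(j+1)). *)
Fixpoint shifts (j : nat) : seq nat * seq nat :=
  if j is j'.+1 then
    ((shifts j').1 ++ map S (shifts j').2, (shifts j').2 ++ map S (shifts j').1)
  else ([:: 0%N], [:: 1%N]).

Lemma shiftsP (j : nat) :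
  [/\ size (shifts j).1 = (2 ^ j)%N, size (shifts j).2 = (2 ^ j)%N,
      {in (shifts j).1, forall i, ~~ odd i /\ (i <= j.+1)%N} &
      {in (shifts j).2, forall i, odd i /\ (i <= j.+1)%N}].
Proof.
elim: j => [|j [s1 s2 h1 h2]] /=.
  by split=> // i; rewrite inE => /eqP->.
split; rewrite ?size_cat ?size_map ?s1 ?s2 ?expnS ?mul2n ?addnn //.
- move=> i; rewrite mem_cat => /orP[/h1[-> h]|/mapP[x /h2[ox h] ->]].
    by rewrite (leq_trans h).
  by rewrite /= negbK.
- move=> i; rewrite mem_cat => /orP[/h2[-> h]|/mapP[x /h1[ox h] ->]].
    by rewrite (leq_trans h).
  by rewrite /= ox.
Qed.

Definition shift_poly (s : seq nat) : {poly int} := \prod_(i <- s) ('X + (i%:Z)%:P).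

Lemma size_shift_sub (A : {poly int}) :
  (size (A \Po ('X + 1%:P) - A)%R <= (size A).-1)%N.
Proof.
have [->|A0] := eqVneq A 0; first by rewrite comp_poly0 subrr size_poly0.
have sX : size ('X + 1%:P : {poly int}) = 2%N by rewrite size_XaddC.
have sC : size (A \Po ('X + 1%:P)) = size A by rewrite size_comp_poly2.
apply/leq_sizeP => i hi; rewrite coefB.
have [hi2|hi2] := leqP (size A) i.
  by rewrite !nth_default ?sC // subrr.
have -> : i = (size A).-1.
  by move: hi hi2; rewrite -ltnS; case: (size A) => //= a; lia.
rewrite -lead_coefE -[in X in X - _]sC -lead_coefE lead_coef_comp ?sX //.
by rewrite lead_coefXaddC expr1n mulr1 subrr.
Qed.

(** A discrete Wronskian: written with the differences A(X+1) - A and B(X+1) - B, each of its two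
    terms loses one degree. *)
Lemma size_cross_shift (A B : {poly int}) :
  (size (A * (B \Po ('X + 1%:P)) - B * (A \Po ('X + 1%:P)))%R <= (size A + size B).-2)%N.
Proof.
set A1 := A \Po ('X + 1%:P) - A; set B1 := B \Po ('X + 1%:P) - B.
have -> : A * (B \Po ('X + 1%:P)) - B * (A \Po ('X + 1%:P)) = A * B1 - B * A1.
  by rewrite /A1 /B1; ring.
have hA := size_shift_sub A; have hB := size_shift_sub B.
rewrite -/A1 -/B1 in hA hB.
have [A0|A0] := eqVneq A 0.
  by rewrite /A1 A0 comp_poly0 subrr !mul0r mulr0 subrr size_poly0.
have [B0|B0] := eqVneq B 0.
  by rewrite /B1 B0 comp_poly0 subrr !mul0r mulr0 subrr size_poly0.
rewrite -size_poly_gt0 in A0; rewrite -size_poly_gt0 in B0.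
have aux (a b c : nat) : (c <= a.-1)%N -> (0 < a)%N -> ((b + c).-1 <= (b + a).-2)%N by lia.
apply: leq_trans (size_polyD _ _) _; rewrite size_polyN geq_max; apply/andP; split.
  by apply: leq_trans (size_polyMleq _ _) _; apply: aux.
by apply: leq_trans (size_polyMleq _ _) _; rewrite (addnC (size A)); apply: aux.
Qed.

(** The difference at stage j + 1 is the discrete Wronskian of U and V, which does not change when U
    is replaced by U - V. The new degree is therefore below deg(U - V) + deg V, and the gap to the
    full degree grows by one at each stage. *)
Lemma size_shift_poly_sub (j : nat) :
  (size (shift_poly (shifts j).1 - shift_poly (shifts j).2)%R + j <= 2 ^ j)%N.
Proof.
elim: j => [|j IH].
  rewrite /shift_poly /= !big_seq1 opprD addrACA subrr add0r -polyCB.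
  by rewrite size_polyC.
set U := shift_poly (shifts j).1 in IH; set V := shift_poly (shifts j).2 in IH.
have comp s : shift_poly (map S s) = shift_poly s \Po ('X + 1%:P).
  rewrite /shift_poly big_map rmorph_prod /=; apply: eq_bigr => i _.
  by rewrite comp_polyD comp_polyX comp_polyC -addrA -polyCD intS.
have -> : shift_poly (shifts j.+1).1 = U * (V \Po ('X + 1%:P)).
  by rewrite /shift_poly /= big_cat /= -/(shift_poly (map S _)) comp.
have -> : shift_poly (shifts j.+1).2 = V * (U \Po ('X + 1%:P)).
  by rewrite /shift_poly /= big_cat /= -/(shift_poly (map S _)) comp.
have -> : U * (V \Po ('X + 1%:P)) - V * (U \Po ('X + 1%:P)) =
   (U - V) * (V \Po ('X + 1%:P)) - V * ((U - V) \Po ('X + 1%:P)).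
  by rewrite comp_polyB; ring.
have sV : size V = (2 ^ j).+1%N.
  have [_ <- _ _] := shiftsP j.
  rewrite -(size_prod_XsubC (shifts j).2 (fun i => - i%:Z)) /V /shift_poly.
  by under eq_bigr do rewrite -[_%:Z]opprK polyCN.
have := size_cross_shift (U - V) V; rewrite sV expnS.
move: (size _) (size (U - V)) IH => x y; have := expn_gt0 2 j; lia.
Qed.

Definition shift_prod (s : seq nat) (M : nat) : nat := (\prod_(i <- s) (M + i))%N.

Lemma horner_shift_poly (s : seq nat) (M : nat) :
  (shift_poly s).[M%:Z] = (shift_prod s M)%:Z.
Proof.
rewrite /shift_poly horner_prod /shift_prod (big_morph Posz PoszM (erefl 1%:Z)).
by apply: eq_bigr => i _; rewrite hornerD hornerX hornerC.
Qed.

Lemma shift_prod_sub_le (j : nat) : exists A : nat, forall M : nat, (0 < M)%N ->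
  `|(shift_prod (shifts j).1 M)%:Z - (shift_prod (shifts j).2 M)%:Z|
    <= (A * M ^ (2 ^ j - j.+1))%N%:Z.
Proof.
set W := shift_poly (shifts j).1 - shift_poly (shifts j).2.
have sW : (size W + j <= 2 ^ j)%N := size_shift_poly_sub j.
have aux (i t k P : nat) : (i < t)%N -> (t + k <= P)%N -> (i <= P - k.+1)%N by lia.
exists (\sum_(i < size W) `|(W`_i)%R|)%N => M M0.
rewrite -!horner_shift_poly -hornerN -hornerD -/W horner_coef.
apply: le_trans (ler_norm_sum _ _ _) _.
rewrite PoszM (big_morph Posz PoszD (erefl 0%:Z)) mulr_suml; apply: ler_sum => i _.
rewrite normrM abszE ler_wpM2l // normrX ger0_norm // -[M%:Z]natz -[X in _ <= X]natz.
by rewrite -natrX ler_nat leq_pexp2l //; apply: aux (ltn_ord i) sW.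
Qed.

(** The choice eps = 1/E followed by raising to the power E removes real exponents from the rest of
    the argument. *)
Lemma abc_pow (R : realType) : abc_conjecture R -> forall E : nat, (0 < E)%N ->
  exists2 K : R, 0 < K & forall u v w : nat,
    (0 < u)%N -> (0 < v)%N -> (0 < w)%N ->
    gcdn (gcdn u v) w = 1%N -> (u + v = w)%N ->
    w%:R ^+ E <= K * (radn (u * v * w))%:R ^+ E.+1.
Proof.
move=> abc E E0; have E0' : 0 < E%:R :> R by rewrite ltr0n.
have [|K hK] := abc (E%:R^-1); first by rewrite invr_gt0.
exists ((`|K| + 1) ^+ E); first by rewrite exprn_gt0 // ltr_wpDl.
move=> u v w u0 v0 w0 g e; set r := (radn _)%:R.
have r0 : 0 <= r by exact: ler0n.
have h : w%:R <= (`|K| + 1) * r `^ (1 + E%:R^-1).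
  apply: le_trans (hK u v w u0 v0 w0 g e) _; rewrite -/r ler_wpM2r ?powR_ge0 //.
  by apply: le_trans (ler_norm _) _; rewrite lerDl.
have -> : r ^+ E.+1 = (r `^ (1 + E%:R^-1)) ^+ E.
  rewrite -!powR_mulrn ?powR_ge0 // -powRrM; congr (_ `^ _).
  by rewrite mulrDl mul1r mulVf ?gt_eqF // -natr1.
by rewrite -exprMn lerXn2r // nnegrE ?ler0n // mulr_ge0 ?powR_ge0 // addr_ge0.
Qed.

(** For x < y, abc is applied to x/g + (y - x)/g = y/g with g the gcd; the radical of the difference
    is bounded by the difference itself, which will be small. *)
Lemma abc_distinct (R : realType) : abc_conjecture R -> forall E : nat, (0 < E)%N ->
  exists2 K : R, 0 < K & forall x y : nat, (0 < x)%N -> (0 < y)%N -> x != y ->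
    (x%:R / (gcdn x y)%:R) ^+ E <=
      K * ((radn (x * y))%:R * `|x%:R - y%:R|) ^+ E.+1.
Proof.
move=> abc E E0; have [K K0 hK] := abc_pow abc E0; exists K => // x y x0 y0.
have key a b : (0 < a)%N -> (a < b)%N ->
    (b%:R / (gcdn a b)%:R) ^+ E <=
      K * ((radn (a * b))%:R * (b - a)%:R) ^+ E.+1.
  move=> a0 ab; have b0 : (0 < b)%N by apply: leq_trans ab.
  have g0 : (0 < gcdn a b)%N by rewrite gcdn_gt0 a0.
  set g := gcdn a b in g0 *.
  have ga : (g %| a)%N by apply: dvdn_gcdl.
  have gb : (g %| b)%N by apply: dvdn_gcdr.
  have gba : (g %| b - a)%N by rewrite dvdn_sub.
  have q0 z : (g %| z)%N -> (0 < z)%N -> (0 < z %/ g)%N.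
    by move=> gz z0; rewrite divn_gt0 // dvdn_leq.
  have ba0 : (0 < b - a)%N by rewrite subn_gt0.
  have := hK (a %/ g)%N ((b - a) %/ g)%N (b %/ g)%N (q0 _ ga a0) (q0 _ gba ba0) (q0 _ gb b0).
  have cop : coprime (a %/ g) (b %/ g).
    rewrite /coprime -(eqn_pmul2r g0) mul1n muln_gcdl !divnK //.
  have h1 : gcdn (gcdn (a %/ g) ((b - a) %/ g)) (b %/ g) = 1%N.
    by rewrite gcdnAC; move/eqP: cop => ->; rewrite gcd1n.
  have h2 : (a %/ g + (b - a) %/ g = b %/ g)%N.
    by rewrite -divnDl // subnKC // ltnW.
  move=> /(_ h1 h2) h.
  have -> : (b%:R / g%:R : R) = (b %/ g)%:R.
    by rewrite -{1}(divnK gb) natrM mulfK // pnatr_eq0 -lt0n.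
  apply: le_trans h _; rewrite ler_wpM2l ?(ltW K0) //.
  rewrite -natrM lerXn2r ?nnegrE ?ler0n // ler_nat.
  apply: (@leq_trans (radn (a * b * (b - a)))).
    apply: dvdn_leq; first exact: radn_gt0.
    apply: radn_dvd; last by rewrite !muln_gt0 !q0.
    move=> p pp; rewrite !Euclid_dvdM // => h; apply: dvdn_radn => //.
      by rewrite !muln_gt0 a0 b0 ba0.
    rewrite !Euclid_dvdM //; have dz z : (g %| z)%N -> (p %| z %/ g)%N -> (p %| z)%N.
      by move=> gz pz; rewrite -(divnK gz) dvdn_mulr.
    by case/orP: h => [/orP[]|] /dz->; rewrite ?orbT.
  apply: leq_trans (radnM_le _ _) _; rewrite ?muln_gt0 ?a0 //.
  by rewrite leq_mul2l radn_le ?orbT.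
have gR : 0 < (gcdn x y)%:R :> R by rewrite ltr0n gcdn_gt0 x0.
rewrite neq_ltn => /orP[xy|xy].
  rewrite distrC -natrB ?(ltnW xy) // ger0_norm ?ler0n //.
  apply: le_trans (key x y x0 xy).
  apply: lerXn2r; rewrite ?nnegrE ?divr_ge0 ?ler0n //.
  by rewrite ler_pM2r ?invr_gt0 // ler_nat ltnW.
rewrite -natrB ?(ltnW xy) // ger0_norm ?ler0n //.
by rewrite gcdnC mulnC; apply: key.
Qed.

Definition large_square (R : realType) (Y : R) (N : nat) : bool :=
  `[< exists q : nat, [/\ prime q, Y <= q%:R & (q ^ 2 %| N)%N] >].

Lemma radn_large_square (R : realType) (Y : R) (N : nat) : (0 < N)%N ->
  (radn N)%:R * Y ^+ large_square Y N <= N%:R.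
Proof.
move=> N0; rewrite /large_square; case: asboolP => [[q [pq Yq q2]]|_] /=.
  rewrite expr1; apply: (@le_trans _ _ ((radn N)%:R * q%:R)).
    by rewrite ler_wpM2l.
  by rewrite -natrM ler_nat radn_sq_le.
by rewrite expr0 mulr1 ler_nat radn_le.
Qed.

Lemma shift_prod_ge (s : seq nat) (M : nat) : (M ^ size s <= shift_prod s M)%N.
Proof.
elim: s => [|i s IH]; first by rewrite /shift_prod big_nil.
by rewrite /shift_prod big_cons /= expnS leq_mul // leq_addr.
Qed.

Lemma shift_prod_gt0 (s : seq nat) (M : nat) : (0 < M)%N -> (0 < shift_prod s M)%N.
Proof. by move=> M0; apply: leq_trans (shift_prod_ge s M); rewrite expn_gt0 M0. Qed.

(** Shifts in the two lists have opposite parity, so they differ, and the gcd of M + x and M + y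
    divides a nonzero number at most j + 1. The bound does not depend on M. *)
Lemma gcdn_shift_prod_le (j M : nat) : (0 < M)%N ->
  (gcdn (shift_prod (shifts j).1 M) (shift_prod (shifts j).2 M)
     <= j.+1 ^ (2 ^ j * 2 ^ j))%N.
Proof.
move=> M0; have [s1 s2 h1 h2] := shiftsP j; rewrite -{1}s1 -{1}s2.
apply: gcdn_prod_le => // [i|x y /h1[ox xj] /h2[oy yj]].
  by rewrite addn_gt0 M0.
have xy : x != y by apply: contraNneq ox => ->.
have gx : (gcdn (M + x) (M + y) %| M + x)%N by apply: dvdn_gcdl.
have gy : (gcdn (M + x) (M + y) %| M + y)%N by apply: dvdn_gcdr.
move: xy; rewrite neq_ltn => /orP[lt|lt].
  have := dvdn_sub gy gx; rewrite subnDl => /dvdn_leq; rewrite subn_gt0 => /(_ lt) h.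
  by apply: leq_trans h _; apply: leq_trans (leq_subr _ _) yj.
have := dvdn_sub gx gy; rewrite subnDl => /dvdn_leq; rewrite subn_gt0 => /(_ lt) h.
by apply: leq_trans h _; apply: leq_trans (leq_subr _ _) xj.
Qed.

Lemma radn_shift_prod_le (j M : nat) : (0 < M)%N ->
  (radn (shift_prod (shifts j).1 M * shift_prod (shifts j).2 M)
     <= \prod_(0 <= i < j.+2) radn (M + i))%N.
Proof.
move=> M0; have [_ _ h1 h2] := shiftsP j.
have Mi i : (0 < M + i)%N by rewrite addn_gt0 M0.
apply: leq_trans (radn_prod_le _ Mi).
have P0 : (0 < \prod_(0 <= i < j.+2) (M + i))%N by apply: prodn_gt0.
apply: dvdn_leq; first exact: radn_gt0.
apply: radn_dvd; last by rewrite muln_gt0 !shift_prod_gt0.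
move=> p pp; rewrite Euclid_dvdM // => h; apply: dvdn_radn => //.
have dv s : {in s, forall i, i <= j.+1}%N -> (p %| shift_prod s M)%N ->
    (p %| \prod_(0 <= i < j.+2) (M + i))%N.
  elim: s => [|i s IH] hs; first by rewrite /shift_prod big_nil Euclid_dvd1.
  rewrite /shift_prod big_cons Euclid_dvdM // => /orP[pi|]; last first.
    by apply: IH => x xs; apply: hs; rewrite inE xs orbT.
  rewrite (big_rem i) ?mem_index_iota ?ltnS ?hs ?mem_head //=.
  exact: dvdn_mulr.
by case/orP: h; apply: dv => i; [move/h1|move/h2] => -[].
Qed.

(* Among consecutive integers near M, at most 2n can have a square prime factor
   whose root exceeds a constant times M^(1/n): the loss of one power of M in
   the abc bound for the product is the only room for such square factors. *)
Lemma abc_block (R : realType) (n j : nat) (A2 : R) :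
  abc_conjecture R -> 0 < A2 ->
  exists M1 : nat, forall (M : nat) (Y : R), (M1 <= M)%N -> 1 <= Y ->
    M%:R <= A2 * Y ^+ n ->
    (\sum_(0 <= i < j.+2) large_square Y (M + i) <= 2 * n)%N.
Proof.
(* The final comparison of exponents, with d = D: M occurs to one power more on the left than on the
   right, which bounds M. *)
have aux d : (d * d + 2 * d.+1 = (d.+1 * d.+1).+1)%N by lia.
move=> abc A20; set D := (2 ^ j)%N.
have D0 : (0 < D)%N by rewrite expn_gt0.
have [K K0 hK] := abc_distinct abc D0.
have [A hA] := shift_prod_sub_le j.
pose g0 := (j.+1 ^ (D * D))%N.
pose C1 : R := g0%:R ^+ D * K * (2 ^+ j.+2 * A%:R) ^+ D.+1.
pose C2 : R := A2 ^+ (2 * D.+1) * C1.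
have [N hN] : exists N : nat, C2 < N%:R.
  by exists (Num.truncn `|C2|).+1; apply: le_lt_trans (ler_norm _) _; exact: truncnS_gt.
(* The three summands give M + i <= 2M, then u distinct from v because their gcd is less than M, and
   finally M > [C2], contradicting the bound M <= [C2] reached at the end. *)
exists (j.+1 + g0.+1 + N)%N => M Y hM Y1 hY.
have M0 : (0 < M)%N by lia.
have Mj : (j.+1 <= M)%N by lia.
have Mg : (g0 < M)%N by lia.
have MN : (N <= M)%N by lia.
rewrite leqNgt; apply/negP => hr.
set r := (\sum_(0 <= i < j.+2) _)%N in hr.
pose u := shift_prod (shifts j).1 M; pose v := shift_prod (shifts j).2 M.
have u0 : (0 < u)%N by apply: shift_prod_gt0.
have v0 : (0 < v)%N by apply: shift_prod_gt0.
have hg : (gcdn u v <= g0)%N by apply: gcdn_shift_prod_le.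
have uD : (M ^ D <= u)%N.
  by have [s1 _ _ _] := shiftsP j; rewrite /D -s1; apply: shift_prod_ge.
have uv : u != v.
  apply/eqP => e; move: hg; rewrite -e gcdnn leqNgt => /negP; apply.
  apply: leq_trans Mg _; apply: leq_trans uD.
  by rewrite -{1}(expn1 M) leq_pexp2l.
pose rho : R := \prod_(0 <= i < j.+2) (radn (M + i))%:R.
have rho0 : 0 <= rho by apply: prodr_ge0.
have Y0 : 0 < Y by apply: lt_le_trans Y1.
have MR : 0 < M%:R :> R by rewrite ltr0n.
(* Each term with a large square factor saves a factor Y in its radical, and there are more than 2n
   such terms. *)
have hrho : rho * Y ^+ (2 * n) <= (2 * M%:R) ^+ j.+2.
  apply: (@le_trans _ _ (rho * Y ^+ r)).
    by apply: ler_wpM2l => //; apply: ler_weXn2l => //; apply: ltnW.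
  rewrite /r -[Y ^+ _]prodrXr -big_split /=.
  apply: (@le_trans _ _ (\prod_(0 <= i < j.+2) (2 * M%:R))); last first.
    by rewrite prodr_const_nat subn0.
  rewrite big_nat_cond [leRHS]big_nat_cond; apply: ler_prod => i.
  rewrite andbT => /andP[_ hi]; apply/andP; split.
    by rewrite mulr_ge0 ?ler0n // exprn_ge0 // ltW.
  apply: le_trans (radn_large_square _ _) _; first by rewrite addn_gt0 M0.
  by rewrite -natrM ler_nat mul2n -addnn leq_add2l (leq_trans _ Mj).
have hrad : (radn (u * v))%:R <= rho :> R.
  by rewrite /rho -natr_prod ler_nat; apply: radn_shift_prod_le.
have hsub : `|u%:R - v%:R| <= A%:R * M%:R ^+ (D - j.+1) :> R.
  have := hA M M0; rewrite -(ler_int R) intr_norm rmorphB /= => h.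
  by apply: le_trans h _; rewrite -natrX -natrM.
have gR : 0 < (gcdn u v)%:R :> R by rewrite ltr0n gcdn_gt0 u0.
have g0R : 0 < g0%:R :> R by rewrite ltr0n expn_gt0.
have h1 : (M%:R ^+ D / g0%:R) ^+ D <= K * (rho * (A%:R * M%:R ^+ (D - j.+1))) ^+ D.+1.
  apply: (@le_trans _ _ ((u%:R / (gcdn u v)%:R) ^+ D)).
    apply: lerXn2r; rewrite ?nnegrE ?divr_ge0 ?exprn_ge0 ?ler0n //.
    apply: ler_pM; rewrite ?exprn_ge0 ?invr_ge0 ?ler0n //.
      by rewrite -natrX ler_nat.
    by rewrite lef_pV2 ?posrE // ler_nat.
  apply: le_trans (hK u v u0 v0 uv) _; rewrite ler_wpM2l ?(ltW K0) //.
  apply: lerXn2r; rewrite ?nnegrE ?mulr_ge0 ?exprn_ge0 ?ler0n //.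
  by apply: ler_pM => //; exact: ler0n.
have h2 : (M%:R ^+ D) ^+ D * (Y ^+ (2 * n)) ^+ D.+1 <= C1 * (M%:R ^+ D.+1) ^+ D.+1.
  rewrite expr_div_n ler_pdivrMr ?exprn_gt0 // in h1.
  have jD : (j.+2 + (D - j.+1) = D.+1)%N.
    by rewrite addSn subnKC //; apply: ltn_expl.
  have -> : C1 * (M%:R ^+ D.+1) ^+ D.+1 =
      K * ((2 * M%:R) ^+ j.+2 * (A%:R * M%:R ^+ (D - j.+1))) ^+ D.+1 * g0%:R ^+ D.
    have eM : M%:R ^+ D.+1 = M%:R ^+ j.+2 * M%:R ^+ (D - j.+1) :> R.
      by rewrite -exprD jD.
    have e : (2 * M%:R) ^+ j.+2 * (A%:R * M%:R ^+ (D - j.+1)) =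
        (2 ^+ j.+2 * A%:R) * (M%:R ^+ j.+2 * M%:R ^+ (D - j.+1)) :> R.
      rewrite (exprMn j.+2 2); move: (2 ^+ j.+2) (M%:R ^+ j.+2) (M%:R ^+ _) => x y z.
      by ring.
    rewrite /C1 eM e [in RHS]exprMn.
    by move: (_ ^+ D.+1) (_ ^+ D.+1) (_ ^+ D) => x y z; ring.
  apply: (@le_trans _ _ (K * (rho * (A%:R * M%:R ^+ (D - j.+1))) ^+ D.+1 * g0%:R ^+ D
     * (Y ^+ (2 * n)) ^+ D.+1)).
    by rewrite ler_wpM2r // !exprn_ge0 ?(ltW Y0) ?(ltW g0R) ?ler0n.
  rewrite [leLHS]mulrAC ler_wpM2r ?exprn_ge0 // -mulrA -exprMn ler_wpM2l ?(ltW K0) //.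
  have AM0 : 0 <= A%:R * M%:R ^+ (D - j.+1) :> R.
    by apply: mulr_ge0; [exact: ler0n|apply: exprn_ge0; exact: ler0n].
  have tM0 : 0 <= (2 * M%:R) ^+ j.+2 :> R.
    by apply: exprn_ge0; apply: mulr_ge0; [|exact: ler0n].
  have YY0 : 0 <= Y ^+ (2 * n) by apply: exprn_ge0; exact: ltW.
  apply: lerXn2r; rewrite ?nnegrE.
  - by apply: mulr_ge0 => //; apply: mulr_ge0.
  - exact: mulr_ge0.
  - by rewrite mulrAC; apply: ler_wpM2r.
(* The hypothesis M <= A2 Y^n turns the saving of Y^(2n) into one of M^2 up to a constant. *)
have h3 : M%:R ^+ (2 * D.+1) <= A2 ^+ (2 * D.+1) * (Y ^+ (2 * n)) ^+ D.+1.
  rewrite [(2 * n)%N]mulnC (exprM Y) -(exprM (Y ^+ n)) -exprMn.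
  have AY : 0 <= A2 * Y ^+ n by apply: mulr_ge0; rewrite ?exprn_ge0 ?(ltW A20) ?(ltW Y0).
  by apply: lerXn2r; rewrite ?nnegrE ?ler0n.
have h4 : (M%:R ^+ D) ^+ D * M%:R ^+ (2 * D.+1) <= C2 * (M%:R ^+ D.+1) ^+ D.+1.
  apply: (@le_trans _ _ ((M%:R ^+ D) ^+ D * (A2 ^+ (2 * D.+1) * (Y ^+ (2 * n)) ^+ D.+1))).
    by rewrite ler_wpM2l ?exprn_ge0 ?ler0n.
  by rewrite mulrCA -mulrA ler_wpM2l // exprn_ge0 // ltW.
have : M%:R <= C2.
  have e : (M%:R ^+ D) ^+ D * M%:R ^+ (2 * D.+1) = M%:R * (M%:R ^+ D.+1) ^+ D.+1 :> R.
    by rewrite -!exprM -exprD -exprS aux.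
  by rewrite e ler_pM2r // !exprn_gt0 in h4.
by apply/negP; rewrite -ltNge; apply: lt_le_trans hN _; rewrite ler_nat.
Qed.

(** * Large primes *)

(** Windows starting beyond B are excluded from the hypothesis because the bound given by abc is
    available only for blocks starting at some b <= B. *)
Lemma window_count (N r B : nat) (P : pred nat) : (0 < N)%N ->
  (forall t, 0 < t <= B -> \sum_(t <= x < t + N) P x <= r)%N ->
  (\sum_(1 <= x < B.+1) P x <= r * (B %/ N).+1)%N.
Proof.
move=> N0 h.
have h' j : (j * N <= B)%N -> (\sum_(1 <= x < (j * N).+1) P x <= r * j)%N.
  elim: j => [|j IH] hj; first by rewrite mul0n big_geq.
  have hj' : (j * N <= B)%N by apply: leq_trans hj; rewrite leq_mul2r leqnSn orbT.
  rewrite (big_cat_nat (n := (j * N).+1)) //=; last by rewrite ltnS leq_mul2r leqnSn orbT.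
  rewrite mulnS addnC leq_add ?IH //.
  have -> : (j.+1 * N).+1 = ((j * N).+1 + N)%N by rewrite mulSn addnC addSn.
  apply: h; rewrite ltnS leq0n /=.
  by apply: leq_trans hj; rewrite mulSn -addn1 addnC leq_add2r.
have hq : (B %/ N * N <= B)%N by apply: leq_trunc_div.
rewrite (big_cat_nat (n := (B %/ N * N).+1)) //= mulnS addnC leq_add ?h' //.
have [e|ne] := eqVneq (B %/ N * N)%N B; first by rewrite e big_geq.
have hlt : (B %/ N * N < B)%N by rewrite ltn_neqAle ne.
apply: leq_trans (h (B %/ N * N).+1 _); last by rewrite hlt.
have hB : (B.+1 <= (B %/ N * N).+1 + N)%N.
  by rewrite addSn ltnS {1}(divn_eq B N) leq_add2l ltnW // ltn_pmod.
by rewrite [leqRHS](big_cat_nat (n := B.+1)) //= ?leq_addr // ltnW.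
Qed.

Lemma sum_inv_sq_le (R : realType) (z X : nat) : (1 < z)%N ->
  \sum_(z <= p < X) ((p%:R : R) ^+ 2)^-1 <= (z%:R - 1)^-1.
Proof.
move=> z1; have zR : 0 < z%:R - 1 :> R by rewrite subr_gt0 ltr1n.
have [hX|hX] := leqP X z; first by rewrite big_geq // invr_ge0 ltW.
(* Telescoping, from 1/p^2 <= 1/(p-1) - 1/p. *)
suff : \sum_(z <= p < X) ((p%:R : R) ^+ 2)^-1 <= (z%:R - 1)^-1 - (X%:R - 1)^-1.
  move/le_trans; apply; rewrite gerBl invr_ge0 subr_ge0 ler1n; lia.
elim: X hX => // X IH; rewrite ltnS leq_eqVlt => /orP[/eqP <-|hX].
  rewrite big_nat1 -natr1 addrK.
  have -> : (z%:R - 1)^-1 - z%:R^-1 = (z%:R * (z%:R - 1))^-1 :> R.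
    by field; rewrite gt_eqF //= pnatr_eq0; lia.
  have z0 : 0 < z%:R :> R by rewrite ltr0n; lia.
  by rewrite lef_pV2 ?posrE ?exprn_gt0 ?mulr_gt0 // expr2 ler_pM2l // gerBl.
rewrite big_nat_recr ?(ltnW hX) //=.
apply: le_trans (lerD (IH hX) (lexx _)) _.
have X1 : 1 < X%:R :> R by rewrite ltr1n; lia.
have X0 : 0 < X%:R :> R by apply: lt_trans X1.
rewrite -addrA lerD2l -natr1 addrK lerNr opprD opprK lerBrDr addrC.
have -> : (X%:R - 1)^-1 = (X%:R * (X%:R - 1))^-1 + X%:R^-1 :> R.
  by field; rewrite ?gt_eqF // subr_gt0.
rewrite lerD2r lef_pV2 ?posrE ?exprn_gt0 ?mulr_gt0 ?subr_gt0 // expr2 ler_pM2l //.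
by rewrite gerBl.
Qed.

Lemma natr_div_le (R : realType) (B N : nat) : (B %/ N)%:R <= B%:R / N%:R :> R.
Proof.
have [->|N0] := posnP N; first by rewrite divn0 invr0 mulr0.
by rewrite ler_pdivlMr ?ltr0n // -natrM ler_nat leq_trunc_div.
Qed.

Lemma ex_prime_count_le (B z X r : nat) (D : pred nat) (Q : nat -> pred nat)
    (f : nat -> nat) :
  (forall p x, Q p x -> prime p -> (z <= p <= X)%N && D p) ->
  (forall p, prime p -> z <= p <= X ->
     \sum_(1 <= x < B.+1) Q p x <= r * (B %/ f p).+1)%N ->
  (\sum_(1 <= x < B.+1) `[< exists2 p, prime p & Q p x >] <=
     \sum_(z <= p < X.+1 | prime p && D p) r * (B %/ f p).+1)%N.
Proof.
move=> hQ h.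
apply: (@leq_trans (\sum_(1 <= x < B.+1) \sum_(z <= p < X.+1 | prime p && D p) Q p x)).
  apply: leq_sum => x _; case: asboolP => [[p pp Qp]|//].
  have /andP[hp Dp] := hQ p x Qp pp.
  have pin : p \in index_iota z X.+1 by rewrite mem_index_iota ltnS.
  by rewrite (big_rem _ pin) /= pp Dp Qp.
rewrite exchange_big /= [leqLHS]big_nat_cond [leqRHS]big_nat_cond.
by apply: leq_sum => p /and3P[hp pp _]; apply: h => //; rewrite -ltnS.
Qed.

Lemma sum_window_sq_le (R : realType) (B z X r : nat) : (1 < z)%N ->
  (\sum_(z <= p < X.+1 | prime p && predT p) r * (B %/ p ^ 2).+1)%N%:R <=
    r%:R * (B%:R / (z%:R - 1) + X%:R) :> R.
Proof.
move=> z1; rewrite -big_distrr /= natrM ler_wpM2l ?ler0n //.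
apply: (@le_trans _ _ (\sum_(z <= p < X.+1) (B%:R * (p%:R ^+ 2)^-1 + 1))).
  rewrite natr_sum big_mkcond; apply: ler_sum => p _; case: ifP => _.
    rewrite -natr1 lerD2r -natrX; exact: natr_div_le.
  by rewrite addr_ge0 // mulr_ge0 ?invr_ge0 ?exprn_ge0 ?ler0n.
rewrite big_split /= -mulr_sumr lerD //.
  by rewrite ler_wpM2l ?ler0n // sum_inv_sq_le.
by rewrite sumr_const_nat ler_nat; lia.
Qed.

Lemma linear_tail (R : realType) (u v : int) (z X B : nat) : (1 < z)%N ->
  (forall p, prime p -> (z <= p)%N -> ~~ (p%:Z %| u)%Z) ->
  (\sum_(1 <= b < B.+1) `[< exists2 p, prime p &
     (z <= p <= X)%N && ((p ^ 2)%N%:Z %| (u * b%:Z + v)%R)%Z >])%N%:R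
  <= B%:R / (z%:R - 1) + X%:R :> R.
Proof.
move=> z1 hu; have := @sum_window_sq_le R B z X 1 z1; rewrite mul1r.
apply: le_trans; rewrite ler_nat.
apply: (@ex_prime_count_le B z X 1 predT (fun p b => (z <= p <= X)%N &&
   ((p ^ 2)%N%:Z %| (u * b%:Z + v)%R)%Z) (fun p => p ^ 2)%N) => [p x /andP[->]//|p pp hp].
apply: window_count => [|t _]; first by rewrite expn_gt0 prime_gt0.
have /andP[zp _] := hp; rewrite hp /=.
by apply: linear_congruence_le1; apply: coprimez_prime => //; apply: hu.
Qed.

(** [Q z] is meant for the pairs spoiled by a prime at least z: their upper density tends to 0 with
    1/z. The threshold N may depend on z, while B and C remain unrelated. *)
Definition sieve_negligible (R : realType) (Q : nat -> nat -> pred nat) : Prop :=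
  forall e : R, 0 < e -> exists z0 : nat, forall z : nat, (z0 <= z)%N ->
  exists N : nat, forall B C : nat, (N <= B)%N -> (N <= C)%N ->
    (\sum_(1 <= b < B.+1) \sum_(1 <= c < C.+1) Q z b c)%N%:R
      <= e * (B%:R * C%:R).

Lemma sieve_negligible_or (R : realType) (Q1 Q2 Q : nat -> nat -> pred nat) :
  sieve_negligible R Q1 -> sieve_negligible R Q2 ->
  (exists z1, forall z b c, (z1 <= z)%N -> (0 < b)%N -> (0 < c)%N ->
     Q z b c -> Q1 z b c || Q2 z b c) -> sieve_negligible R Q.
Proof.
move=> h1 h2 [z1 hQ] e e0; have e20 : 0 < e / 2 by rewrite divr_gt0.
have [za ha] := h1 _ e20; have [zb hb] := h2 _ e20.
exists (z1 + za + zb)%N => z hz.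
have [|Na hNa] := ha z; first lia. have [|Nb hNb] := hb z; first lia.
exists (Na + Nb)%N => B C hB hC.
have := lerD (hNa B C ltac:(lia) ltac:(lia)) (hNb B C ltac:(lia) ltac:(lia)).
rewrite -mulrDl -splitr -natrD; apply: le_trans; rewrite ler_nat -big_split /=.
rewrite big_nat_cond [leqRHS]big_nat_cond; apply: leq_sum => b /andP[/andP[b0 _] _].
rewrite -big_split /= big_nat_cond [leqRHS]big_nat_cond.
apply: leq_sum => c /andP[/andP[c0 _] _].
have := hQ z b c ltac:(lia) b0 c0; case: (Q z b c) => // /(_ isT).
by case: (Q1 z b c); case: (Q2 z b c).
Qed.

Lemma prime_gt_truncn (R : realType) (x : R) (p : nat) :
  0 <= x -> ~~ (p <= Num.truncn x)%N -> x < p%:R.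
Proof.
move=> x0; rewrite -ltnNge => h; apply: lt_le_trans (truncnS_gt x) _.
by rewrite ler_nat.
Qed.

Lemma inv_le_truncn (R : realType) (e : R) (z : nat) : 0 < e ->
  ((Num.truncn e^-1).+2 <= z)%N -> (z%:R - 1)^-1 <= e.
Proof.
move=> e0 hz; have ei : 0 < e^-1 by rewrite invr_gt0.
have h : e^-1 <= z%:R - 1.
  apply: (@le_trans _ _ (Num.truncn e^-1).+1%:R); first exact: ltW (truncnS_gt _).
  by rewrite lerBrDr natr1 ler_nat.
by rewrite -[leRHS]invrK lef_pV2 ?posrE // (lt_le_trans ei h).
Qed.

Lemma truncnS_le (R : realType) (x : R) (B : nat) :
  (Num.truncn x < B)%N -> x <= B%:R.
Proof.
by move=> h; apply: le_trans (ltW (truncnS_gt x)) _; rewrite ler_nat.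
Qed.

(** A prime p > eta B has p^2 larger than every |u b + v| with b <= B once B is large, so it matters
    only for the at most one b with u b + v = 0. Smaller primes are counted by windows of length
    p^2. *)
Lemma sieve_negligible_linear (R : realType) (u v : int) (z1 : nat) : u != 0 ->
  (forall p, prime p -> (z1 <= p)%N -> ~~ (p%:Z %| u)%Z) ->
  sieve_negligible R (fun z b _ => `[< exists2 p, prime p &
     (z <= p)%N && ((p ^ 2)%N%:Z %| u * b%:Z + v)%Z >]).
Proof.
move=> u0 hu e e0; pose eta := e / 4.
have eta0 : 0 < eta by rewrite divr_gt0.
exists (z1 + (Num.truncn eta^-1).+2)%N => z hz.
pose K := (`|u| + `|v|)%N.
exists ((Num.truncn (K%:R / eta ^+ 2)).+1 + (Num.truncn eta^-1).+1)%N => B C hB _.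
pose X := Num.truncn (eta * B%:R).
have hB1 : K%:R / eta ^+ 2 <= B%:R by apply: truncnS_le; lia.
have hB2 : eta^-1 <= B%:R by apply: truncnS_le; lia.
have etaB : 0 <= eta * B%:R by rewrite mulr_ge0 ?ler0n ?(ltW eta0).
have B0 : (0 < B)%N by lia.
rewrite (eq_bigr (fun b : nat => C * `[< exists2 p, prime p &
     (z <= p)%N && ((p ^ 2)%N%:Z %| (u * b%:Z + v)%R)%Z >])%N); last first.
  by move=> b _; rewrite sum_nat_const_nat subn1.
rewrite -big_distrr /= natrM mulrC [leRHS]mulrA; apply: ler_wpM2r; first exact: ler0n.
pose Q b := `[< exists2 p, prime p &
     (z <= p <= X)%N && ((p ^ 2)%N%:Z %| u * b%:Z + v)%Z >].
apply: (@le_trans _ _ (\sum_(1 <= b < B.+1) (Q b + (u * b%:Z + v == 0)%R))%N%:R).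
  rewrite ler_nat big_nat_cond [leqRHS]big_nat_cond.
  apply: leq_sum => b /andP[/andP[b0 bB] _].
  case: asboolP => [[p pp /andP[zp pd]]|//].
  have [e0'|ne0] := eqVneq (u * b%:Z + v) 0; first by rewrite addn1.
  rewrite (_ : Q b) //; apply/asboolP; exists p => //; rewrite zp pd andbT /=.
  apply: contraT => /(prime_gt_truncn etaB) hp.
  have h1 : (p ^ 2 <= K * B)%N.
    apply: (@leq_trans (absz (u * b%:Z + v))%R).
      by apply: dvdn_leq; [rewrite absz_gt0|].
    have := leqD_dist (u * b%:Z) 0 (- v); rewrite !(subr0, sub0r, opprK, abszN) => h.
    apply: leq_trans h _; rewrite abszM /K mulnDl leq_add //.
      by rewrite leq_mul2l -ltnS bB orbT.
    by rewrite add0r leq_pmulr.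
  have h2 : (eta * B%:R) ^+ 2 < (K * B)%N%:R.
    apply: (@lt_le_trans _ _ (p%:R ^+ 2)); first by rewrite ltrXn2r ?nnegrE.
    by rewrite -natrX ler_nat.
  move: h2; rewrite exprMn natrM [B%:R ^+ 2]expr2 mulrA ltr_pM2r ?ltr0n // mulrC.
  by rewrite -ltr_pdivlMr ?exprn_gt0 // ltNge hB1.
rewrite big_split natrD.
have z2 : (1 < z)%N by lia.
have hlin := @linear_tail R u v z X B z2.
have {}hlin := hlin _; apply: (@le_trans _ _ (B%:R / (z%:R - 1) + X%:R + 1)).
  apply: lerD; first by apply: hlin => p pp zp; apply: hu => //; lia.
  rewrite -[1]/(1%:R) ler_nat; apply: sum_bool_le1 => x y _ _ /eqP h1 /eqP h2.
  have : u * x%:Z = u * y%:Z by apply: (addIr v); rewrite h1 h2.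
  by move/(mulfI u0) => [].
have hX : X%:R <= eta * B%:R by rewrite truncn_le.
have h3 : B%:R / (z%:R - 1) <= eta * B%:R.
  by rewrite mulrC ler_wpM2r // inv_le_truncn //; lia.
have h4 : 1 <= eta * B%:R by rewrite mulrC -ler_pdivrMr // div1r.
have -> : e = 4 * eta by rewrite /eta; field.
by rewrite -mulrA; move: hX h3 h4 etaB; move: (B%:R / _) (X%:R) (eta * B%:R) => *; lra.
Qed.

(** * Large square factors of f(c) *)

Definition f_val (k : nat) (s : int) (b c : nat) : int :=
  c%:Z ^+ k.+1 * (c%:Z + s) ^+ 2 + b%:Z.

Lemma sum_bool_roots (F : fieldType) (h : {poly F}) (P : pred nat) (s t : nat) :
  h != 0 ->
  (forall x, (s <= x < t)%N -> P x -> root h x%:R) ->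
  (forall x y, (s <= x < t)%N -> (s <= y < t)%N -> P x -> P y ->
     x%:R = y%:R :> F -> x = y) ->
  (\sum_(s <= x < t) P x <= (size h).-1)%N.
Proof.
move=> h0 hr inj; rewrite -big_mkcond /= sum1_count -size_filter.
set S := [seq x <- _ | _].
have hS x : x \in S -> P x /\ (s <= x < t)%N.
  by rewrite mem_filter mem_index_iota => /andP[].
rewrite -ltnS prednK ?size_poly_gt0 // -(size_map (fun x : nat => x%:R : F) S).
apply: max_poly_roots => //.
  by apply/allP => _ /mapP[x /hS[Px hx] ->]; apply: hr.
rewrite map_inj_in_uniq ?filter_uniq ?iota_uniq // => x y /hS[Px hx] /hS[Py hy].
exact: inj.
Qed.

Lemma abs_lt_window (N t x y : nat) : (t <= x < t + N)%N -> (t <= y < t + N)%N ->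
  (N%:Z %| x%:Z - y%:Z)%Z -> x = y.
Proof.
move=> hx hy /dvdzP[q hq].
have [q0|q0] := eqVneq q 0; first by move: hq; rewrite q0 mul0r; lia.
exfalso; have : (`|x%:Z - y%:Z| >= N%:Z).
  rewrite hq normrM ler_peMl //; lia.
lia.
Qed.

Section RootCounts.
Variables (k : nat) (s : int) (p b : nat).
Hypothesis pp : prime p.

Let h := redp p (f_at k s b%:Z 'X).

Lemma size_red_f : size h = k.+4.
Proof.
have [fm fs] := @f_at_monic k s b%:Z 'X (monicX _) (eq_leq (esym (size_polyX _))).
rewrite /h size_map_poly_id0 /= ?fs ?size_polyX ?mul1n //.
by rewrite (monicP fm) oner_neq0.
Qed.

Lemma red_f_neq0 : h != 0.
Proof. by rewrite -size_poly_gt0 size_red_f. Qed.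

Lemma red_f_root (c : nat) : root h c%:R = (p%:Z %| f_val k s b c)%Z.
Proof.
rewrite /root /h -[c%:R]/((c%:Z)%:~R) horner_map /= intrFp_eq0 //.
by rewrite /f_at /f_val !(hornerD, hornerM, hornerXn, horner_exp, hornerX, hornerC).
Qed.

Lemma natr_Fp_eq (x y : nat) : x%:R = y%:R :> 'F_p -> (p%:Z %| x%:Z - y%:Z)%Z.
Proof. by move=> e; rewrite -intrFp_eq0 // rmorphB /= subr_eq0; apply/eqP. Qed.

Lemma root_count (t : nat) :
  (\sum_(t <= c < t + p) (p%:Z %| f_val k s b c)%Z <= k.+3)%N.
Proof.
rewrite -[k.+3]/(k.+4.-1) -size_red_f; apply: sum_bool_roots red_f_neq0 _ _.
  by move=> x _; rewrite red_f_root.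
by move=> x y hx hy _ _ /natr_Fp_eq; apply: (abs_lt_window hx hy).
Qed.

(** A multiple root of f modulo p is a critical point: at 0 or -s the value of f is b, and at the
    third one it is G(b) up to a factor, by [f_at_taylor] taken at a constant polynomial. *)
Lemma critical_dvd (x : int) :
  (p%:Z %| x ^+ k.+1 * (x + s) ^+ 2 + b%:Z)%Z ->
  (p%:Z %| x ^+ k * (x + s) * ((k.+3)%:Z * x + (k.+1)%:Z * s))%Z ->
  (p%:Z %| b%:Z)%Z || (p%:Z %| G_at k s b%:Z)%Z.
Proof.
move=> hf; rewrite !dvdzE !abszM !Euclid_dvdM // -!dvdzE => /orP[hx|hZ].
  have : (p%:Z %| x ^+ k.+1 * (x + s) ^+ 2)%Z.
    case/orP: hx => hx; first by rewrite exprS mulrAC dvdz_mull.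
    by rewrite expr2 mulrA dvdz_mull.
  move=> hx2; apply/orP; left.
  by rewrite -[b%:Z](addKr (x ^+ k.+1 * (x + s) ^+ 2)) addrC rpredB.
have [A] := @f_at_taylor k s b%:Z x%:P.
move/(congr1 (fun h : {poly int} => h.[0])).
rewrite /f_at !(hornerD, hornerM, horner_exp, hornerC, hornerN) => e.
apply/orP; right.
rewrite -[G_at k s b%:Z](addKr (((k.+3)%:Z * x + (k.+1)%:Z * s) ^+ 2 * A.[0])) -e addrC.
apply: rpredB; first by rewrite mulrAC dvdz_mull.
by rewrite expr2 -mulrA dvdz_mulr.
Qed.

(** Under the coprimality condition the roots modulo p are simple, so each lifts to at most one root
    modulo p^2, and there are at most n of them. *)
Lemma hensel_count (t : nat) :
  (\sum_(t <= c < t + p ^ 2) (((p ^ 2)%N%:Z %| f_val k s b c)%Z &&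
     ~~ ((p%:Z %| b%:Z)%Z || (p%:Z %| G_at k s b%:Z)%Z)) <= k.+3)%N.
Proof.
rewrite -[k.+3]/(k.+4.-1) -size_red_f; apply: sum_bool_roots red_f_neq0 _ _.
  by move=> x _ /andP[/dvdz_sq]; rewrite red_f_root.
move=> x y hx hy /andP[fx nb] /andP[fy _] /natr_Fp_eq hxy.
apply: (abs_lt_window hx hy).
set d := x%:Z - y%:Z in hxy *.
have nd : ~~ (p%:Z %| x%:Z ^+ k * (x%:Z + s) * ((k.+3)%:Z * x%:Z + (k.+1)%:Z * s))%Z.
  by apply: contra nb; apply: critical_dvd; apply: dvdz_sq.
have d2 : ((p ^ 2)%N%:Z %| d ^+ 2)%Z.
  have -> : (p ^ 2)%N%:Z = p%:Z * p%:Z by lia.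
  by rewrite expr2 dvdz_mul.
have [A hA] := exprB_taylor (- d) (- x%:Z) k.
have ey : y%:Z = - d - - x%:Z by rewrite /d; ring.
have : ((p ^ 2)%N%:Z %| x%:Z ^+ k * (x%:Z + s) * ((k.+3)%:Z * x%:Z + (k.+1)%:Z * s) * d)%Z.
  (* Taylor expansion at x: f(x) - f(y) equals f'(x) d up to a multiple of d^2, which is divisible
     by p^2. *)
  have [W ->] : exists W, x%:Z ^+ k * (x%:Z + s) * ((k.+3)%:Z * x%:Z + (k.+1)%:Z * s) * d =
     f_val k s b x - f_val k s b y + d ^+ 2 * W.
    exists (x%:Z ^+ k.+1 + 2 * (k.+1)%:R * x%:Z ^+ k * (x%:Z + s)
       - (k.+1)%:R * x%:Z ^+ k * d + A * (x%:Z + s - d) ^+ 2).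
    rewrite /f_val ey hA !opprK exprS -!natz -[k.+3]addn2 natrD.
    by move: (x%:R ^+ k) => X; ring.
  by rewrite rpredD ?rpredB // dvdz_mulr.
rewrite Gauss_dvdzr //.
by rewrite coprimez_sym; apply: coprimez_prime.
Qed.
End RootCounts.

Lemma few_large_prime_divisors (N X X' r : nat) : (0 < N)%N -> (N < X.+1 ^ r)%N ->
  (\sum_(X.+1 <= p < X'.+1 | prime p && (p %| N)) 1 < r)%N.
Proof.
move=> N0 hN; rewrite sum1_count -size_filter.
set S := [seq p <- _ | _].
have hS : all (fun p => prime p && (p %| N)%N) S by apply/allP => p; rewrite mem_filter => /andP[].
have Su : uniq S by rewrite filter_uniq // iota_uniq.
have dv : (\prod_(p <- S) p <= N)%N by rewrite dvdn_leq // prod_primes_dvd.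
rewrite ltnNge; apply/negP => hr; move: hN; rewrite ltnNge => /negP; apply.
apply: leq_trans dv; apply: (@leq_trans (X.+1 ^ size S)); first by rewrite leq_pexp2l.
have : all (fun p => X < p)%N S.
  by apply/allP => p; rewrite mem_filter mem_index_iota => /andP[_ /andP[]].
elim: S {hS Su hr} => [|p s IH] /=; first by rewrite big_nil.
by move=> /andP[hp hs]; rewrite big_cons expnS leq_mul ?IH.
Qed.

Section NegligibleF.
Variables (R : realType) (k : nat) (s : int).
Local Notation n := k.+3.

Lemma small_prime_part (z X B c : nat) : (1 < z)%N ->
  (\sum_(1 <= b < B.+1) `[< exists2 p, prime p &
     (z <= p <= X)%N && ((p ^ 2)%N%:Z %| f_val k s b c)%Z >])%N%:R
  <= B%:R / (z%:R - 1) + X%:R :> R.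
Proof.
move=> z1; have := @linear_tail R 1 (c%:Z ^+ k.+1 * (c%:Z + s) ^+ 2) z X B z1.
move=> h; apply: le_trans (h _) => [|p pp _]; last exact: pn1.
by under [X in _ <= X%:R]eq_bigr do rewrite mul1r addrC.
Qed.

Lemma hensel_part (z X C b : nat) : (1 < z)%N ->
  (\sum_(1 <= c < C.+1) `[< exists2 p, prime p &
     (z <= p <= X)%N && (((p ^ 2)%N%:Z %| f_val k s b c)%Z &&
       ~~ ((p%:Z %| b%:Z)%Z || (p%:Z %| G_at k s b%:Z)%Z)) >])%N%:R
  <= n%:R * (C%:R / (z%:R - 1) + X%:R) :> R.
Proof.
move=> z1; apply: le_trans (@sum_window_sq_le R C z X n z1); rewrite ler_nat.
apply: (@ex_prime_count_le C z X n predT (fun p c => (z <= p <= X)%N &&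
  (((p ^ 2)%N%:Z %| f_val k s b c)%Z &&
       ~~ ((p%:Z %| b%:Z)%Z || (p%:Z %| G_at k s b%:Z)%Z))) (fun p => p ^ 2)%N)
  => [p x /andP[->]//|p pp hp].
apply: window_count => [|t _]; first by rewrite expn_gt0 prime_gt0.
by rewrite hp; apply: hensel_count.
Qed.

(** Where roots may fail to lift uniquely, p divides b G(b), and the size of that product leaves at
    most r primes above X. For each of them, counting roots modulo p rather than p^2 is enough. *)
Lemma singular_part (X X' C b r : nat) : (0 < b)%N -> G_at k s b%:Z != 0 ->
  (b * `|G_at k s b%:Z| < X.+1 ^ r.+1)%N ->
  (\sum_(1 <= c < C.+1) `[< exists2 p, prime p &
     (X.+1 <= p <= X')%N && ((p%:Z %| f_val k s b c)%Z &&
       ((p%:Z %| b%:Z)%Z || (p%:Z %| G_at k s b%:Z)%Z)) >]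
  <= r * (n * (C %/ X.+1).+1))%N.
Proof.
move=> b0 G0 hb; set N := (b * _)%N in hb.
have N0 : (0 < N)%N by rewrite muln_gt0 b0 absz_gt0.
have hf := few_large_prime_divisors X' N0 hb; rewrite ltnS in hf.
apply: leq_trans (leq_mul hf (leqnn _)); rewrite big_distrl /=.
apply: (@leq_trans (\sum_(X.+1 <= p < X'.+1 | prime p && (p %| N)) n * (C %/ p).+1)%N).
  apply: (@ex_prime_count_le C X.+1 X' n (fun p => p %| N)%N (fun p c => (X.+1 <= p <= X')%N &&
    ((p%:Z %| f_val k s b c)%Z && ((p%:Z %| b%:Z)%Z || (p%:Z %| G_at k s b%:Z)%Z))) id).
    by move=> p x /and3P[-> _ h] pp /=; rewrite /N Euclid_dvdM //.
  move=> p pp hp; apply: window_count => [|t _]; first exact: prime_gt0.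
  apply: leq_trans (root_count k s b pp t).
  by apply: leq_sum => x _; rewrite hp /=; case: (_ %| f_val _ _ _ _)%Z => //=; apply: leq_b1.
rewrite big_nat_cond [leqRHS]big_nat_cond; apply: leq_sum => p /andP[/andP[hp _] _].
by rewrite mul1n leq_mul2l ltnS leq_div2l ?orbT.
Qed.

(** For fixed c >= 0, |f(c)| is g + b with g independent of b, so consecutive b give blocks of
    consecutive integers, to which [abc_block] applies with Y = e max(B, C). *)
Lemma abc_part (e : R) : abc_conjecture R -> 0 < e ->
  exists N : nat, forall B C c : nat, (N <= maxn B C)%N -> (N <= B)%N -> (c <= C)%N ->
  (\sum_(1 <= b < B.+1) `[< exists2 p, prime p &
     (e * (maxn B C)%:R <= p%:R)%R && ((p ^ 2)%N%:Z %| f_val k s b c)%Z >])%N%:R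
  <= e * B%:R.
Proof.
move=> abc e0; pose S := (1 + `|s|)%N.
(* Chosen so that g + b <= (S^2 + 1) T^n = A2 Y^n, where T = max(B, C). *)
pose A2 : R := (S ^ 2 + 1)%:R / e ^+ n.
have A20 : 0 < A2 by rewrite divr_gt0 ?exprn_gt0 // ltr0n addn1.
(* This length makes 2n per block at most half of e B; the incomplete last block costs 2n, covered
   by the other half as B is large. *)
pose j := (Num.truncn (4 * n%:R / e)).+1.
have [M1 hM] := @abc_block R n j A2 abc A20.
exists ((Num.truncn ((M1 + j.+2).+1%:R / e)).+1 + (Num.truncn (4 * n%:R / e)).+1)%N => B C c hT hB hc.
set T := maxn B C in hT *; pose Y := e * T%:R.
have hY1 : (M1 + j.+2).+1%:R <= Y.
  by rewrite /Y mulrC -ler_pdivrMr //; apply: truncnS_le; apply: leq_trans hT; exact: leq_addr.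
have hB1 : 4 * n%:R <= e * B%:R.
  by rewrite [leRHS]mulrC -ler_pdivrMr //; apply: truncnS_le; apply: leq_trans hB; exact: leq_addl.
have Y1 : 1 <= Y by apply: le_trans hY1; rewrite ler1n.
have Y0 : 0 <= Y by apply: le_trans Y1.
pose g := absz (c%:Z ^+ k.+1 * (c%:Z + s) ^+ 2)%R.
have ef b : `|f_val k s b c|%N = (g + b)%N.
  have h0 : 0 <= c%:Z ^+ k.+1 * (c%:Z + s) ^+ 2 by apply: mulr_ge0; [exact: exprn_ge0|exact: sqr_ge0].
  by rewrite /f_val /g; move: (_ * _) h0 => x; lia.
have gT : (g <= S ^ 2 * T ^ n)%N.
  have cT : (c <= T)%N by apply: leq_trans hc _; rewrite leq_maxr.
  have T0 : (0 < T)%N by lia.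
  have cs : (`|(c%:Z + s)%R| <= S * T)%N.
    have : (`|s| * 1 <= `|s| * T)%N by rewrite leq_mul2l T0 orbT.
    rewrite /S mulnDl; lia.
  rewrite /g abszM !abszX -[n]addn2 expnD mulnCA -expnMn leq_mul // ?leq_exp2r //.
have win t : (0 < t <= B)%N ->
   (\sum_(t <= b < t + j.+2) large_square Y (g + b) <= 2 * n)%N.
  move=> /andP[t0 tB]; rewrite -{1}[t]add0n big_addn addKn.
  have [hMt|hMt] := leqP M1 (g + t)%N.
    apply: leq_trans (hM (g + t)%N Y hMt Y1 _).
      by under eq_bigr do rewrite [(_ + t)%N]addnC addnA.
    apply: (@le_trans _ _ ((S ^ 2 + 1) * T ^ n)%N%:R).
      rewrite ler_nat mulnDl mul1n leq_add //.
      apply: leq_trans tB _; apply: (@leq_trans T); first by rewrite leq_maxl.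
      by rewrite -{1}(expn1 T) leq_pexp2l //; lia.
    by rewrite /A2 /Y exprMn natrM (natrX _ T) [leRHS]mulrA divfK // expf_neq0 // gt_eqF.
  (* A block starting below [M1] contains only numbers less than Y, so none has a square factor q^2
     with q >= Y. *)
  rewrite big_nat_cond big1 // => i /andP[/andP[_ hi] _].
  rewrite /large_square; case: asboolP => // -[q [pq hq q2]].
  have h1 : (q ^ 2 <= g + (i + t))%N by apply: dvdn_leq; rewrite // !addn_gt0 t0 !orbT.
  have h2 : ((M1 + j.+2).+1 <= q)%N by rewrite -(ler_nat R); apply: le_trans hq.
  have h3 : (q <= q ^ 2)%N by rewrite -{1}(expn1 q) leq_pexp2l // prime_gt0.
  have := leq_trans h2 (leq_trans h3 h1); rewrite ltnNge addnCA [(M1 + _)%N]addnC.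
  by rewrite leq_add // ltnW.
have := @window_count j.+2 (2 * n) B _ isT win.
rewrite -(ler_nat R) => h; apply: le_trans (le_trans _ h) _.
  rewrite ler_nat; apply: leq_sum => b _.
  case: asboolP => // -[p pp /andP[hp pd]]; rewrite /large_square asboolT //.
  by exists p; split=> //; move: pd; rewrite dvdzE ef.
rewrite natrM -natr1 natrM.
have h1 : (B %/ j.+2)%:R <= B%:R / j.+2%:R :> R by apply: natr_div_le.
have h2 : (4 * n%:R) * (B%:R / j.+2%:R) <= e * B%:R.
  have hj : 4 * n%:R <= e * j.+2%:R.
    rewrite [leRHS]mulrC -ler_pdivrMr //; apply: truncnS_le.
    exact: (leq_trans (ltnSn _) (leq_addl 2 _)).
  by rewrite mulrA ler_pdivrMr // [leRHS]mulrAC ler_wpM2r.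
have n0 : 0 <= 2 * n%:R :> R by rewrite mulr_ge0.
have h3 := ler_wpM2l n0 h1.
rewrite mulrDr mulr1; move: h2 h3 hB1.
move: (n%:R) ((B %/ j.+2)%:R) (B%:R / j.+2%:R) (e * B%:R) => x y w v; lra.
Qed.
End NegligibleF.

Lemma sum_range_le (R : realType) (F : nat -> nat) (x : R) (B : nat) :
  (forall i, (0 < i <= B)%N -> (F i)%:R <= x) ->
  (\sum_(1 <= i < B.+1) F i)%N%:R <= B%:R * x.
Proof.
move=> h; rewrite natr_sum mulr_natl -[X in x *+ X](subn1 B.+1).
rewrite -[leRHS]sumr_const_nat big_nat_cond [leRHS]big_nat_cond.
by apply: ler_sum => i /andP[hi _]; apply: h.
Qed.

Lemma G_at_abs_le (k : nat) (s : int) : exists K : nat, forall b : nat, (0 < b)%N ->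
  (`|G_at k s b%:Z| <= K * b)%N.
Proof.
exists (absz ((- (k.+3)%:Z) ^+ k.+3)%R + absz (4 * (k.+1)%:Z ^+ k.+1 * s ^+ k.+3)%R)%N => b b0.
rewrite /G_at; move: (_ ^+ k.+3) (4 * _ * _) => x y.
have h := leqD_dist (x * b%:Z) 0 (- y).
rewrite !(subr0, sub0r, opprK, add0r) abszM in h.
by apply: leq_trans h _; rewrite mulnDl leq_add // leq_pmulr.
Qed.

Lemma G_at_root_le1 (k : nat) (s : int) (B : nat) :
  (\sum_(1 <= b < B.+1) (G_at k s b%:Z == 0)%R <= 1)%N.
Proof.
apply: sum_bool_le1 => x y _ _ /eqP h1 /eqP h2; move: (etrans h1 (esym h2)).
have u0 : (- (k.+3)%:Z) ^+ k.+3 != 0 by rewrite expf_neq0 // oppr_eq0.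
by rewrite /G_at => /addIr /(mulfI u0) [].
Qed.

(** Each bad pair falls under one of five heads: p <= eta B ([a]); p <= eta C with simple roots
    ([h]); p in between, with a possibly multiple root ([sg]); G(b) = 0; p beyond both bounds ([L]).
    Sums are taken over b or over c first according to the head. *)
Lemma sieve_negligible_f (R : realType) (k : nat) (s : int) : abc_conjecture R ->
  sieve_negligible R (fun z b c => `[< exists2 p, prime p &
     (z <= p)%N && ((p ^ 2)%N%:Z %| f_val k s b c)%Z >]).
Proof.
move=> abc e e0; set n := k.+3.
have n0 : 0 < 6 + 2 * n%:R :> R by rewrite addr_gt0 // mulr_gt0 // ltr0n.
(* The five heads cost 2, 2n, 2, 1 and 1 times eta B C. *)
have [eta eta0 Ee] : exists2 eta : R, 0 < eta & e = eta * (6 + 2 * n%:R).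
  by exists (e / (6 + 2 * n%:R)); rewrite ?divr_gt0 // divfK // gt_eqF.
exists (Num.truncn eta^-1).+2 => z hz.
have z1 : (1 < z)%N by apply: leq_trans hz.
have hz1 : (z%:R - 1)^-1 <= eta by apply: inv_le_truncn.
have [N1 hN1] := @abc_part R k s eta abc eta0.
have [K hK] := G_at_abs_le k s.
exists (N1 + ((Num.truncn (K%:R / eta ^+ 3)).+1 + ((Num.truncn (2 * n%:R / eta ^+ 2)).+1 +
   ((Num.truncn (2 * n%:R / eta)).+1 + (Num.truncn eta^-1).+1))))%N => B C.
move: (Num.truncn (K%:R / eta ^+ 3)) (@truncnS_le R (K%:R / eta ^+ 3)) => t1 ht1.
move: (Num.truncn (2 * n%:R / eta ^+ 2)) (@truncnS_le R (2 * n%:R / eta ^+ 2)) => t2 ht2.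
move: (Num.truncn (2 * n%:R / eta)) (@truncnS_le R (2 * n%:R / eta)) => t3 ht3.
move: (Num.truncn eta^-1) (@truncnS_le R eta^-1) => t4 ht4 hB hC.
have B0 : (0 < B)%N by lia.
have C0 : (0 < C)%N by lia.
have {ht1} hB1 : K%:R / eta ^+ 3 <= B%:R by apply: ht1; lia.
have {ht2} hB2 : 2 * n%:R / eta ^+ 2 <= B%:R by apply: ht2; lia.
have {ht3} hC3 : 2 * n%:R / eta <= C%:R by apply: ht3; lia.
have {ht4} hB4 : eta^-1 <= B%:R by apply: ht4; lia.
have hN1B : (N1 <= B)%N by lia.
have {hB hC} hN1T : (N1 <= maxn B C)%N by rewrite leq_max hN1B.
have BR : 0 < B%:R :> R by rewrite ltr0n.
have CR : 0 < C%:R :> R by rewrite ltr0n.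
have etaB : 0 < eta * B%:R by rewrite mulr_gt0.
have etaC : 0 < eta * C%:R by rewrite mulr_gt0.
pose X := Num.truncn (eta * B%:R); pose X' := Num.truncn (eta * C%:R).
have hX : X%:R <= eta * B%:R by rewrite truncn_le ltW.
have hX' : X'%:R <= eta * C%:R by rewrite truncn_le ltW.
have hX1 : eta * B%:R < X.+1%:R by apply: truncnS_gt.
pose a b c := `[< exists2 p, prime p &
     (z <= p <= X)%N && ((p ^ 2)%N%:Z %| f_val k s b c)%Z >].
pose h b c := `[< exists2 p, prime p &
     (z <= p <= X')%N && (((p ^ 2)%N%:Z %| f_val k s b c)%Z &&
       ~~ ((p%:Z %| b%:Z)%Z || (p%:Z %| G_at k s b%:Z)%Z)) >].
pose sg b c := (G_at k s b%:Z != 0) && `[< exists2 p, prime p &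
     (X.+1 <= p <= X')%N && ((p%:Z %| f_val k s b c)%Z &&
       ((p%:Z %| b%:Z)%Z || (p%:Z %| G_at k s b%:Z)%Z)) >].
pose L b c := `[< exists2 p, prime p &
     (eta * (maxn B C)%:R <= p%:R) && ((p ^ 2)%N%:Z %| f_val k s b c)%Z >].
apply: (@le_trans _ _ (\sum_(1 <= b < B.+1) \sum_(1 <= c < C.+1)
   (a b c + (h b c + (sg b c + ((G_at k s b%:Z == 0)%R + L b c)))))%N%:R).
  rewrite ler_nat; apply: leq_sum => b _; apply: leq_sum => c _.
  case: asboolP => // -[p pp /andP[zp pf]].
  have [pX|pX] := leqP p X.
    by rewrite (_ : a b c) //; apply/asboolP; exists p; rewrite // zp pX.
  have [pX'|pX'] := leqP p X'; last first.
    rewrite [X in (_ + (_ + (_ + (_ + X))))%N](_ : _ = 1%N); first by rewrite !addnS.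
    rewrite /L asboolT //; exists p; rewrite // pf andbT.
    rewrite /maxn; case: ifP => _; apply: ltW.
      by apply: lt_le_trans (truncnS_gt _) _; rewrite ler_nat.
    by apply: lt_le_trans hX1 _; rewrite ler_nat.
  have [G0|G0] := eqVneq (G_at k s b%:Z) 0; first by rewrite /= !addnS.
  case: (boolP ((p%:Z %| b%:Z)%Z || (p%:Z %| G_at k s b%:Z)%Z)) => hb.
    rewrite (_ : sg b c) ?addnS // /sg G0; apply/asboolP; exists p => //.
    by rewrite pX pX' hb (dvdz_sq pf).
  by rewrite (_ : h b c) ?addnS //; apply/asboolP; exists p; rewrite // zp pX' pf hb.
under eq_bigr do rewrite !big_split.
rewrite !big_split /= !natrD.
have e1 : (\sum_(1 <= b < B.+1) \sum_(1 <= c < C.+1) a b c)%N%:R <=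
    C%:R * (2 * (eta * B%:R)) :> R.
  rewrite exchange_big /=; apply: sum_range_le => c _.
  apply: le_trans (@small_prime_part R k s z X B c z1) _.
  have := ler_wpM2l (ltW BR) hz1; rewrite [B%:R * eta]mulrC; lra.
have e2 : (\sum_(1 <= b < B.+1) \sum_(1 <= c < C.+1) h b c)%N%:R <=
    B%:R * (n%:R * (2 * (eta * C%:R))) :> R.
  apply: sum_range_le => b _.
  apply: le_trans (@hensel_part R k s z X' C b z1) _; rewrite ler_wpM2l //.
  have := ler_wpM2l (ltW CR) hz1; rewrite [C%:R * eta]mulrC; lra.
have e3 : (\sum_(1 <= b < B.+1) \sum_(1 <= c < C.+1) sg b c)%N%:R <=
    B%:R * (2 * (eta * C%:R)) :> R.
  apply: sum_range_le => b /andP[b0 bB].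
  have [G0|G0] := eqVneq (G_at k s b%:Z) 0.
    rewrite big1 => [|c _]; last by rewrite /sg G0 eqxx.
    by apply: mulr_ge0 => //; apply: ltW.
  (* b |G(b)| is at most K B^2, below (eta B)^3 once B > K / eta^3; so at most two singular primes
     exceed eta B. *)
  have hb : (b * `|G_at k s b%:Z| < X.+1 ^ 3)%N.
    rewrite -(ltr_nat R) natrX; apply: (@le_lt_trans _ _ ((eta * B%:R) ^+ 3)); last first.
      by rewrite ltrXn2r ?nnegrE ?(ltW etaB).
    apply: (@le_trans _ _ (B * (K * B))%N%:R).
      rewrite ler_nat leq_mul // (leq_trans (hK b b0)) // leq_mul2l bB orbT //.
    move: hB1; rewrite ler_pdivrMr ?exprn_gt0 // !natrM exprMn => hB1.
    have := ler_wpM2l (ltW (mulr_gt0 BR BR)) hB1.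
    by rewrite [leLHS](_ : _ = B%:R * (K%:R * B%:R)) ?[leRHS](_ : _ = eta ^+ 3 * B%:R ^+ 3) //; ring.
  have := @singular_part k s X X' C b 2 b0 G0 hb.
  rewrite -(ler_nat R) => /(le_trans _) hh.
  apply: (@le_trans _ _ (2 * (n%:R * (C%:R / (eta * B%:R) + 1)))).
    apply: (le_trans (hh _ _)); first by rewrite ler_nat; apply: leq_sum => c _; rewrite /sg G0.
    rewrite !natrM ler_wpM2l // ler_wpM2l // -natr1 lerD2r.
    apply: le_trans (natr_div_le _ _ _) _; rewrite ler_wpM2l ?(ltW CR) //.
    by rewrite lef_pV2 ?posrE ?ltr0n // ltW.
  have q1 : 2 * n%:R * (C%:R / (eta * B%:R)) <= eta * C%:R.
    rewrite mulrA ler_pdivrMr // [leRHS](_ : _ = eta ^+ 2 * B%:R * C%:R); last by ring.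
    by rewrite ler_wpM2r ?(ltW CR) // [leRHS]mulrC -ler_pdivrMr ?exprn_gt0.
  have q2 : 2 * n%:R <= eta * C%:R by rewrite [leRHS]mulrC -ler_pdivrMr.
  rewrite [leLHS](_ : _ = 2 * n%:R * (C%:R / (eta * B%:R)) + 2 * n%:R); last by ring.
  by rewrite [leRHS](_ : _ = eta * C%:R + eta * C%:R); [exact: lerD|ring].
have e4 : (\sum_(1 <= b < B.+1) \sum_(1 <= c < C.+1) (G_at k s b%:Z == 0)%R)%N%:R <=
    C%:R * (eta * B%:R) :> R.
  rewrite exchange_big /=; apply: sum_range_le => c _.
  apply: (@le_trans _ _ 1%:R); first by rewrite ler_nat G_at_root_le1.
  by rewrite mulrC -ler_pdivrMr // div1r.
have e5 : (\sum_(1 <= b < B.+1) \sum_(1 <= c < C.+1) L b c)%N%:R <=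
    C%:R * (eta * B%:R) :> R.
  rewrite exchange_big /=; apply: sum_range_le => c /andP[_ cC].
  exact: hN1 hN1T hN1B cC.
rewrite Ee.
apply: le_trans (lerD e1 (lerD e2 (lerD e3 (lerD e4 e5)))) _.
by rewrite le_eqVlt; apply/orP; left; apply/eqP; ring.
Qed.

(** * Small primes *)

Lemma sieve_negligible_bad (R : realType) (k m l : nat) (s : int) :
  abc_conjecture R -> (1 < m)%N ->
  sieve_negligible R (fun z b c => `[< exists2 p, prime p &
     (z <= p)%N && ~~ good k m s l p b c >]).
Proof.
move=> abc m1; set n := k.+3.
have ndvd p q : prime p -> (q < p)%N -> (0 < q)%N -> ~~ (p %| q)%N.
  by move=> _ qp q0; apply/negP => /(dvdn_leq q0); rewrite leqNgt qp.
have h1 := @sieve_negligible_linear R 1 0 0 isT (fun p pp _ => pn1 pp).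
have u0 : (- n%:Z) ^+ n != 0 by rewrite expf_neq0 // oppr_eq0.
have hu p : prime p -> (n.+1 <= p)%N -> ~~ (p%:Z %| (- n%:Z) ^+ n)%Z.
  move=> pp np; rewrite dvdzE abszX abszN Euclid_dvdX // andbT.
  exact: ndvd pp np _.
have h2 := @sieve_negligible_linear R _ (4 * (k.+1)%:Z ^+ k.+1 * s ^+ n) _ u0 hu.
have h3 := @sieve_negligible_f R k s abc.
have h12 := sieve_negligible_or h1 h2 (ex_intro _ 0%N (fun z b c _ _ _ h => h)).
apply: (sieve_negligible_or h12 h3); exists (l + m + n).+1 => z b c hz b0 c0.
case/asboolP => p pp /andP[zp ng].
have pl : p != l by apply: contraTneq zp => ->; rewrite -ltnNge; lia.
have pm : ~~ (p %| m)%N by apply: ndvd => //; lia.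
have pn : ~~ (p %| n)%N by apply: ndvd => //; lia.
apply: contraR ng => /norP[/norP[/asboolPn nb /asboolPn nG] /asboolPn nf].
have p2b : ~~ ((p ^ 2)%N%:Z %| b%:Z)%Z.
  by apply/negP => h; apply: nb; exists p => //; rewrite zp mul1r addr0.
have p2G : ~~ ((p ^ 2)%N%:Z %| G_at k s b%:Z)%Z.
  by apply/negP => h; apply: nG; exists p => //; rewrite zp.
have p2f : ~~ ((p ^ 2)%N%:Z %| f_val k s b c)%Z.
  by apply/negP => h; apply: nf; exists p => //; rewrite zp.
rewrite goodE //; apply/asboolP; split; first by apply: regular_f => //; left.
by apply: regular_F => //; left.
Qed.

(** * Counting in boxes with the Chinese remainder theorem *)

Lemma sum_crt (M N : nat) (F : nat -> nat -> nat) : coprime M N ->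
  (0 < M)%N -> (0 < N)%N ->
  (\sum_(0 <= x < M * N) F (x %% M) (x %% N) =
   \sum_(0 <= u < M) \sum_(0 <= v < N) F u v)%N.
Proof.
case: M => // M; case: N => // N co _ _.
rewrite !big_mkord; under [RHS]eq_bigr do rewrite big_mkord.
rewrite pair_big /=.
pose h (x : 'I_(M.+1 * N.+1)) : 'I_M.+1 * 'I_N.+1 :=
  (Ordinal (ltn_pmod x (ltn0Sn M)), Ordinal (ltn_pmod x (ltn0Sn N))).
have hinj : injective h.
  move=> x y [hM hN]; apply: val_inj => /=.
  have := chinese_remainder co x y; rewrite hM hN !eqxx /=.
  by rewrite !modn_small // => /eqP.
have hbij : bijective h by apply: inj_card_bij => //; rewrite card_prod !card_ord.
by rewrite (reindex h) //=; apply: onW_bij.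
Qed.

Lemma sum_periodic_shift (M t : nat) (F : nat -> nat) :
  (forall x, F (x + M) = F x) ->
  (\sum_(t <= x < t + M) F x = \sum_(0 <= x < M) F x)%N.
Proof.
move=> hF; elim: t => [//|t <-]; rewrite addSn.
have [->|M0] := posnP M; first by rewrite addn0 !big_geq.
rewrite big_nat_recr ?hF /=; last by rewrite -addn1 leq_add2l.
have ht : (t < t + M)%N by rewrite -[X in (X < _)%N]addn0 ltn_add2l.
by rewrite [RHS](big_ltn ht) addnC.
Qed.

Lemma sum_periodic_ge (M B : nat) (F : nat -> nat) :
  (forall x, F (x + M) = F x) ->
  (B %/ M * \sum_(0 <= x < M) F x <= \sum_(1 <= x < B.+1) F x)%N.
Proof.
move=> hF.
have h q : (q * \sum_(0 <= x < M) F x = \sum_(1 <= x < (q * M).+1) F x)%N.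
  elim: q => [|q IH]; first by rewrite !mul0n big_geq.
  rewrite mulSn IH addnC [RHS](big_cat_nat (n := (q * M).+1)) //=; last first.
    by rewrite ltnS leq_mul2r leqnSn orbT.
  by rewrite mulSn [(M + _)%N]addnC -addSn sum_periodic_shift.
rewrite h [leqRHS](big_cat_nat (n := (B %/ M * M).+1)) //= ?leq_addr //.
by rewrite ltnS leq_trunc_div.
Qed.

Definition box_count (M : nat) (P : nat -> nat -> bool) : nat :=
  (\sum_(0 <= c < M) \sum_(0 <= b < M) P b c)%N.

Definition periodic2 (M : nat) (P : nat -> nat -> bool) : Prop :=
  forall b c, P (b %% M)%N (c %% M)%N = P b c.

Lemma box_count_crt (M N : nat) (P S : nat -> nat -> bool) : coprime M N ->
  (0 < M)%N -> (0 < N)%N -> periodic2 M P -> periodic2 N S ->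
  box_count (M * N) (fun b c => P b c && S b c) = (box_count M P * box_count N S)%N.
Proof.
move=> co M0 N0 hP hS; rewrite /box_count.
pose H u v := (\sum_(0 <= x < M) \sum_(0 <= y < N) (P x u * S y v))%N.
transitivity (\sum_(0 <= c < M * N) H (c %% M) (c %% N))%N.
  apply: eq_bigr => c _; rewrite /H.
  rewrite -(sum_crt (fun x y => (P x (c %% M) * S y (c %% N))%N) co M0 N0).
  by apply: eq_bigr => b _; rewrite hP hS mulnb.
rewrite sum_crt // /H big_distrl /=; apply: eq_bigr => u _.
rewrite big_distrr /=; apply: eq_bigr => v _.
rewrite big_distrl /=; apply: eq_bigr => x _.
by rewrite big_distrr.
Qed.

Lemma periodic2_mul (M N : nat) (P : nat -> nat -> bool) :
  periodic2 M P -> periodic2 (M * N) P /\ periodic2 (N * M) P.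
Proof.
move=> hP; have h1 : (M %| M * N)%N by apply: dvdn_mulr.
have h2 : (M %| N * M)%N by apply: dvdn_mull.
by split=> b c; rewrite -[LHS]hP -[RHS]hP !modn_dvdm.
Qed.

Lemma box_sum_ge (M B C : nat) (P : nat -> nat -> bool) : periodic2 M P ->
  (B %/ M * (C %/ M) * box_count M P <=
    \sum_(1 <= b < B.+1) \sum_(1 <= c < C.+1) P b c)%N.
Proof.
move=> hP.
have pb c b : P (b + M)%N c = P b c by rewrite -hP modnDr hP.
have pc b c : P b (c + M)%N = P b c by rewrite -hP modnDr hP.
rewrite exchange_big /= -mulnA.
apply: (@leq_trans (\sum_(1 <= c < C.+1) (B %/ M * \sum_(0 <= b < M) P b c))%N).
  rewrite -big_distrr /= leq_mul2l; apply/orP; right.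
  apply: (@sum_periodic_ge M C (fun c => \sum_(0 <= b < M) P b c)%N) => c.
  by apply: eq_bigr => b _; rewrite pc.
by apply: leq_sum => c _; apply: sum_periodic_ge => b; rewrite pb.
Qed.

Section FiniteSieve.
Variables (k m l : nat) (s : int).

Definition good_below (z b c : nat) : bool :=
  all (fun p => prime p ==> good k m s l p b c) (iota 0 z).

Definition sieve_modulus (z : nat) : nat := (\prod_(0 <= p < z | prime p) p ^ 2)%N.

Lemma sieve_modulus_gt0 z : (0 < sieve_modulus z)%N.
Proof. by apply: prodn_cond_gt0 => p pp; rewrite expn_gt0 prime_gt0. Qed.

Lemma good_below_count (z : nat) :
  periodic2 (sieve_modulus z) (good_below z) /\
  box_count (sieve_modulus z) (good_below z) =
    (\prod_(0 <= p < z | prime p) local_count k m s l p)%N.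
Proof.
elim: z => [|z [IHp IHc]].
  rewrite /sieve_modulus !big_geq //; split=> //.
  by rewrite /box_count !big_nat1.
have gS b c : good_below z.+1 b c = good_below z b c && (prime z ==> good k m s l z b c).
  by rewrite /good_below -[z.+1]addn1 iotaD all_cat /= andbT.
have mS : sieve_modulus z.+1 = (sieve_modulus z * (if prime z then z ^ 2 else 1))%N.
  by rewrite /sieve_modulus big_mkcond big_nat_recr //= -big_mkcond.
have cS : (\prod_(0 <= p < z.+1 | prime p) local_count k m s l p =
   (\prod_(0 <= p < z | prime p) local_count k m s l p) *
     (if prime z then local_count k m s l z else 1))%N.
  by rewrite big_mkcond big_nat_recr //= -big_mkcond.
rewrite mS cS; have [pz|pz] := boolP (prime z); last first.
  have e : good_below z.+1 = good_below z.
    by apply/funext => b; apply/funext => c; rewrite gS (negPf pz) andbT.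
  by rewrite !muln1 e.
have e : good_below z.+1 = (fun b c => good_below z b c && good k m s l z b c).
  by apply/funext => b; apply/funext => c; rewrite gS pz.
have pg : periodic2 (z ^ 2) (fun b c => good k m s l z b c).
  by move=> b c; apply: good_modn.
have z20 : (0 < z ^ 2)%N by rewrite expn_gt0 prime_gt0.
have co : coprime (sieve_modulus z) (z ^ 2).
  rewrite coprimeXr // /sieve_modulus big_nat_cond.
  apply: (big_ind (fun x => coprime x z)); first exact: coprime1n.
    by move=> x y hx hy; rewrite coprimeMl hx.
  move=> p /andP[/andP[_ pz'] pp]; rewrite coprimeXl // prime_coprime // dvdn_prime2 //.
  by rewrite neq_ltn pz'.
split; last by rewrite e box_count_crt ?sieve_modulus_gt0 // IHc.
rewrite e => b c; have [h1 _] := periodic2_mul (z ^ 2) IHp.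
by have [_ h2] := periodic2_mul (sieve_modulus z) pg; rewrite h1 h2.
Qed.
End FiniteSieve.

(** * The constant *)

Definition Lambda_factor (R : realType) (n p : nat) : R :=
  if (p ^ 2 <= n)%N then (p%:R ^+ 2)^-1 else 1 - n%:R / p%:R ^+ 2.

(** The Euler factor at p of the announced constant without lambda_G, delta and zeta(2): Lambda_n,
    then phi(kappa)/kappa^2, 1/l and 1/rho^2, where g stands for gcd(d, n). *)
Definition local_factor (R : realType) (n m l g p : nat) : R :=
  Lambda_factor R n p *
  ((if (p %| m * l)%N then p.-1%:R / p%:R ^+ 2 else 1) *
  ((if (p %| l)%N then p%:R^-1 else 1) *
   (if (p %| g)%N then (p%:R ^+ 2)^-1 else 1))).

Lemma Lambda_factor_itv (R : realType) (n p : nat) : (0 < p)%N ->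
  0 <= Lambda_factor R n p <= 1.
Proof.
move=> p0; have pR : 1 <= p%:R :> R by rewrite ler1n.
have p2 : 0 < p%:R ^+ 2 :> R by rewrite exprn_gt0 // ltr0n.
rewrite /Lambda_factor; case: leqP => h; apply/andP; split.
- by rewrite invr_ge0 ltW.
- by rewrite invf_le1 // exprn_ege1.
- by rewrite subr_ge0 ler_pdivrMr // mul1r -natrX ler_nat ltnW.
- by rewrite gerBl divr_ge0 // ltW.
Qed.

(** The 3 matches the three classes lost in [local_count_generic]. For p^2 <= n the claim is 4/p^2
    <= 1. *)
Lemma Lambda_factor_le (R : realType) (n p : nat) : (2 < n)%N -> (1 < p)%N ->
  Lambda_factor R n p <= 1 - 3 / p%:R ^+ 2.
Proof.
move=> n3 p1; have p2 : 0 < p%:R ^+ 2 :> R by rewrite exprn_gt0 // ltr0n ltnW.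
rewrite /Lambda_factor; case: leqP => h.
  have h4 : 4 <= p%:R ^+ 2 :> R.
    by rewrite -natrX ler_nat -[4%N]/(2 ^ 2)%N leq_exp2r.
  rewrite lerBrDr -[X in X + _]mul1r -mulrDl ler_pdivrMr //; lra.
by rewrite lerB // ler_wpM2r ?invr_ge0 ?(ltW p2) // ler_nat.
Qed.

(** For n = 3 the value comes from the other branch, as 1 - 3/4. *)
Lemma Lambda_factor2 (R : realType) (n : nat) : (2 < n)%N ->
  Lambda_factor R n 2%N = 4^-1.
Proof.
move=> n3; rewrite /Lambda_factor; case: ifP => [_|/negbT]; first by field.
rewrite -ltnNge ltnS => h; have -> : n = 3%N by apply/eqP; rewrite eqn_leq n3 andbT.
by field.
Qed.

Section LocalDensity.
Variables (R : realType) (k m l : nat) (s : int).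
Hypotheses (m1 : (1 < m)%N) (pl : prime l).
Let g := gcdn `|(s ^+ 2)%R| k.+3.
Hypothesis hg : forall p, prime p -> (p %| m * l)%N -> ~~ (p %| g)%N.

(** There are p^4 pairs modulo p^2. The coprimality hypothesis [hg] keeps the factor 1/p^2 from rho
    apart from those of kappa, so each case meets a single local count. *)
Lemma local_density (p : nat) : prime p ->
  local_factor R k.+3 m l g p * p%:R ^+ 4 <= (local_count k m s l p)%:R.
Proof.
move=> pp; have p1 := prime_gt1 pp; have p0 := prime_gt0 pp.
have pR : 1 < p%:R :> R by rewrite ltr1n.
have pR0 : 0 < p%:R :> R by rewrite ltr0n.
have pn0 : p%:R != 0 :> R by rewrite gt_eqF.
have p1R : p.-1%:R = p%:R - 1 :> R by rewrite -subn1 natrB.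
have /andP[L0 L1] := Lambda_factor_itv R k.+3 p0.
rewrite /local_factor.
have [epl|npl] := eqVneq p l.
  have -> : (p %| m * l)%N by rewrite epl dvdn_mull.
  have -> : (p %| l)%N by rewrite epl.
  have -> : (p %| g)%N = false.
    by apply/negbTE/hg => //; rewrite epl dvdn_mull.
  have := local_count_eisenstein k m s pp epl; rewrite -(ler_nat R) natrM.
  apply: le_trans; rewrite mulr1 -mulrA; apply: le_trans (ler_wpM2r _ L1) _.
    by rewrite mulr_ge0 ?exprn_ge0 ?mulr_ge0 ?invr_ge0 ?exprn_ge0 ?ler0n.
  by rewrite mul1r le_eqVlt; apply/orP; left; apply/eqP; field.
have epl : (p %| l)%N = false by rewrite dvdn_prime2 // (negbTE npl).
rewrite epl mul1r Euclid_dvdM // epl orbF.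
have ps_g : (p %| g)%N = (p%:Z %| s)%Z && (p %| k.+3)%N.
  by rewrite /g dvdn_gcd abszX Euclid_dvdX // andbT dvdzE.
have [pm|pm] := boolP (p %| m)%N.
  have -> : (p %| g)%N = false by apply/negbTE/hg => //; rewrite dvdn_mulr.
  rewrite mulr1.
  have [hk|hk] : ((0 < k)%N \/ (p%:Z %| s)%Z) \/ (k = 0%N /\ ~~ (p%:Z %| s)%Z).
  - case: (posnP k) => [k0|]; last by left; left.
    by case: (boolP (p%:Z %| s)%Z) => h; [left; right|right].
  - have := local_count_prime_dvd_const m pp npl hk; rewrite -(ler_nat R) natrM natrX.
    apply: le_trans; apply: le_trans (_ : p.-1%:R / p%:R ^+ 2 * p%:R ^+ 4 <= _).
      by rewrite ler_wpM2r ?exprn_ge0 ?ler0n // ler_piMl // divr_ge0 ?exprn_ge0 ?ler0n.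
    by rewrite le_eqVlt; apply/orP; left; apply/eqP; field.
  case: hk => k0 ps.
  have [p2|p2] := eqVneq p 2%N.
    have qm : (2 %| m)%N by rewrite -p2.
    have qs : ~~ (2%:Z %| s)%Z by rewrite -p2.
    have := local_count_cubic2 pp npl k0 qm qs p2.
    rewrite -(ler_nat R); apply: le_trans.
    by rewrite p1R p2 Lambda_factor2 // le_eqVlt; apply/orP; left; apply/eqP; field.
  have [p3|p3] := eqVneq p 3%N.
    have qm : (3 %| m)%N by rewrite -p3.
    have qs : ~~ (3%:Z %| s)%Z by rewrite -p3.
    have := local_count_cubic3 pp npl k0 qm qs p3.
    rewrite -(ler_nat R); apply: le_trans.
    rewrite p1R p3 k0 /Lambda_factor /=.
    by rewrite le_eqVlt; apply/orP; left; apply/eqP; field.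
  have p5 : (5 <= p)%N.
    have p4 : p != 4%N by apply: contraTneq pp => ->.
    by move: p1 p2 p3 p4; clear; lia.
  have := local_count_cubic pp npl k0 pm ps p5.
  rewrite -(ler_nat R); apply: le_trans.
  apply: le_trans (_ : p.-1%:R / p%:R ^+ 2 * p%:R ^+ 4 <= _).
    by rewrite ler_wpM2r ?exprn_ge0 ?ler0n // ler_piMl // divr_ge0 ?exprn_ge0 ?ler0n.
  rewrite [leLHS](_ : _ = p%:R ^+ 2 * p.-1%:R); last by field.
  by rewrite -natrX -natrM ler_nat leq_mul2l; apply/orP; right; move: p5; clear; lia.
rewrite mul1r ps_g.
have gen : ~~ (p %| k.+3)%N \/ ~~ (p%:Z %| 2 * s)%Z ->
    Lambda_factor R k.+3 p * p%:R ^+ 4 <= (local_count k m s l p)%:R.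
  move=> hn; have := local_count_generic pp npl m1 pm hn; rewrite -(ler_nat R).
  apply: le_trans; apply: le_trans (_ : (1 - 3 / p%:R ^+ 2) * p%:R ^+ 4 <= _).
    by rewrite ler_wpM2r ?exprn_ge0 ?ler0n // Lambda_factor_le.
  have p4 : (4 <= p ^ 2)%N by rewrite -[4%N]/(2 ^ 2)%N leq_exp2r.
  rewrite natrM natrX natrB ?(leq_trans _ p4) // natrX.
  by rewrite le_eqVlt; apply/orP; left; apply/eqP; field.
have [pn|pn] := boolP (p %| k.+3)%N; last by rewrite andbF mulr1 gen //; left.
rewrite andbT; have [ps|ps] := boolP (p%:Z %| s)%Z.
  have := local_count_prime_dvd_const m pp npl (or_intror ps : (0 < k)%N \/ _).
  rewrite -(ler_nat R); apply: le_trans.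
  apply: le_trans (_ : (p%:R ^+ 2)^-1 * p%:R ^+ 4 <= _).
    by rewrite ler_wpM2r ?exprn_ge0 ?ler0n // ler_piMl // invr_ge0 ?exprn_ge0 ?ler0n.
  rewrite [leLHS](_ : _ = p%:R ^+ 2); last by field.
  by rewrite -natrX ler_nat leq_pmulr // -ltnS prednK.
rewrite mulr1; have [p2|p2] := eqVneq p 2%N; last first.
  apply: gen; right; move: ps; rewrite !dvdzE abszM Euclid_dvdM // => /negPf->.
  by rewrite orbF /= dvdn_prime2.
have k0 : (0 < k)%N by move: pn; rewrite p2; case: (k).
have := local_count_prime_dvd_const m pp npl (or_introl k0 : _ \/ (p%:Z %| s)%Z).
rewrite -(ler_nat R) natrM natrX p1R; apply: le_trans.
by rewrite p2 Lambda_factor2 // le_eqVlt; apply/orP; left; apply/eqP; field.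
Qed.
End LocalDensity.

(** Factors in [0, 1] make the partial products decrease, so the limit exists and lies below each of
    them. *)
Lemma prime_prod_itv (R : realType) (P : pred nat) (u : nat -> R) (z : nat) :
  (forall p, prime p -> P p -> 0 <= u p <= 1) ->
  0 <= prime_prod P u <= \prod_(0 <= p < z | prime p && P p) u p.
Proof.
move=> hu; rewrite /prime_prod; set v := fun N : nat => _.
have v0 N : 0 <= v N by apply: prodr_ge0 => p /andP[pp Pp]; case/andP: (hu p pp Pp).
have vd : nonincreasing_seq v.
  apply/nonincreasing_seqP => N; rewrite /v big_mkcond big_nat_recr //= -big_mkcond.
  case: ifP => [/andP[pp Pp]|_]; last by rewrite mulr1.
  by rewrite ler_piMr ?v0 //; case/andP: (hu N pp Pp).
have vc : cvgn v.
  by apply: nonincreasing_is_cvgn => //; exists 0 => _ [N _ <-].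
apply/andP; split; first by apply: limr_ge => //; apply: nearW.
exact: nonincreasing_cvgn_ge.
Qed.

Lemma prod_primes_range (R : comNzRingType) (F : nat -> R) (N z : nat) :
  (0 < N < z)%N ->
  \prod_(p <- primes N) F p =
  \prod_(0 <= p < z | prime p) (if (p %| N)%N then F p else 1).
Proof.
move=> /andP[N0 Nz]; rewrite -big_mkcondr -[RHS]big_filter; apply: perm_big.
apply: uniq_perm; rewrite ?primes_uniq ?filter_uniq ?iota_uniq // => p.
rewrite mem_filter mem_primes mem_index_iota N0 /=.
case: (prime p) => //=; case: (boolP (p %| N)%N) => //= pN.
by rewrite (leq_ltn_trans _ Nz) // dvdn_leq.
Qed.

Lemma totient_prod_primes (s : seq nat) : uniq s -> all prime s ->
  totient (\prod_(p <- s) p) = (\prod_(p <- s) p.-1)%N.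
Proof.
elim: s => [|p s IH] /=; first by rewrite !big_nil.
move=> /andP[ps us] /andP[pp al]; rewrite !big_cons totient_coprime ?IH ?totient_prime //.
rewrite big_seq; apply: (big_ind (coprime p)); first exact: coprimen1.
  by move=> x y px py; rewrite coprimeMr px.
move=> q qs; have pq := allP al q qs.
by rewrite prime_coprime // dvdn_prime2 //; apply: contraNneq ps => ->.
Qed.

Lemma totient_radn (R : realType) (N z : nat) : (0 < N < z)%N ->
  (totient (radn N))%:R / (radn N)%:R ^+ 2 =
  \prod_(0 <= p < z | prime p) (if (p %| N)%N then p.-1%:R / p%:R ^+ 2 else 1) :> R.
Proof.
move=> hN; rewrite -(prod_primes_range _ hN) big_split /= prodfV; congr (_ / _).
  rewrite /radn totient_prod_primes ?natr_prod ?primes_uniq //.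
  by apply/allP => p; rewrite mem_primes => /andP[].
by rewrite /radn natr_prod prodrXl.
Qed.

Lemma inv_radn_sq (R : realType) (N z : nat) : (0 < N < z)%N ->
  ((radn N)%:R ^+ 2)^-1 =
  \prod_(0 <= p < z | prime p) (if (p %| N)%N then (p%:R ^+ 2)^-1 else 1) :> R.
Proof.
move=> hN; rewrite -(prod_primes_range _ hN) prodfV; congr (_^-1).
by rewrite /radn natr_prod prodrXl.
Qed.

Lemma inv_prime_range (R : realType) (l z : nat) : prime l -> (l < z)%N ->
  l%:R^-1 = \prod_(0 <= p < z | prime p) (if (p %| l)%N then p%:R^-1 else 1) :> R.
Proof.
move=> pl lz; rewrite -prod_primes_range ?prime_gt0 //.
by rewrite primes_prime // big_seq1.
Qed.

Lemma Lambda_le (R : realType) (n z : nat) : (n < z)%N ->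
  0 <= Lambda R n <= \prod_(0 <= p < z | prime p) Lambda_factor R n p.
Proof.
move=> nz.
have hu p : prime p -> (n < p ^ 2)%N -> 0 <= (1 - n%:R / p%:R ^+ 2 : R) <= 1.
  move=> pp h; have := Lambda_factor_itv R n (prime_gt0 pp).
  have np : (p ^ 2 <= n)%N = false by apply/negbTE; rewrite -ltnNge.
  by rewrite /Lambda_factor np.
have /andP[h0 h1] := prime_prod_itv z hu.
have A0 : 0 <= \prod_(0 <= p < n.+1 | prime p && (p ^ 2 <= n)%N) ((p%:R : R) ^+ 2)^-1.
  by apply: prodr_ge0 => p _; rewrite invr_ge0 exprn_ge0.
rewrite /Lambda mulr_ge0 //= [leRHS](bigID (fun p => (p ^ 2 <= n)%N)) /=.
have -> : \prod_(0 <= p < z | prime p && (p ^ 2 <= n)%N) Lambda_factor R n p =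
    \prod_(0 <= p < n.+1 | prime p && (p ^ 2 <= n)%N) ((p%:R : R) ^+ 2)^-1.
  rewrite (big_cat_nat (n := n.+1)) //= [X in _ * X]big_nat_cond [X in _ * X]big_pred0 ?mulr1.
    by apply: eq_bigr => p /andP[_ h]; rewrite /Lambda_factor h.
  move=> p; apply/negbTE/negP => /andP[/andP[np _] /andP[_ h]].
  have : (p <= p ^ 2)%N by case: (p) => // q; rewrite -{1}(expn1 q.+1) leq_pexp2l.
  by move/leq_trans/(_ h); rewrite leqNgt np.
rewrite ler_wpM2l //; apply: le_trans h1 _; rewrite le_eqVlt; apply/orP; left; apply/eqP.
apply: eq_big => [p|p /andP[_ h]]; first by rewrite ltnNge.
have np : (p ^ 2 <= n)%N = false by apply/negbTE; rewrite -ltnNge.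
by rewrite /Lambda_factor np.
Qed.

Lemma lambda_G_itv (R : realType) (n : nat) (a : int) : 0 <= lambda_G R n a <= 1.
Proof.
have hu p : prime p -> predT p ->
   0 <= (1 - (omega_G n a p)%:R / (p ^ (2 + q_G n a p))%N%:R : R) <= 1.
  move=> pp _; have N0 : (0 < p ^ (2 + q_G n a p))%N by rewrite expn_gt0 prime_gt0.
  have NR : 0 < (p ^ (2 + q_G n a p))%N%:R :> R by rewrite ltr0n.
  rewrite subr_ge0 ler_pdivrMr // mul1r ler_nat gerBl divr_ge0 ?(ltW NR) // andbT.
  rewrite /omega_G; apply: (@leq_trans (\sum_(1 <= t < (p ^ (2 + q_G n a p)).+1) 1)%N).
    by apply: leq_sum => t _; apply: leq_b1.
  by rewrite sum_nat_const_nat muln1 subn1.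
by have := prime_prod_itv 0 hu; rewrite big_geq.
Qed.

(** Convergence has to be shown before [limn] can be compared with a partial sum; the bound 2 is the
    first term plus a telescoping tail. *)
Lemma zeta2_ge1 (R : realType) : 1 <= zeta (2 : R).
Proof.
rewrite /zeta; set u := fun k : nat => _.
have uE k : u k = ((k.+1%:R : R) ^+ 2)^-1 by rewrite /u -[2]/(2%:R) powR_mulrn.
have u0 k : 0 <= u k by rewrite uE invr_ge0 exprn_ge0.
have nd : nondecreasing_seq (series u).
  by apply/nondecreasing_seqP => N; rewrite /series /= big_nat_recr //= lerDl.
have cv : cvgn (series u).
  apply: nondecreasing_is_cvgn => //; exists 2 => _ [N _ <-].
  rewrite /series /=; case: N => [|N]; first by rewrite big_geq.
  rewrite big_nat_recl // uE expr1n invr1 -[X in _ <= X]/(1 + 1) lerD2l.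
  have := @sum_inv_sq_le R 2 N.+2 isT.
  have -> : ((2%:R : R) - 1)^-1 = 1 by rewrite -natr1 addrK invr1.
  apply: le_trans; rewrite -[2%N]add0n big_addn -addn2 addnK le_eqVlt.
  by apply/orP; left; apply/eqP; apply: eq_bigr => i _; rewrite uE addn2.
have := nondecreasing_cvgn_le nd cv 1%N; apply: le_trans.
by rewrite /series /= big_nat1 uE expr1n invr1.
Qed.

Lemma density_const_le (R : realType) (n m l g z : nat) (a d : int) :
  (0 < m)%N -> prime l -> (0 < g)%N ->
  (n < z)%N -> (m * l < z)%N -> (g < z)%N ->
  0 <= Lambda R n * lambda_G R n a *
        ((totient (radn (m * l)))%:R /
          ((delta m d)%:R * l%:R * (radn (m * l))%:R ^+ 2 * zeta (2 : R)
             * (radn g)%:R ^+ 2))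
  <= \prod_(0 <= p < z | prime p) local_factor R n m l g p.
Proof.
move=> m0 pl g0 nz mlz gz.
have l0 := prime_gt0 pl.
have lz : (l < z)%N by apply: leq_ltn_trans mlz; rewrite leq_pmull.
have ml0 : (0 < m * l < z)%N by rewrite muln_gt0 m0 l0.
have /andP[L0 L1] := Lambda_le R nz.
have /andP[G0 G1] := lambda_G_itv R n a.
have z1 := zeta2_ge1 R.
rewrite !big_split /= -(totient_radn R ml0) -inv_prime_range // -inv_radn_sq ?g0 //.
set t : R := (totient _)%:R; set K : R := (radn (m * l))%:R; set r : R := (radn g)%:R.
have t0 : 0 <= t by apply: ler0n.
have K0 : 0 < K by rewrite ltr0n radn_gt0.
have r0 : 0 < r by rewrite ltr0n radn_gt0.
have lR : 0 < l%:R :> R by rewrite ltr0n.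
have d1 : 1 <= (delta m d)%:R :> R by rewrite ler1n /delta; case: ifP.
have d0 : 0 < (delta m d)%:R :> R by apply: lt_le_trans d1.
have zz0 : 0 < zeta (2 : R) by apply: lt_le_trans z1.
have Lg0 : 0 <= Lambda R n * lambda_G R n a by apply: mulr_ge0.
have c0 : 0 <= t / ((delta m d)%:R * l%:R * K ^+ 2 * zeta (2 : R) * r ^+ 2).
  by rewrite divr_ge0 // !mulr_ge0 // ?exprn_ge0 // ltW.
rewrite mulr_ge0 //=; apply: ler_pM => //.
- by apply: le_trans L1; rewrite ler_piMr.
have -> : t / K ^+ 2 * (l%:R^-1 * (r ^+ 2)^-1) = t / (l%:R * K ^+ 2 * r ^+ 2).
  by field; rewrite !gt_eqF.
rewrite ler_wpM2l // lef_pV2 ?posrE ?mulr_gt0 ?exprn_gt0 //.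
have W0 : 0 < l%:R * K ^+ 2 * r ^+ 2 by rewrite !mulr_gt0 ?exprn_gt0.
rewrite [leRHS](_ : _ = (delta m d)%:R * zeta (2 : R) * (l%:R * K ^+ 2 * r ^+ 2)); last by ring.
by rewrite ler_peMl ?(ltW W0) // mulr_ege1.
Qed.

(** * The lower bound *)

Lemma count_pairs_sieve (k m l z B C : nat) (s : int) :
  (1 < m)%N -> prime l -> (l%:Z %| s)%Z ->
  (\sum_(1 <= b < B.+1) \sum_(1 <= c < C.+1) good_below k m l s z b c <=
   count_pairs k.+3 m (2 * s) (s ^+ 2) B C +
   \sum_(1 <= b < B.+1) \sum_(1 <= c < C.+1) `[< exists2 p, prime p &
     (z <= p)%N && ~~ good k m s l p b c >])%N.
Proof.
move=> m1 pl ls; rewrite /count_pairs -big_split; apply: leq_sum => b _ /=.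
rewrite -big_split; apply: leq_sum => c _ /=.
have [hg|//] := boolP (good_below k m l s z b c).
case: (asboolP (exists2 p, _ & _)) => [_|nbad]; first by rewrite addn1.
rewrite addn0 lt0b; apply/asboolP; apply: (good_monogenic (l := l)) => //; first exact: ltnW.
move=> p pp; have [pz|zp] := ltnP p z.
  by move/allP/(_ p): hg; rewrite mem_iota /= pz pp; apply.
by apply: contrapT => /negP ng; apply: nbad; exists p => //; rewrite zp.
Qed.

Lemma good_below_lower (R : realType) (k m l z B C : nat) (s : int) (c0 : R) :
  0 <= c0 -> c0 * (\prod_(0 <= p < z | prime p) p%:R ^+ 4) <=
    \prod_(0 <= p < z | prime p) (local_count k m s l p)%:R ->
  (sieve_modulus z <= B)%N -> (sieve_modulus z <= C)%N ->
  c0 * (B%:R * C%:R) - c0 * (sieve_modulus z)%:R * (B%:R + C%:R) <=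
  (\sum_(1 <= b < B.+1) \sum_(1 <= c < C.+1) good_below k m l s z b c)%N%:R.
Proof.
move=> c00 hc; set Q := sieve_modulus z => QB QC.
have [hp hcnt] := good_below_count k m l s z.
have := box_sum_ge B C hp; rewrite -/Q hcnt -(ler_nat R); apply: le_trans.
have Q0 : (0 < Q)%N := sieve_modulus_gt0 z.
have eQ : \prod_(0 <= p < z | prime p) p%:R ^+ 4 = (Q%:R * Q%:R : R).
  rewrite /Q /sieve_modulus natr_prod -big_split /=; apply: eq_bigr => p _.
  by rewrite natrX -exprD.
rewrite eQ in hc; rewrite natrM natr_prod natrM.
have hq X : (Q <= X)%N -> 0 <= (X%:R - Q%:R : R) <= (X %/ Q)%:R * Q%:R.
  move=> QX; rewrite subr_ge0 ler_nat QX lerBlDr -natrM -natrD ler_nat.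
  by rewrite {1}(divn_eq X Q) leq_add2l ltnW // ltn_pmod.
have /andP[B0 hB] := hq B QB; have /andP[C0 hC] := hq C QC.
apply: le_trans (ler_wpM2l _ hc); last by rewrite mulr_ge0.
(* Complete boxes cover at least (B - Q)(C - Q) pairs; the term Q^2 is then discarded. *)
have := ler_wpM2l c00 (ler_pM B0 C0 hB hC).
have : 0 <= c0 * (Q%:R * Q%:R) by rewrite !mulr_ge0.
move: ((B %/ Q)%:R) ((C %/ Q)%:R) (Q%:R) (B%:R) (C%:R) => x y q u v; nra.
Qed.

Lemma count_pairs_lower (R : realType) (k m l : nat) (s : int) (c0 e : R) :
  abc_conjecture R -> (1 < m)%N -> prime l -> (l%:Z %| s)%Z -> 0 < e ->
  0 <= c0 ->
  (exists z1, forall z, (z1 <= z)%N ->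
     c0 * (\prod_(0 <= p < z | prime p) p%:R ^+ 4) <=
       \prod_(0 <= p < z | prime p) (local_count k m s l p)%:R) ->
  exists N : nat, forall B C : nat, (N <= B)%N -> (N <= C)%N ->
    (c0 - e) * (B%:R * C%:R) <= (count_pairs k.+3 m (2 * s) (s ^+ 2) B C)%:R.
Proof.
move=> abc m1 pl ls e0 c00 [z1 hz1].
have e20 : 0 < e / 2 by rewrite divr_gt0.
have [z0 hz0] := sieve_negligible_bad k l s abc m1 e20.
pose z := maxn z0 z1; have [N hN] := hz0 z (leq_maxl _ _).
have hz := hz1 z (leq_maxr _ _).
set Q := sieve_modulus z.
(* Beyond this threshold each of the boundary terms c0 Q B and c0 Q C is at most (e/4) B C; the
   large primes take the remaining e/2. *)
exists (N + Q + (Num.truncn (c0 * Q%:R / (e / 4))).+1)%N => B C hB hC.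
have QB : (Q <= B)%N by apply: leq_trans hB; rewrite addnAC leq_addl.
have QC : (Q <= C)%N by apply: leq_trans hC; rewrite addnAC leq_addl.
have NB : (N <= B)%N by apply: leq_trans hB; rewrite -addnA leq_addr.
have NC : (N <= C)%N by apply: leq_trans hC; rewrite -addnA leq_addr.
have e40 : 0 < e / 4 by rewrite divr_gt0.
have hQ X : (N + Q + (Num.truncn (c0 * Q%:R / (e / 4))).+1 <= X)%N ->
    c0 * Q%:R <= X%:R * (e / 4).
  move=> hX; rewrite -ler_pdivrMr //; apply: truncnS_le.
  by apply: leq_trans hX; rewrite leq_addl.
have h1 := good_below_lower c00 hz QB QC.
have h2 := count_pairs_sieve k z B C m1 pl ls; rewrite -(ler_nat R) natrD in h2.
have h3 := hN B C NB NC.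
have h4 := ler_wpM2r (ler0n R C) (hQ B hB).
have h5 := ler_wpM2r (ler0n R B) (hQ C hC).
have h6 := le_trans h1 h2.
rewrite -/Q in h6; move: h3 h4 h5 h6.
move: ((count_pairs _ _ _ _ _ _)%:R) ((\sum_(1 <= b < B.+1) _)%N%:R) => x y.
move: (Q%:R) (B%:R) (C%:R) => q u v; lra.
Qed.

Theorem theorem3 (R : realType) (a d : int) (n m l : nat)
  (had : a ^+ 2 = 4 * d) (hd1 : d <> 1) (hdN1 : d <> -1)
  (hn : (3 <= n)%N) (hm : (2 <= m)%N)
  (hl : prime l) (hld : (l%:Z %| d)%Z) (hln : ~~ (l %| n)%N) :
  let rho := radn (gcdn `|d|%N n) in
  let kappa := radn (m * l) in
  gcdn kappa rho = 1%N ->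
  abc_conjecture R ->
  exists e : nat * nat -> R,
    e =o_ (filter_prod \oo \oo) (fun BC : nat * nat => BC.1%:R * BC.2%:R : R) /\
    forall B C : nat, (0 < B)%N -> (0 < C)%N ->
      Lambda R n * lambda_G R n a *
        ((totient kappa)%:R /
          ((delta m d)%:R * l%:R * kappa%:R ^+ 2 * zeta (2 : R) * rho%:R ^+ 2))
        * (B%:R * C%:R) + e (B, C)
      <= (count_pairs n m a d B C)%:R.
Proof.
case: n hn hln => [|[|[|k]]] // _ hln rho kappa cop abc.
have [s es] : exists s, a = 2 * s.
  have : (2%:Z %| a ^+ 2)%Z by rewrite had -[4]/(2 * 2 : int) -mulrA dvdz_mulr.
  rewrite dvdzE abszX Euclid_dvdX // andbT -(dvdzE 2%:Z) => /dvdzP[s ->].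
  by exists s; rewrite mulrC.
have ed : d = s ^+ 2.
  by apply: (@mulfI _ (4 : int)) => //; rewrite -had es; ring.
have ls : (l%:Z %| s)%Z by move: hld; rewrite ed dvdzE abszX Euclid_dvdX // andbT.
pose g := gcdn `|(s ^+ 2)%R| k.+3.
have g0 : (0 < g)%N by rewrite gcdn_gt0 orbT.
have hg p : prime p -> (p %| m * l)%N -> ~~ (p %| g)%N.
  move=> pp pml; apply/negP => pg.
  have : (p %| gcdn kappa rho)%N.
    rewrite dvdn_gcd /kappa /rho ed; apply/andP; split; apply: dvdn_radn => //.
    by rewrite muln_gt0 (prime_gt0 hl) (ltnW hm).
  by rewrite cop Euclid_dvd1.
have m0 := ltnW hm.
set c0 : R := _ * (_ / _).
have hc0 z : (k.+3 + m * l + g < z)%N -> 0 <= c0 /\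
    c0 <= \prod_(0 <= p < z | prime p) local_factor R k.+3 m l g p.
  move=> hz; apply/andP; have := @density_const_le R k.+3 m l g z a d m0 hl g0.
  rewrite /c0 /kappa /rho ed; apply; apply: leq_ltn_trans hz.
  - by rewrite -addnA leq_addr.
  - by rewrite addnAC leq_addl.
  - exact: leq_addl.
have [c00 _] := hc0 _ (ltnSn _).
pose cnt B C : R := (count_pairs k.+3 m a d B C)%:R.
(* The error is the negative part of the deficit: the inequality becomes immediate, and its being
   o(BC) is exactly [count_pairs_lower] for every e. *)
exists (fun BC => Num.min 0 (cnt BC.1 BC.2 - c0 * (BC.1%:R * BC.2%:R))); split; last first.
  by move=> B C _ _; rewrite -lerBrDl ge_min lexx orbT.
apply/eqoP => e /= e0.
have [|N hN] := @count_pairs_lower R k m l s c0 e abc hm hl ls e0 c00.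
  exists (k.+3 + m * l + g).+1 => z hz; have [_ h] := hc0 z hz.
  apply: le_trans (_ : (\prod_(0 <= p < z | prime p) local_factor R k.+3 m l g p) *
     (\prod_(0 <= p < z | prime p) p%:R ^+ 4) <= _).
    by rewrite ler_wpM2r // prodr_ge0.
  rewrite -big_split /= big_mkcond [leRHS]big_mkcond; apply: ler_prod => p _.
  case: ifP => [pp|_]; last by rewrite ler01 lexx.
  rewrite (local_density R hm hl hg pp) andbT mulr_ge0 ?exprn_ge0 //.
  have /andP[L0 _] := Lambda_factor_itv R k.+3 (prime_gt0 pp).
  rewrite /local_factor !mulr_ge0 //.
  - by case: ifP => // _; rewrite divr_ge0 ?exprn_ge0.
  - by case: ifP => // _; rewrite invr_ge0.
  - by case: ifP => // _; rewrite invr_ge0 exprn_ge0.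
exists ([set B | (N <= B)%N], [set C | (N <= C)%N]) => /=.
  by split; exists N.
move=> [B C] /= [hB hC]; have h := hN B C hB hC.
rewrite -es -ed -/(cnt B C) mulrBl in h.
rewrite normrM !normr_nat ler0_norm ?ge_min ?lexx // oppr_min oppr0 ge_max.
rewrite mulr_ge0 ?(ltW e0) ?mulr_ge0 //=; lra.
Qed.
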